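(* Let $d\ge 3$ and $p\in(d,+\infty]$ (with $1/p=0$ if $p=\infty$). There exists a constant $C_0\ge 1$, depending only on $p$ and $d$, such that the following holds. Let $u_0\in L^p_\sigma(\mathbb{R}^d)$ and let $T_0>\bar T(d,p,\|u_0\|_{L^p})$, where the guaranteed existence time $\bar T$ is defined by $\|u_0\|_{L^p}\bar T^{\frac12(1-\frac dp)}=c_p$. Define $\gamma$ by $$\|u_0\|_{L^p}\,T_0^{\frac12(1-\frac dp)}\,\gamma=c_p$$ (so $\gamma\in(0,1)$), and define $T_1>0$ by $$\|u_0\|_{L^p}\,T_1^{\frac12(1-\frac dp)}=\frac{\gamma}{2C_1}$$ (so $T_1<\bar T$). If $u_0$ is $(\varepsilon,\beta,\ell)$-sparse in $L^p$, where $\ell=\sqrt{T_1}\,\bar\ell$ and the dimensionless parameters $\varepsilon,\beta\in(0,1)$, $\bar\ell>0$ satisfy $$\bar\ell^2\ge C_0\log(C_0/\gamma),\qquad \beta=C_0^{-1}\gamma,\qquad \varepsilon^{1-\frac1p}\le C_0^{-1}\gamma/\bar\ell^{\,d},$$ then the unique strong solution of the Navier--Stokes equations with initial data $u_0$ extends past time $T_0$.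
   Context: Navier--Stokes equations on $\mathbb{R}^d$: $\partial_t u+u\cdot\nabla u-\Delta u+\nabla p=0$, $\operatorname{div}u=0$, $u(\cdot,0)=u_0$. $L^p_\sigma(\mathbb{R}^d)$ is the space of (weakly) divergence-free vector fields in $L^p(\mathbb{R}^d)$. A mild solution satisfies $u(\cdot,t)=e^{t\Delta}u_0-\int_0^t e^{(t-s)\Delta}\mathbb{P}\nabla\cdot(u\otimes u)\,ds$, with $\mathbb{P}$ the Leray projector; the strong ($L^p$) solution on $(0,T)$ is the unique mild solution that is in $C((0,T);L^p)$ and is bounded in $L^p$ on $(0,T')$ for each $T'<T$. It has a maximal time of existence $T^*(u_0)$; ''extends past time $T_0$'' means $T^*(u_0)>T_0$. Constants. $c_p\in(0,1]$ is a fixed small constant (depending on $d,p$) such that for each $u_0\in L^p_\sigma$, with $\bar T$ defined by $\|u_0\|_{L^p}\bar T^{\frac12(1-\frac dp)}=c_p$, there is a unique mild solution $u\in C((0,\bar T];L^p)$, and it satisfies $\sup_{t\in(0,\bar T)}\|u(\cdot,t)\|_{L^p}\le 2\|u_0\|_{L^p}$. $C_1\ge(2c_p)^{-1}$ is a fixed constant (depending on $d,p$) such that for all such $u_0$ and all $t\in(0,\bar T)$, $\big\|\int_0^t e^{(t-s)\Delta}\mathbb{P}\nabla\cdot(u\otimes u)\,ds\big\|_{L^p}\le C_1t^{\frac12(1-\frac dp)}\|u_0\|_{L^p}^2$. Sparseness. For $1\le p\le\infty$, $\varepsilon,\beta\in(0,1)$, $\ell>0$, a vector field $v\in L^p(\mathbb{R}^d)$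 is $(\varepsilon,\beta,\ell)$-sparse in $L^p$ if there is a measurable set $S\subset\mathbb{R}^d$ with $\|v\|_{L^p(S^c)}<\beta\|v\|_{L^p}$ and $\sup_{x_0\in\mathbb{R}^d}|S\cap B_\ell(x_0)|/|B_\ell(x_0)|\le\varepsilon$. *)

(* Defs.v *)
From HB Require Import structures.
From mathcomp Require Import all_boot all_order all_algebra.
From mathcomp Require Import all_classical all_reals all_analysis.
Import Order.TTheory GRing.Theory Num.Theory.
Import numFieldNormedType.Exports.

Set Implicit Arguments.
Unset Strict Implicit.
Unset Printing Implicit Defensive.

Local Open Scope classical_set_scope.
Local Open Scope ring_scope.

Section measurable_rV.
Variables (R : realType) (n : nat).

Let coord (i : 'I_n) (v : 'rV[R]_n) : measurableTypeR R := v ord0 i.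

Let rV_set0 : g_sigma_preimage coord set0.
Proof. exact: sigma_algebra0. Qed.

Let rV_setC A : g_sigma_preimage coord A -> g_sigma_preimage coord (~` A).
Proof. exact: sigma_algebraC. Qed.

Let rV_bigcup (F : (set 'rV[R]_n)^nat) :
  (forall i, g_sigma_preimage coord (F i)) ->
  g_sigma_preimage coord (\bigcup_i (F i)).
Proof. exact: sigma_algebra_bigcup. Qed.

Definition rV_display : measure_display.
Proof. exact: default_measure_display. Qed.

HB.instance Definition _ := @isMeasurable.Build rV_display
  'rV[R]_n (g_sigma_preimage coord) rV_set0 rV_setC rV_bigcup.

End measurable_rV.


Section measurable_rV_lemmas.
Variable R : realType.

Lemma measurable_coord n (i : 'I_n) :
  measurable_fun [set: 'rV[R]_n] (fun v => v ord0 i : measurableTypeR R).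
Proof.
move=> _ Y mY; rewrite setTI; apply: sub_sigma_algebra => /=.
rewrite -bigcup_seq/=; exists i => /=; first by rewrite mem_index_enum.
by exists Y => //; rewrite setTI.
Qed.

Lemma measurable_fun_rVP d (T : measurableType d) n (f : T -> 'rV[R]_n) :
  measurable_fun setT f <->
  forall i, measurable_fun setT (fun x => f x ord0 i : measurableTypeR R).
Proof.
split=> [mf i|mf].
  exact: (measurableT_comp (measurable_coord i) mf).
move=> _ Y mY; rewrite setTI.
suff : measurable `<=` [set A | measurable (f @^-1` A)] by apply.
apply: smallest_sub.
  split => /=.
  - by rewrite preimage_set0.
  - by move=> A mA; rewrite setTD preimage_setC; exact: measurableC.
  - by move=> F mF; rewrite preimage_bigcup; exact: bigcup_measurable.
rewrite -bigcup_seq => A [i _] [B mB <-] /=.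
rewrite setTI -comp_preimage -[X in measurable X]setTI; exact: mf.
Qed.

Definition rV_cons n (xv : measurableTypeR R * 'rV[R]_n) : 'rV[R]_n.+1 :=
  row_mx (const_mx xv.1 : 'rV_1) xv.2.

Definition rV_uncons n (v : 'rV[R]_n.+1) : measurableTypeR R * 'rV[R]_n :=
  (v ord0 ord0, \row_i v ord0 (lift ord0 i)).

Lemma rV_consE0 n xv : @rV_cons n xv ord0 ord0 = xv.1.
Proof.
transitivity ((const_mx xv.1 : 'rV_1) ord0 ord0); last by rewrite mxE.
rewrite -[RHS](row_mxEl _ xv.2) /rV_cons; congr (row_mx _ _ _ _).
exact/val_inj.
Qed.

Lemma rV_consES n xv i : @rV_cons n xv ord0 (lift ord0 i) = xv.2 ord0 i.
Proof.
rewrite -[RHS](row_mxEr (const_mx xv.1 : 'rV_1)) /rV_cons.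
by congr (row_mx _ _ _ _); exact/val_inj.
Qed.

Lemma rV_consK n : cancel (@rV_cons n) (@rV_uncons n).
Proof.
move=> [x v]; rewrite /rV_uncons rV_consE0; congr pair.
by apply/rowP => i; rewrite mxE rV_consES.
Qed.

Lemma rV_unconsK n : cancel (@rV_uncons n) (@rV_cons n).
Proof.
move=> v; apply/rowP => i; case: (unliftP ord0 i) => [j ->|->].
  by rewrite rV_consES mxE.
by rewrite rV_consE0.
Qed.

Lemma measurable_rV_cons n : measurable_fun setT (@rV_cons n).
Proof.
apply/measurable_fun_rVP => i; case: (unliftP ord0 i) => [j ->|->].
  under eq_fun do rewrite rV_consES.
  exact: (measurableT_comp (measurable_coord j) measurable_snd).
under eq_fun do rewrite rV_consE0.
exact: measurable_fst.
Qed.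

Lemma measurable_rV_uncons n : measurable_fun setT (@rV_uncons n).
Proof.
apply: measurable_fun_pair => /=; first exact: measurable_coord.
apply/measurable_fun_rVP => i; under eq_fun do rewrite mxE.
exact: measurable_coord.
Qed.

Section step.
Variables (n : nat) (m : {sigma_finite_measure set 'rV[R]_n -> \bar R}).

Definition lebesgue_rV_step : set 'rV[R]_n.+1 -> \bar R :=
  pushforward (lebesgue_measure \x m)%E (@rV_cons n).

Let mcons := @measurable_rV_cons n.

Let step0 : lebesgue_rV_step set0 = 0%E.
Proof. exact: measure0. Qed.

Let step_ge0 A : (0 <= lebesgue_rV_step A)%E.
Proof. exact: measure_ge0. Qed.

Let step_sigma_additive : semi_sigma_additive lebesgue_rV_step.
Proof. exact: measure_semi_sigma_additive. Qed.

HB.instance Definition _ := isMeasure.Build _ _ _ lebesgue_rV_step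
  step0 step_ge0 step_sigma_additive.

Let step_sigma_finite : sigma_finite setT lebesgue_rV_step.
Proof.
have /sigma_finiteP[F [FT ndF Foo]] := sigma_finiteT (@lebesgue_measure R).
have /sigma_finiteP[G [GT ndG Goo]] := sigma_finiteT m.
exists (fun k => @rV_uncons n @^-1` (F k `*` G k)).
  apply/seteqP; split => // v _; rewrite -preimage_bigcup /=.
  have [k _ Fk] : (\bigcup_i F i) (v ord0 ord0) by rewrite -FT.
  have [l _ Gl] : (\bigcup_i G i) (rV_uncons v).2 by rewrite -GT.
  exists (maxn k l) => //; split => /=.
    by move: Fk; exact/subsetPset/ndF/leq_maxl.
  by move: Gl; exact/subsetPset/ndG/leq_maxr.
move=> k; have [mF Fk] := Foo k; have [mG Gk] := Goo k; split.
  rewrite -[X in measurable X]setTI.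
  by apply: measurable_rV_uncons => //; exact: measurableX.
rewrite /lebesgue_rV_step /pushforward -comp_preimage.
rewrite (_ : _ \o _ = id) ?preimage_id; last first.
  by apply/funext => x /=; rewrite rV_consK.
by rewrite product_measure1E// lte_mul_pinfty// ge0_fin_numE.
Qed.

HB.instance Definition _ := Measure_isSigmaFinite.Build _ _ _ lebesgue_rV_step
  step_sigma_finite.

End step.
End measurable_rV_lemmas.

Fixpoint lebesgue_rV (R : realType) (n : nat) :
    {sigma_finite_measure set 'rV[R]_n -> \bar R} :=
  match n with
  | 0 => [the {sigma_finite_measure set 'rV[R]_0 -> \bar R} of \d_(0 : 'rV[R]_0)]
  | n'.+1 => [the {sigma_finite_measure set 'rV[R]_n'.+1 -> \bar R} of
      lebesgue_rV_step (lebesgue_rV R n')]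
  end.

Lemma measurable_box (R : realType) n (A : 'I_n -> set R) :
  (forall i, measurable (A i)) ->
  measurable [set v : 'rV[R]_n | forall i, A i (v ord0 i)].
Proof.
move=> mA; rewrite (_ : mkset _ =
    \big[setI/setT]_(i < n) ((fun v : 'rV[R]_n => v ord0 i) @^-1` A i)).
  apply: bigsetI_measurable => i _; rewrite -[X in measurable X]setTI.
  by apply: measurable_coord => //; exact: mA.
rewrite -bigcap_seq; apply/seteqP; split => v /= vA i => [_|]; first exact: vA.
by apply: vA; rewrite /= mem_index_enum.
Qed.

Lemma lebesgue_rV_box (R : realType) n (A : 'I_n -> set R) :
  (forall i, measurable (A i)) ->
  lebesgue_rV R n [set v | forall i, A i (v ord0 i)] =
  (\prod_(i < n) lebesgue_measure (A i))%E.
Proof.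
elim: n A => [|n IHn] A mA.
  rewrite big_ord0 /= diracE mem_set//.
  by case.
have mA0 := mA ord0.
rewrite big_ord_recl -IHn// -product_measure1E//; last first.
  exact: (@measurable_box R n (fun i => A (lift ord0 i))).
rewrite /= /lebesgue_rV_step /pushforward; congr (product_measure1 _ _ _).
apply/seteqP; split => [[x v] /= xvA|[x v] /= [xA vA] i].
  split=> [|i].
    by rewrite -[x]/((x, v).1) -rV_consE0.
  by rewrite -[v]/((x, v).2) -rV_consES.
by case: (unliftP ord0 i) => [j ->|->]; rewrite ?rV_consES ?rV_consE0.
Qed.

Section vector_fields.
Variables (R : realType) (d : nat).
Implicit Types (v w : 'rV[R]_d -> 'rV[R]_d) (p : \bar R) (S : set 'rV[R]_d).

Local Notation mu := (lebesgue_rV R d).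

(* The library's norm on 'rV[R]_d is the sup norm. *)
Definition enorm (x : 'rV[R]_d) : R := Num.sqrt (\sum_i x ord0 i ^+ 2).

Definition eball (x0 : 'rV[R]_d) (r : R) : set 'rV[R]_d :=
  [set x | enorm (x - x0) < r].

Definition Lpnorm p S v : \bar R :=
  Lnorm mu p ((fun x => (enorm (v x))%:E) \_ S).

Definition in_Lp p v : Prop :=
  measurable_fun setT v /\ (Lpnorm p setT v < +oo)%E.

Definition normLp p v : R := fine (Lpnorm p setT v).

(* 1/p, with 1/oo = 0 *)
Definition inv_exp p : R := fine p^-1.

Definition partial (k : 'I_d) (f : 'rV[R]_d -> R) (x : 'rV[R]_d) : R :=
  'D_(delta_mx ord0 k) f x.

Definition test_function (phi : 'rV[R]_d -> R) : Prop :=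
  (forall (s : seq 'I_d) x, differentiable (foldr partial phi s) x) /\
  compact (closure [set x | phi x != 0]).

Definition weakly_div_free v : Prop := forall phi, test_function phi ->
  \int[mu]_x (\sum_i v x ord0 i * partial i phi x) = 0.

Definition in_Lp_sigma p v : Prop := in_Lp p v /\ weakly_div_free v.

Definition sparse (eps beta ell : R) p v : Prop :=
  exists S, [/\ measurable S,
    (Lpnorm p (~` S) v < beta%:E * Lpnorm p setT v)%E &
    (ereal_sup (range (fun x0 =>
       (fine (mu (S `&` eball x0 ell)) / fine (mu (eball x0 ell)))%:E))
     <= eps%:E)%E].

End vector_fields.

Section navier_stokes.
Variables (R : realType) (d : nat).
Implicit Types (v : 'rV[R]_d -> 'rV[R]_d) (u : R -> 'rV[R]_d -> 'rV[R]_d).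
Implicit Types (p : \bar R) (t T : R) (I : set R).

Local Notation mu := (lebesgue_rV R d).

Definition heat_kernel t (x : 'rV[R]_d) : R :=
  (4 * pi * t) `^ (- (d%:R / 2)) * expR (- (enorm x ^+ 2 / (4 * t))).

Definition heat t v (x : 'rV[R]_d) : 'rV[R]_d :=
  \row_i \int[mu]_y (heat_kernel t (x - y) * v y ord0 i).

(* Kernel of (-Delta)^-1 exp(t Delta), from (-Delta)^-1 = \int_0^oo exp(s Delta)
   ds; the integral converges for d >= 3. *)
Definition inv_laplace_heat_kernel t (x : 'rV[R]_d) : R :=
  \int[lebesgue_measure]_(s in `]t, +oo[) heat_kernel s x.

(* Kernel of exp(t Delta) P, where P = Id + grad (-Delta)^-1 div is the Leray
   projector: (P f)_i = f_i + \sum_j d_i d_j (-Delta)^-1 f_j. *)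
Definition leray_heat_kernel t (i j : 'I_d) (x : 'rV[R]_d) : R :=
  (i == j)%:R * heat_kernel t x
  + partial i (partial j (inv_laplace_heat_kernel t)) x.

(* exp(t Delta) P div F for a matrix field F, (div F)_j = \sum_k d_k F_jk.
   Since P is not bounded on L^oo, this operator is, as usual, the convolution
   with the derivatives of the kernel of exp(t Delta) P. *)
Definition heat_leray_div t (F : 'rV[R]_d -> 'M[R]_d) (x : 'rV[R]_d) :
    'rV[R]_d :=
  \row_i \sum_j \sum_k
    \int[mu]_y (partial k (leray_heat_kernel t i j) (x - y) * F y j k).

Definition tensor v (x : 'rV[R]_d) : 'M[R]_d := (v x)^T *m v x.

(* The time integral is taken pointwise in x. For u in C((0, T); L^p), bounded
   near 0, with p > d >= 3, the integrand is jointly continuous in (s, x) and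
   this agrees a.e. with the L^p-valued integral. *)
Definition duhamel u t (x : 'rV[R]_d) : 'rV[R]_d :=
  \row_i \int[lebesgue_measure]_(s in `]0, t[)
    heat_leray_div (t - s) (tensor (u s)) x ord0 i.

Definition mild_solution v I u : Prop := forall t, I t ->
  {ae mu, forall x, u t x = heat t v x - duhamel u t x}.

Definition continuous_Lp p I u : Prop :=
  (forall t, I t -> in_Lp p (u t)) /\
  (forall t, I t ->
    Lpnorm p setT (fun x => u s x - u t x) @[s --> within I (nbhs t)] --> 0%E).

(* I is meant to be ]0, T[ or ]0, T]. *)
Definition strong_solution p v I u : Prop :=
  [/\ mild_solution v I u, continuous_Lp p I u &
    forall T', I T' -> exists M,
      forall t, 0 < t < T' -> (Lpnorm p setT (u t) <= M%:E)%E].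

Definition max_existence_time p v : \bar R :=
  ereal_sup [set T%:E | T in
    [set T | 0 < T /\ exists u, strong_solution p v `]0, T[ u]].

(* The scaling exponent (1 - d / p) / 2. *)
Definition scal_exp p : R := (1 - d%:R * inv_exp p) / 2.

(* Uniqueness is only asked among solutions that are bounded in L^p near 0. *)
Definition local_existence_constant p (cp : R) : Prop :=
  0 < cp <= 1 /\
  forall v T, in_Lp_sigma p v -> 0 < T ->
    normLp p v * T `^ scal_exp p = cp ->
  exists u, [/\ strong_solution p v `]0, T] u,
    forall w, strong_solution p v `]0, T] w ->
      forall t, `]0, T]%classic t -> {ae mu, forall x, w t x = u t x} &
    (ereal_sup [set Lpnorm p setT (u t) | t in `]0%R, T[%classic]
      <= (2 * normLp p v)%:E)%E].

Definition bilinear_constant p (cp C1 : R) : Prop :=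
  (2 * cp)^-1 <= C1 /\
  forall v T u, in_Lp_sigma p v -> 0 < T ->
    normLp p v * T `^ scal_exp p = cp ->
    strong_solution p v `]0, T] u ->
  forall t, 0 < t < T ->
    (Lpnorm p setT (duhamel u t) <= (C1 * t `^ scal_exp p * normLp p v ^+ 2)%:E)%E.

End navier_stokes.

(* Main.v *)
(* At time T1 the solution u is exp(T1 Delta) u0 minus a Duhamel term.  In the heat
   convolution, split u0 into its part off the sparse set S, its part on S at distance
   at least ell, and its part on S at distance less than ell: the first is small because
   of beta, the second because of the Gaussian tail, the third by Schur's test because S
   has density eps at scale ell.  Together they contribute gamma/2 |u0|, and by the
   choice of T1 so does the Duhamel term.  Hence |u(T1)| <= gamma |u0|, which is small
   enough for local existence to give a solution w on ]0, T0] issued from u(T1), and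
   gluing w to u at time T1 gives a strong solution of lifespan T1 + T0.

   The kernel K_t of exp(t Delta) P div satisfies |K_t|_1 <= C t^(-1/2) and
   |K_t|_oo <= C t^(-(d+1)/2), so that the Duhamel term is O(t^scal_exp) in L^p; together
   with G_s * K_t = K_(s+t) this splits the Duhamel integral at time T1, which yields both
   the mild formulation for the glued function and its continuity at T1.  That u(T1) is
   divergence free follows by pairing K_t with the gradient of a test function. *)
Require Import Defs.
From mathcomp Require Import all_boot all_order all_algebra.
From mathcomp Require Import all_classical all_reals all_analysis.
From mathcomp Require Import measurable_realfun ess_sup_inf.
From mathcomp Require Import ring lra.
Import Order.TTheory GRing.Theory Num.Theory.
Import numFieldNormedType.Exports.
Local Open Scope classical_set_scope.
Local Open Scope ring_scope.
Set Implicit Arguments.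
Unset Strict Implicit.
Unset Printing Implicit Defensive.

(** * Lebesgue measure and the heat kernel *)

(** All kernel bounds come from Gaussians. The three derivatives in [P div] fall on [G_s] inside
    [(-Delta)^-1 exp(t Delta)], the integral of [G_s] over [s > t], and third derivatives of [G_s]
    are at most [C s^(-3/2) G_(2s)]. Since [s^(-3/2)] integrates to [2 t^(-1/2)] over [s > t], this
    controls the mass and the supremum of the kernel with no theory of singular integrals, and
    [p = +oo] is treated like finite [p].

    The Duhamel integral is taken pointwise in [x], and a divergent real integral has value 0.
    Before Fubini can be applied, the integrand must be jointly measurable in [(s, x)], which comes
    from the continuity of [u] in time, and absolutely integrable in time at almost every [x], which
    comes from Minkowski's inequality and [p > d].

    The heat semigroup is not strongly continuous at time 0 on [L^oo]. Continuity of the glued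
    solution at [T1] is therefore obtained by comparing [w] with [u] itself, which lives on to
    [Tbar > T1]. *)

Section rV_measure.
Variable R : realType.

Lemma measurable_rV_add n :
  measurable_fun setT (fun z : 'rV[R]_n * 'rV[R]_n => z.1 + z.2).
Proof.
apply/measurable_fun_rVP => i; under eq_fun do rewrite mxE.
apply: measurable_funD.
  exact: (measurableT_comp (measurable_coord i) measurable_fst).
exact: (measurableT_comp (measurable_coord i) measurable_snd).
Qed.

Lemma measurable_rV_sub n :
  measurable_fun setT (fun z : 'rV[R]_n * 'rV[R]_n => z.1 - z.2).
Proof.
apply/measurable_fun_rVP => i; under eq_fun do rewrite !mxE.
apply: measurable_funB.
  exact: (measurableT_comp (measurable_coord i) measurable_fst).
exact: (measurableT_comp (measurable_coord i) measurable_snd).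
Qed.

(** [lebesgue_rV] is built by recursion as a pushforward of a product measure. Peeling off the first
    coordinate by Tonelli is thus the basic tool for the inductions on the dimension below. *)
Lemma ge0_integral_rV_cons n (f : 'rV[R]_n.+1 -> \bar R) :
  measurable_fun setT f -> (forall x, 0 <= f x)%E ->
  (\int[lebesgue_rV R n.+1]_x f x =
   \int[lebesgue_measure]_t \int[lebesgue_rV R n]_v f (rV_cons (t, v)))%E.
Proof.
move=> mf f0.
rewrite /= ge0_integral_pushforward//; first last.
  exact: measurable_rV_cons.
rewrite preimage_setT fubini_tonelli1//=.
- exact: (measurableT_comp mf (@measurable_rV_cons R n)).
Qed.

Lemma ge0_integral_prod n (g : 'I_n -> R -> R) :
  (forall i, measurable_fun setT (g i : measurableTypeR R -> R)) -> (forall i t, 0 <= g i t) ->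
  (\int[lebesgue_rV R n]_x (\prod_i g i (x ord0 i))%:E =
   \prod_i \int[lebesgue_measure]_t (g i t)%:E)%E.
Proof.
elim: n g => [|n IHn] g mg g0.
  rewrite big_ord0 /=.
  under eq_integral do rewrite big_ord0.
  by rewrite integral_cst//= diracT mule1.
rewrite ge0_integral_rV_cons; first last.
- by move=> x; rewrite lee_fin prodr_ge0.
- apply/measurable_EFinP/measurable_prod => i _.
  exact: (measurableT_comp (mg i) (measurable_coord i)).
rewrite big_ord_recl -IHn//.
under eq_integral => t _.
  under eq_integral => v _.
    rewrite big_ord_recl rV_consE0/= EFinM.
    under eq_bigr do rewrite rV_consES/=.
    over.
  rewrite ge0_integralZl_EFin//=; first last.
  - apply/measurable_EFinP/measurable_prod => i _.
    exact: (measurableT_comp (mg _) (measurable_coord i)).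
  - by move=> x _; rewrite lee_fin prodr_ge0.
  over.
rewrite ge0_integralZr//=.
- exact/measurable_EFinP.
- by move=> x _; rewrite lee_fin.
- by apply: integral_ge0 => x _; rewrite lee_fin prodr_ge0.
Qed.

(** The boolean treats the translation [a + t] and the reflection [a - t] at once. By uniqueness of
    Lebesgue measure only intervals []x, y]] matter; the reflection returns [[a - y, a - x[], closed
    at the other end but of the same length. *)
Lemma lebesgue_measure_signed_shift (b : bool) (a : R) (A : set (measurableTypeR R)) :
  measurable A ->
  lebesgue_measure ((fun t : measurableTypeR R => a + (-1) ^+ b * t) @^-1` A) =
  lebesgue_measure A :> \bar R.
Proof.
pose phi := (fun t : measurableTypeR R => (a + (-1) ^+ b * t) : measurableTypeR R).
have mphi : measurable_fun setT phi.
  by apply: (@measurable_funD _ _ _ _ (cst a)).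
move=> mA; rewrite -[LHS]/(pushforward lebesgue_measure phi A).
symmetry.
apply: (@lebesgue_measure_unique _ (pushforward lebesgue_measure phi)) => // X.
case=> [[x y]] _ <-; rewrite lebesgue_measure_itv/= /pushforward.
case: b @phi mphi => phi mphi.
  rewrite (_ : _ @^-1` _ = `[a - y, a - x[%classic); last first.
    apply/seteqP; split => t /=; rewrite /phi !in_itv/= mulN1r => /andP[? ?];
    by apply/andP; split; lra.
  rewrite lebesgue_measure_itv/= !lte_fin ltrD2l ltrN2.
  by case: ifPn => // _; rewrite -!EFinD; congr (_%:E); lra.
rewrite (_ : _ @^-1` _ = `]x - a, y - a]%classic); last first.
  apply/seteqP; split => t /=; rewrite /phi !in_itv/= mul1r => /andP[? ?];
  by apply/andP; split; lra.
rewrite lebesgue_measure_itv/= !lte_fin ltrD2r.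
by case: ifPn => // _; rewrite -!EFinD; congr (_%:E); lra.
Qed.

Lemma ge0_integral_signed_shift1 (b : bool) (a : R) (f : measurableTypeR R -> \bar R) :
  measurable_fun setT f -> (forall x, 0 <= f x)%E ->
  (\int[lebesgue_measure]_t f (a + (-1) ^+ b * t)%R =
   \int[lebesgue_measure]_t f t)%E.
Proof.
move=> mf f0.
pose phi := (fun t : measurableTypeR R => (a + (-1) ^+ b * t) : measurableTypeR R).
have mphi : measurable_fun setT phi.
  by apply: (@measurable_funD _ _ _ _ (cst a)).
rewrite -[LHS]/(\int[lebesgue_measure]_(t in setT) (f \o phi) t)%E.
rewrite -(preimage_setT phi) -ge0_integral_pushforward//.
apply: eq_measure_integral => A mA _.
exact: lebesgue_measure_signed_shift.
Qed.

Lemma ge0_integral_signed_shift n (b : bool) (a : 'rV[R]_n) (f : 'rV[R]_n -> \bar R) :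
  measurable_fun setT f -> (forall x, 0 <= f x)%E ->
  (\int[lebesgue_rV R n]_x f (a + (-1) ^+ b *: x)%R =
   \int[lebesgue_rV R n]_x f x)%E.
Proof.
elim: n a f => [|n IHn] a f mf f0.
  apply: eq_integral => x _; congr f; apply/rowP; case=> //.
have mphi m c : measurable_fun setT (fun x : 'rV[R]_m => c + (-1) ^+ b *: x).
  apply/measurable_fun_rVP => i; under eq_fun do rewrite !mxE.
  apply: measurable_funD => //; apply: measurable_funM => //.
  exact: measurable_coord.
rewrite ge0_integral_rV_cons//; last first.
  exact: (measurableT_comp mf (mphi _ a)).
rewrite [RHS](ge0_integral_rV_cons mf f0).
pose F t := (\int[lebesgue_rV R n]_v f (rV_cons (t, v)))%E.
have mF : measurable_fun setT F.
  apply: (measurable_fun_fubini_tonelli_F (fun z => f (rV_cons z))) => //.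
  exact: (measurableT_comp mf (@measurable_rV_cons R n)).
rewrite -[RHS](ge0_integral_signed_shift1 b (a ord0 ord0) mF); last first.
  by move=> x; exact: integral_ge0.
apply: eq_integral => t _; rewrite /F.
rewrite -[RHS](IHn (\row_i a ord0 (lift ord0 i))).
- apply: eq_integral => v _; congr f; apply/rowP => i.
  case: (unliftP ord0 i) => [j ->|->].
    rewrite [RHS]rV_consES mxE [X in _ + X]mxE [RHS]mxE [X in _ = X + _]mxE [X in _ = _ + X]mxE.
    by congr (_ + _ * _); exact: rV_consES.
  rewrite [RHS]rV_consE0 mxE [X in _ + X]mxE.
  by congr (_ + _ * _); exact: rV_consE0.
- apply: (measurableT_comp mf) => /=.
  exact: (measurableT_comp (@measurable_rV_cons R n) (measurable_pair1 _)).
- by [].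
Qed.

Lemma ge0_integral_shift n (a : 'rV[R]_n) (f : 'rV[R]_n -> \bar R) :
  measurable_fun setT f -> (forall x, 0 <= f x)%E ->
  (\int[lebesgue_rV R n]_x f (x + a)%R = \int[lebesgue_rV R n]_x f x)%E.
Proof.
move=> mf f0; rewrite -[RHS](ge0_integral_signed_shift false a)//.
by apply: eq_integral => x _; rewrite expr0 scale1r addrC.
Qed.

Lemma ge0_integral_reflect n (a : 'rV[R]_n) (f : 'rV[R]_n -> \bar R) :
  measurable_fun setT f -> (forall x, 0 <= f x)%E ->
  (\int[lebesgue_rV R n]_x f (a - x)%R = \int[lebesgue_rV R n]_x f x)%E.
Proof.
move=> mf f0; rewrite -[RHS](ge0_integral_signed_shift true a)//.
by apply: eq_integral => x _; rewrite expr1 scaleN1r.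
Qed.

End rV_measure.

Section heat_kernel_basics.
Variables (R : realType) (d : nat).
Implicit Types (x y : 'rV[R]_d) (s t : R).

Lemma enorm_sqr x : enorm x ^+ 2 = \sum_i x ord0 i ^+ 2.
Proof. by rewrite sqr_sqrtr// sumr_ge0// => i _; exact: sqr_ge0. Qed.

Lemma enorm_ge0 x : 0 <= enorm x. Proof. exact: sqrtr_ge0. Qed.

Lemma coord_le_enorm x i : `|x ord0 i| <= enorm x.
Proof.
rewrite -sqrtr_sqr; apply: ler_wsqrtr.
by rewrite (bigD1 i)//= lerDl sumr_ge0// => j _; exact: sqr_ge0.
Qed.

Lemma heat_kernel_ge0 t x : 0 <= heat_kernel t x.
Proof. by rewrite mulr_ge0 ?powR_ge0 ?expR_ge0. Qed.

Lemma heat_kernel_sub t x y : heat_kernel t (x - y) = heat_kernel t (y - x).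
Proof.
have e : enorm (x - y) = enorm (y - x).
  by congr Num.sqrt; apply: eq_bigr => i _; rewrite !mxE -sqrrN opprB.
by rewrite /heat_kernel e.
Qed.

(** The Gaussian of time [t] is a product of centred normal densities of variance [2 t], so its
    total mass comes from dimension one. *)
Lemma heat_kernel_prod t x : 0 < t ->
  heat_kernel t x = \prod_i normal_pdf 0 (Num.sqrt (2 * t)) (x ord0 i).
Proof.
move=> t0.
have s0 : Num.sqrt (2 * t) != 0 by rewrite gt_eqF// sqrtr_gt0 mulr_gt0.
under eq_bigr do rewrite normal_pdfE//.
rewrite big_split/= prodr_const card_ord /heat_kernel; congr (_ * _).
  rewrite /normal_peak sqr_sqrtr ?mulr_ge0 ?ltW//.
  rewrite (_ : (2 * t * pi) *+ 2 = 4 * pi * t); last by rewrite mulr2n; ring.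
  have p0 : 0 <= 4 * pi * t by rewrite !mulr_ge0 ?pi_ge0// ltW.
  have -> : (Num.sqrt (4 * pi * t))^-1 = (4 * pi * t) `^ (- 2^-1).
    by rewrite powRN powR12_sqrt.
  by rewrite -powR_mulrn ?powR_ge0// -powRrM; congr (_ `^ _); field.
rewrite /normal_fun -expR_sum; congr expR.
rewrite enorm_sqr sqr_sqrtr ?mulr_ge0 ?ltW//.
rewrite -mulNr -sumrN mulr_suml.
apply: eq_bigr => i _.
by rewrite subr0 mulr2n; congr (_ / _); ring.
Qed.

Lemma measurable_enorm : measurable_fun setT (@enorm R d).
Proof.
apply: (@measurableT_comp _ _ _ _ _ _ (@Num.sqrt R)); last first.
  by apply: measurable_sum => i; apply: measurable_funX; exact: measurable_coord.
exact: (continuous_measurable_fun (@sqrt_continuous R)).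
Qed.

Lemma measurable_heat_kernel t : measurable_fun setT (@heat_kernel R d t).
Proof.
apply: measurable_funM => //; apply: (measurableT_comp (@measurable_expR R)).
apply: measurable_funN; apply: measurable_funM => //.
by apply: measurable_funX; exact: measurable_enorm.
Qed.

Lemma integral_heat_kernel t : 0 < t ->
  (\int[lebesgue_rV R d]_x (heat_kernel t x)%:E = 1)%E.
Proof.
move=> t0; under eq_integral do rewrite heat_kernel_prod//.
rewrite (ge0_integral_prod (g := fun=> normal_pdf 0 (Num.sqrt (2 * t)))).
- by rewrite big1// => i _; exact: integral_normal_pdf.
- by move=> i; exact: measurable_normal_pdf.
- by move=> i u; exact: normal_pdf_ge0.
Qed.

(** Completing the square in [y]: what depends on [y] is a Gaussian centred at [s x / (t + s)],
    whose mass 1 gives the semigroup law. *)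
Lemma heat_kernel_mul t s x y : 0 < t -> 0 < s ->
  heat_kernel t (x - y) * heat_kernel s y =
  heat_kernel (t + s) x *
  heat_kernel (t * s / (t + s)) (y - (s / (t + s)) *: x).
Proof.
move=> t0 s0; have ts0 : 0 < t + s by rewrite addr_gt0.
have pi0 := pi_gt0 R.
have ts : 0 < t * s / (t + s) by rewrite divr_gt0// mulr_gt0.
rewrite /heat_kernel [LHS]mulrACA [RHS]mulrACA; congr (_ * _).
  have h (c : R) : 0 < c -> 0 <= 4 * pi * c by move=> c0; rewrite ltW// !mulr_gt0.
  rewrite -(powRM _ (h _ t0) (h _ s0)) -(powRM _ (h _ ts0) (h _ ts)).
  by congr (_ `^ _); field; rewrite gt_eqF.
rewrite -!expRD; congr expR; rewrite !enorm_sqr -!mulNr -!sumrN !mulr_suml -!big_split/=.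
apply: eq_bigr => i _; rewrite !mxE; field.
by rewrite !gt_eqF// mulr_gt0.
Qed.

Lemma heat_kernel_conv t s x : 0 < t -> 0 < s ->
  (\int[lebesgue_rV R d]_y (heat_kernel t (x - y) * heat_kernel s y)%:E =
   (heat_kernel (t + s) x)%:E)%E.
Proof.
move=> t0 s0; have ts0 : 0 < t + s by rewrite addr_gt0.
under eq_integral do rewrite heat_kernel_mul// EFinM.
have ts : 0 < t * s / (t + s) by rewrite divr_gt0// mulr_gt0.
rewrite ge0_integralZl_EFin ?heat_kernel_ge0//; first last.
- apply/measurable_EFinP; apply: (measurableT_comp (measurable_heat_kernel _)).
  exact: (measurableT_comp (@measurable_rV_sub R d) (measurable_pair2 _)).
- by move=> y _; rewrite lee_fin heat_kernel_ge0.
have := ge0_integral_shift (- ((s / (t + s)) *: x))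
  (f := fun y => (heat_kernel (t * s / (t + s)) y)%:E).
move=> ->; first by rewrite integral_heat_kernel// mule1.
  by apply/measurable_EFinP; exact: measurable_heat_kernel.
by move=> y; rewrite lee_fin heat_kernel_ge0.
Qed.

End heat_kernel_basics.

(** * Kernel bounds in Lp *)

Section Lp_tools.
Context d (T : measurableType d) (R : realType).
Variable mu : {measure set T -> \bar R}.
Implicit Types (f g k : T -> R) (p : \bar R) (r : R).

Lemma inv_exp_fin r : r != 0 -> inv_exp r%:E = r^-1.
Proof. by move=> r0; rewrite /inv_exp inver (negbTE r0). Qed.

Lemma inv_exp_pinfty : inv_exp (+oo%E : \bar R) = 0.
Proof. by rewrite /inv_exp invey. Qed.

Lemma ge0_le_poweR r (x y : \bar R) :
  0 <= r -> (0 <= x)%E -> (x <= y)%E -> (x `^ r <= y `^ r)%E.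
Proof.
move=> r0 x0 xy; apply: gt0_ler_poweR => //; rewrite in_itv/= leey andbT//.
exact: le_trans xy.
Qed.

Lemma measurable_fun_poweR (f : T -> \bar R) r : measurable_fun setT f ->
  measurable_fun setT (fun x => (f x `^ r)%E).
Proof. exact: (measurableT_comp (measurable_poweR r)). Qed.

Lemma measurable_fun_powR (f : T -> R) r : measurable_fun setT f ->
  measurable_fun setT (fun x => f x `^ r).
Proof. exact: (measurableT_comp (@measurable_powR R r)). Qed.

Lemma measurable_fun_inv (f : T -> R) : measurable_fun setT f ->
  measurable_fun setT (fun x => (f x)^-1).
Proof.
(* [powR] is measurable on the whole line but is an inverse only at nonnegative arguments; hence the
   square. At a zero of [f] both sides are 0. *)
move=> mf; rewrite (_ : (fun x => _) = fun x => f x * (f x ^+ 2) `^ (-1)).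
  apply: measurable_funM => //; apply: measurable_fun_powR.
  exact: measurable_funX.
apply/funext => x; rewrite powR_inv1 ?sqr_ge0//.
have [->|fx0] := eqVneq (f x) 0; first by rewrite invr0 mul0r.
by field.
Qed.

(** Hoelder's inequality for the splitting [k = k^(1 - 1/r) k^(1/r)], with [f] attached to the
    second factor and the mass of [k] bounding the first. *)
Lemma weighted_hoelder r A k f : 1 < r -> 0 < A ->
  measurable_fun setT k -> measurable_fun setT f ->
  (forall x, 0 <= k x) -> (forall x, 0 <= f x) ->
  (\int[mu]_x (k x)%:E <= A%:E)%E ->
  (\int[mu]_x (k x * f x)%:E <=
   (A `^ (1 - r^-1))%:E * (\int[mu]_x (k x * f x `^ r)%:E) `^ r^-1)%E.
Proof.
move=> r1 A0 mk mf k0 f0 kA.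
have r0 : 0 < r by rewrite (lt_trans _ r1).
have q0 : 0 < 1 - r^-1 by rewrite subr_gt0 invf_lt1.
pose q := (1 - r^-1)^-1.
pose F x := k x `^ (1 - r^-1); pose G x := k x `^ r^-1 * f x.
have mp s : measurable_fun setT (fun x => k x `^ s).
  exact: measurable_fun_powR.
have mF : measurable_fun setT F by exact: mp.
have mG : measurable_fun setT G by apply: measurable_funM => //; exact: mp.
have FG x : F x * G x = k x * f x.
  by rewrite /F /G mulrA -powRD ?subrK ?powRr1 ?k0// oner_eq0.
have := @hoelder _ _ _ mu F G q r mF mG _ r0 _.
rewrite invr_gt0 q0 /q invrK subrK => /(_ isT erefl).
rewrite Lnorm1.
under eq_integral do rewrite /= FG ger0_norm ?mulr_ge0//.
move=> /le_trans; apply.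
apply: lee_pmul; try exact: Lnorm_ge0.
  rewrite unlock invrK -poweR_EFin.
  under eq_integral => x _.
    rewrite gee0_abs ?lee_fin ?powR_ge0// poweR_EFin -powRrM mulfV ?gt_eqF//.
    rewrite powRr1//.
    over.
  apply: ge0_le_poweR => //; first exact: ltW.
  by apply: integral_ge0 => x _; rewrite lee_fin.
rewrite unlock le_eqVlt; apply/orP; left; apply/eqP; congr (_ `^ _)%E.
apply: eq_integral => x _.
rewrite /= ger0_norm ?mulr_ge0 ?powR_ge0// /G.
by rewrite powRM ?powR_ge0// -powRrM mulVf ?gt_eqF// powRr1.
Qed.

(** Jensen's inequality for a weight whose mass need not be 1: raising [weighted_hoelder] to the
    power [r] turns [A^(1 - 1/r)] into [A^(r - 1)]. *)
Lemma weighted_jensen r A k f : 1 < r -> 0 < A ->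
  measurable_fun setT k -> measurable_fun setT f ->
  (forall x, 0 <= k x) -> (forall x, 0 <= f x) ->
  (\int[mu]_x (k x)%:E <= A%:E)%E ->
  ((\int[mu]_x (k x * f x)%:E) `^ r <=
   (A `^ (r - 1))%:E * \int[mu]_x (k x * f x `^ r)%:E)%E.
Proof.
move=> r1 A0 mk mf k0 f0 kA.
have r0 : 0 < r by rewrite (lt_trans _ r1).
have I0 : (0 <= \int[mu]_x (k x * f x `^ r)%:E)%E.
  by apply: integral_ge0 => x _; rewrite lee_fin mulr_ge0 ?powR_ge0.
have H := weighted_hoelder r1 A0 mk mf k0 f0 kA.
have -> : ((A `^ (r - 1))%:E * \int[mu]_x (k x * f x `^ r)%:E =
  ((A `^ (1 - r^-1))%:E * (\int[mu]_x (k x * f x `^ r)%:E) `^ r^-1) `^ r)%E.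
  rewrite poweRM ?lee_fin ?powR_ge0 ?poweR_ge0// -poweRrM mulVf ?gt_eqF//.
  by rewrite poweRe1// poweR_EFin -powRrM mulrBl mul1r mulVf ?gt_eqF.
apply: ge0_le_poweR => //; first exact: ltW.
by apply: integral_ge0 => x _; rewrite lee_fin mulr_ge0.
Qed.

Lemma ae_le_Lnormy (f : T -> \bar R) :
  {ae mu, forall x, (`|f x| <= 'N[mu]_+oo[f])%E}.
Proof.
rewrite unlock; case: ifPn => [_|].
  exact: (ess_sup_ge mu (abse \o f)).
(* On a null space the norm is 0 by convention, and the exceptional set may be everything. *)
rewrite -leNgt => muT0; exists setT; split => //.
by apply/eqP; rewrite eq_le muT0 measure_ge0.
Qed.

Lemma Lnormy_le (f : T -> \bar R) (M : \bar R) : (0 <= M)%E ->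
  {ae mu, forall x, (`|f x| <= M)%E} -> ('N[mu]_+oo[f] <= M)%E.
Proof.
move=> M0 fM; rewrite unlock; case: ifPn => // _.
by apply/ess_supP.
Qed.

Lemma le_Lnorm p (f g : T -> \bar R) : (0 < p)%E ->
  measurable_fun setT f -> measurable_fun setT g ->
  {ae mu, forall x, (`|f x| <= `|g x|)%E} -> ('N[mu]_p[f] <= 'N[mu]_p[g])%E.
Proof.
case: p => [r r0|_|//] mf mg fg; last first.
  apply: Lnormy_le; first exact: Lnorm_ge0.
  by apply: filterS2 fg (ae_le_Lnormy g) => x; exact: le_trans.
have mp (h : T -> \bar R) : measurable_fun setT h ->
    measurable_fun setT (fun x => (`|h x| `^ r)%E).
  by move=> mh; apply: measurable_fun_poweR; exact: measurableT_comp.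
rewrite unlock; apply: ge0_le_poweR.
- by rewrite invr_ge0 ltW.
- by apply: integral_ge0 => x _; exact: poweR_ge0.
apply: ae_ge0_le_integral => //.
- by move=> x _; exact: poweR_ge0.
- exact: mp.
- by move=> x _; exact: poweR_ge0.
- exact: mp.
by apply: filterS fg => x fgx _; apply: ge0_le_poweR => //; exact: ltW.
Qed.

Lemma ae_eq_Lnorm p (f g : T -> \bar R) : (0 < p)%E ->
  measurable_fun setT f -> measurable_fun setT g ->
  {ae mu, forall x, f x = g x} -> ('N[mu]_p[f] = 'N[mu]_p[g])%E.
Proof.
move=> p0 mf mg fg; apply/eqP; rewrite eq_le; apply/andP; split;
  by apply: le_Lnorm => //; apply: filterS fg => x ->.
Qed.

Lemma LnormZ_le p (c : R) (f : T -> \bar R) : 0 <= c -> (0 < p)%E ->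
  measurable_fun setT f ->
  ('N[mu]_p[(fun x => c%:E * f x)] <= c%:E * 'N[mu]_p[f])%E.
Proof.
move=> c0; case: p => [r r0|_|//] mf; last first.
  apply: Lnormy_le; first by rewrite mule_ge0 ?lee_fin ?Lnorm_ge0.
  apply: filterS (ae_le_Lnormy f) => x fx.
  by rewrite abseM gee0_abs ?lee_fin// lee_wpmul2l.
rewrite unlock.
under eq_integral do rewrite abseM gee0_abs ?lee_fin// poweRM ?lee_fin// poweR_EFin.
rewrite ge0_integralZl_EFin ?powR_ge0//; first last.
- by apply: measurable_fun_poweR; exact: measurableT_comp.
- by move=> x _; exact: poweR_ge0.
rewrite poweRM ?lee_fin ?powR_ge0//; last first.
  by apply: integral_ge0 => x _; exact: poweR_ge0.
by rewrite poweR_EFin -powRrM mulfV ?gt_eqF// powRr1.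
Qed.

End Lp_tools.

Section kernel_bounds.
Context d (T : measurableType d) (R : realType).
Variable mu : {measure set T -> \bar R}.
Implicit Types (f g k : T -> R) (p : \bar R) (r : R).

Lemma LnormEr r f : r != 0 ->
  ('N[mu]_r%:E[EFin \o f] `^ r = \int[mu]_x (`|f x| `^ r)%:E)%E.
Proof. by move=> r0; rewrite poweR_Lnorm. Qed.

Lemma weighted_sup_le A k f : 0 < A ->
  measurable_fun setT k -> measurable_fun setT f -> (forall x, 0 <= k x) ->
  (\int[mu]_x (k x)%:E <= A%:E)%E ->
  (\int[mu]_x (k x * `|f x|)%:E <= A%:E * 'N[mu]_+oo[EFin \o f])%E.
Proof.
move=> A0 mk mf k0 kA.
have [->|Nfin] := eqVneq ('N[mu]_+oo[EFin \o f])%E +oo%E.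
  by rewrite gt0_muley ?leey// lte_fin.
have [M NM] : exists M, ('N[mu]_+oo[EFin \o f] = M%:E)%E.
  exists (fine ('N[mu]_+oo[EFin \o f])); rewrite fineK// ge0_fin_numE ?Lnorm_ge0//.
  by rewrite ltey.
have M0 : 0 <= M by rewrite -lee_fin -NM Lnorm_ge0.
rewrite NM; apply: (@le_trans _ _ (\int[mu]_x (k x * M)%:E)%E).
  apply: ae_ge0_le_integral => //.
  - by move=> x _; rewrite lee_fin mulr_ge0.
  - by apply/measurable_EFinP/measurable_funM => //; exact: measurableT_comp.
  - by move=> x _; rewrite lee_fin mulr_ge0.
  - by apply/measurable_EFinP/measurable_funM.
  apply: filterS (ae_le_Lnormy mu (EFin \o f)) => x fx _.
  by rewrite lee_fin ler_wpM2l// -lee_fin -NM.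
under eq_integral do rewrite EFinM.
rewrite ge0_integralZr//; first by rewrite lee_wpmul2r.
- exact/measurable_EFinP.
- by move=> x _; rewrite lee_fin.
Qed.

(** Hoelder with the kernel in the conjugate space, whose norm is interpolated between the mass [A]
    and the bound [B]. After [weighted_hoelder], the factor [k] left inside the integral is replaced
    by [B]. *)
Lemma integral_kernel_le p A B k f : (1 < p)%E -> 0 < A -> 0 < B ->
  measurable_fun setT k -> measurable_fun setT f ->
  (forall x, 0 <= k x) -> (forall x, k x <= B) ->
  (\int[mu]_x (k x)%:E <= A%:E)%E ->
  (\int[mu]_x (k x * `|f x|)%:E <=
   (A `^ (1 - inv_exp p) * B `^ inv_exp p)%:E * 'N[mu]_p[EFin \o f])%E.
Proof.
case: p => [r r1|_|//] A0 B0 mk mf k0 kB kA; last first.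
  rewrite inv_exp_pinfty subr0 powRr0 mulr1 (powRr1 (ltW A0)).
  exact: weighted_sup_le.
have r1' : 1 < r by rewrite -lte_fin.
have r0 : 0 < r by rewrite (lt_trans _ r1').
rewrite inv_exp_fin ?gt_eqF//.
have mfa : measurable_fun setT (fun x => `|f x|) by exact: measurableT_comp.
apply: le_trans (weighted_hoelder r1' A0 mk mfa k0 (fun x => normr_ge0 _) kA) _.
rewrite EFinM -muleA; apply: lee_pmul => //.
- by rewrite lee_fin powR_ge0.
- exact: poweR_ge0.
rewrite unlock -poweR_EFin -poweRM ?lee_fin; first last.
- by apply: integral_ge0 => x _; rewrite poweR_ge0.
- exact: ltW.
apply: ge0_le_poweR.
- by rewrite invr_ge0 ltW.
- by apply: integral_ge0 => x _; rewrite lee_fin mulr_ge0 ?powR_ge0.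
have mfr : measurable_fun setT (fun x => `|f x| `^ r).
  by apply: measurable_fun_powR; exact: measurableT_comp.
rewrite -ge0_integralZl_EFin//; first last.
- exact: ltW.
- exact/measurable_EFinP.
- by move=> x _; rewrite poweR_ge0.
apply: ge0_le_integral => //.
- by move=> x _; rewrite lee_fin mulr_ge0 ?powR_ge0.
- by apply/measurable_EFinP/measurable_funM.
- apply/measurable_EFinP/measurable_funM => //.
- move=> x _; rewrite /= -EFinM lee_fin ler_wpM2r ?powR_ge0//.
Qed.

(** [f^2] lies in [L^(p/2)], so this is the previous bound at the exponent [p/2]; hence [p > 2] and
    the doubled [inv_exp p]. *)
Lemma integral_kernel_sqr_le p A B k f : (2%:E < p)%E -> 0 < A -> 0 < B ->
  measurable_fun setT k -> measurable_fun setT f ->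
  (forall x, 0 <= k x) -> (forall x, k x <= B) ->
  (\int[mu]_x (k x)%:E <= A%:E)%E ->
  (\int[mu]_x (k x * f x ^+ 2)%:E <=
   (A `^ (1 - 2 * inv_exp p) * B `^ (2 * inv_exp p))%:E * 'N[mu]_p[EFin \o f] `^ 2)%E.
Proof.
case: p => [r r2|_|//] A0 B0 mk mf k0 kB kA.
  rewrite lte_fin in r2.
  have r0 : 0 < r by rewrite (lt_trans _ r2).
  have q1 : (1 < (r / 2)%:E)%E by rewrite lte_fin ltr_pdivlMr// mul1r.
  have := integral_kernel_le q1 A0 B0 mk (measurable_funX 2 mf) k0 kB kA.
  under eq_integral do rewrite ger0_norm ?sqr_ge0//.
  rewrite !inv_exp_fin ?gt_eqF ?divr_gt0// invf_div => /le_trans; apply.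
  rewrite lee_pmul2l//; last by rewrite lte_fin mulr_gt0 ?powR_gt0.
  rewrite unlock -poweRrM invf_div (mulrC 2).
  rewrite le_eqVlt; apply/orP; left; apply/eqP; apply: (congr1 (fun u => u `^ (r^-1 * 2))%E).
  apply: eq_integral => x _ /=; rewrite normrX -powR_mulrn// -powRrM.
  by congr (_ `^ _)%:E; field.
have := integral_kernel_le (ltry 1) A0 B0 mk (measurable_funX 2 mf) k0 kB kA.
rewrite inv_exp_pinfty mulr0 => /le_trans.
under eq_integral do rewrite ger0_norm ?sqr_ge0//.
apply; rewrite lee_pmul2l//; last by rewrite lte_fin mulr_gt0 ?powR_gt0.
apply: Lnormy_le; first exact: poweR_ge0.
apply: filterS (ae_le_Lnormy mu (EFin \o f)) => x fx.
rewrite /= normrX -powR_mulrn// -poweR_EFin; apply: ge0_le_poweR => //.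
Qed.

End kernel_bounds.

(** * Schur's test, linear and quadratic *)

Section schur.
Context d1 d2 (X : measurableType d1) (Y : measurableType d2) (R : realType).
Variable mu : {sigma_finite_measure set X -> \bar R}.
Variable nu : {sigma_finite_measure set Y -> \bar R}.
Variables (k : X * Y -> R) (A B : R).
Hypotheses (A0 : 0 < A) (B0 : 0 < B) (mk : measurable_fun setT k)
  (k0 : forall z, 0 <= k z).
Hypothesis kA : forall x, (\int[nu]_y (k (x, y))%:E <= A%:E)%E.

Let mkx x : measurable_fun setT (fun y => k (x, y)).
Proof. exact: (measurableT_comp mk (measurable_pair1 x)). Qed.

Let mky y : measurable_fun setT (fun x => k (x, y)).
Proof. exact: (measurableT_comp mk (measurable_pair2 y)). Qed.

Lemma measurable_kernel_integral (g : Y -> R) : measurable_fun setT g ->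
  (forall y, 0 <= g y) ->
  measurable_fun setT (fun x => \int[nu]_y (k (x, y) * g y)%:E)%E.
Proof.
move=> mg g0.
apply: (measurable_fun_fubini_tonelli_F (fun z => (k z * g z.2)%:E)).
  apply/measurable_EFinP/measurable_funM => //.
  exact: (measurableT_comp mg measurable_snd).
by move=> z; rewrite lee_fin mulr_ge0.
Qed.

Lemma integral_kernel_swap (C : R) (g : Y -> R) : 0 <= C -> measurable_fun setT g ->
  (forall y, 0 <= g y) ->
  (forall y, (\int[mu]_x (k (x, y))%:E <= C%:E)%E) ->
  (\int[mu]_x \int[nu]_y (k (x, y) * g y)%:E <= C%:E * \int[nu]_y (g y)%:E)%E.
Proof.
move=> C0 mg g0 kC.
have mkg : measurable_fun setT (fun z => (k z * g z.2)%:E).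
  apply/measurable_EFinP/measurable_funM => //.
  exact: (measurableT_comp mg measurable_snd).
rewrite (fubini_tonelli (fun z => (k z * g z.2)%:E))//; last first.
  by move=> z; rewrite lee_fin mulr_ge0.
rewrite -ge0_integralZl_EFin//; first last.
- exact/measurable_EFinP.
- by move=> y _; rewrite lee_fin.
apply: ge0_le_integral => //.
- by move=> y _; apply: integral_ge0 => x _; rewrite lee_fin mulr_ge0.
- apply: (measurable_fun_fubini_tonelli_G (fun z => (k z * g z.2)%:E)) => //.
  by move=> z; rewrite lee_fin mulr_ge0.
- by apply: measurable_funeM; exact/measurable_EFinP.
move=> y _ /=; under eq_integral do rewrite EFinM.
rewrite ge0_integralZr//.
- by rewrite lee_wpmul2r ?lee_fin.
- exact/measurable_EFinP.
- by move=> x _; rewrite lee_fin.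
- by rewrite lee_fin.
Qed.

(** Schur's test: Jensen in [y] costs the row mass [A] to the power [r - 1], and Tonelli then costs
    one column mass [B]. *)
Lemma Lnorm_kernel_le p (f : Y -> R) : (1 < p)%E -> measurable_fun setT f ->
  (forall y, (\int[mu]_x (k (x, y))%:E <= B%:E)%E) ->
  ('N[mu]_p[(fun x => \int[nu]_y (k (x, y) * `|f y|)%:E)] <=
   (A `^ (1 - inv_exp p) * B `^ inv_exp p)%:E * 'N[nu]_p[EFin \o f])%E.
Proof.
case: p => [r r1|_|//] mf kB; last first.
  apply: Lnormy_le.
    by rewrite mule_ge0 ?Lnorm_ge0// lee_fin mulr_ge0 ?powR_ge0.
  apply: aeW => x; rewrite gee0_abs; last first.
    by apply: integral_ge0 => y _; rewrite lee_fin mulr_ge0.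
  have := @weighted_sup_le _ _ _ nu A _ f A0 (mkx x) mf (fun y => k0 _) (kA x).
  by rewrite inv_exp_pinfty subr0 powRr0 mulr1 powRr1// ltW.
have r1' : 1 < r by rewrite -lte_fin.
have r0 : 0 < r by rewrite (lt_trans _ r1').
have mfa : measurable_fun setT (fun y => `|f y|) by exact: measurableT_comp.
rewrite inv_exp_fin ?gt_eqF// [in leLHS]unlock.
have -> : ((A `^ (1 - r^-1) * B `^ r^-1)%:E * 'N[nu]_r%:E[EFin \o f] =
  ((A `^ (r - 1))%:E * (B%:E * \int[nu]_y (`|f y| `^ r)%:E)) `^ r^-1)%E.
  have B0' : (0 <= B%:E)%E by rewrite lee_fin ltW.
  have I0 : (0 <= \int[nu]_y (`|f y| `^ r)%:E)%E.
    by apply: integral_ge0 => y _; rewrite lee_fin powR_ge0.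
  rewrite !poweRM ?lee_fin ?powR_ge0 ?mule_ge0//.
  rewrite !poweR_EFin -powRrM mulrBl mulfV ?gt_eqF// mul1r EFinM -muleA.
  by rewrite [in LHS]unlock.
apply: ge0_le_poweR; first by rewrite invr_ge0 ltW.
  by apply: integral_ge0 => x _; exact: poweR_ge0.
have mfr : measurable_fun setT (fun y => `|f y| `^ r) by exact: measurable_fun_powR.
apply: (@le_trans _ _ (\int[mu]_x ((A `^ (r - 1))%:E *
    \int[nu]_y (k (x, y) * `|f y| `^ r)%:E))%E).
  apply: ge0_le_integral => //.
  - by move=> x _; exact: poweR_ge0.
  - apply: measurable_fun_poweR; apply: measurableT_comp => //.
    exact: measurable_kernel_integral.
  - by apply: measurable_funeM; apply: measurable_kernel_integral.
  move=> x _; rewrite gee0_abs; last first.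
    by apply: integral_ge0 => y _; rewrite lee_fin mulr_ge0.
  by apply: weighted_jensen => //.
rewrite ge0_integralZl_EFin ?powR_ge0//; first last.
- by apply: measurable_kernel_integral.
- by move=> x _; apply: integral_ge0 => y _; rewrite lee_fin mulr_ge0 ?powR_ge0.
rewrite lee_wpmul2l ?lee_fin ?powR_ge0//.
apply: integral_kernel_swap => //; first exact: ltW.
Qed.

(** A gain of integrability, from [L^(p/2)] for [f^2] up to [L^p]. Jensen at the exponent [r/2]
    bounds the [r]-th power by [A^(r - 2) I^2], where [I] is the integral of [k |f|^r]. With [F] the
    integral of [|f|^r], one factor [I] is at most [B F], and the other, integrated in [x], is at
    most [A F]. *)
Lemma Lnorm_kernel_sqr_le p (f : Y -> R) : (2%:E < p)%E -> measurable_fun setT f ->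
  (forall z, k z <= B) ->
  (forall y, (\int[mu]_x (k (x, y))%:E <= A%:E)%E) ->
  ('N[mu]_p[(fun x => \int[nu]_y (k (x, y) * f y ^+ 2)%:E)] <=
   (A `^ (1 - inv_exp p) * B `^ inv_exp p)%:E * 'N[nu]_p[EFin \o f] `^ 2)%E.
Proof.
move=> p2 mf kB kA'.
have mf2 : measurable_fun setT (fun y => f y ^+ 2) by exact: measurable_funX.
case: p p2 => [r r2|_|//]; last first.
  apply: Lnormy_le.
    by rewrite mule_ge0 ?poweR_ge0// lee_fin mulr_ge0 ?powR_ge0.
  apply: aeW => x; rewrite gee0_abs; last first.
    by apply: integral_ge0 => y _; rewrite lee_fin mulr_ge0 ?sqr_ge0.
  have := integral_kernel_sqr_le (ltry _) A0 B0 (mkx x) mf (fun y => k0 _) (fun y => kB _) (kA x).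
  by rewrite inv_exp_pinfty mulr0.
rewrite lte_fin in r2.
have r0 : 0 < r by rewrite (lt_trans _ r2).
have r21 : 1 < r / 2 by rewrite ltr_pdivlMr// mul1r.
have rn0 : r != 0 by rewrite gt_eqF.
set F := (\int[nu]_y (`|f y| `^ r)%:E)%E.
have F0 : (0 <= F)%E.
  by apply: integral_ge0 => y _; rewrite lee_fin powR_ge0.
have mfr : measurable_fun setT (fun y => `|f y| `^ r).
  by apply: measurable_fun_powR; exact: measurableT_comp.
rewrite inv_exp_fin//.
have -> : ((A `^ (1 - r^-1) * B `^ r^-1)%:E * 'N[nu]_r%:E[EFin \o f] `^ 2 =
  ((A `^ (r - 2))%:E * (B%:E * F) * (A%:E * F)) `^ r^-1)%E.
  have B0' : (0 <= B%:E)%E by rewrite lee_fin ltW.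
  have A0' : (0 <= A%:E)%E by rewrite lee_fin ltW.
  rewrite !poweRM ?lee_fin ?powR_ge0 ?mule_ge0 ?lee_fin ?powR_ge0//.
  rewrite !poweR_EFin -powRrM mulrBl mulfV//.
  have -> : ('N[nu]_r%:E[EFin \o f] `^ 2 = F `^ r^-1 * F `^ r^-1)%E.
    rewrite [in LHS]unlock -poweRrM -/F.
    rewrite -poweRD; first by congr (_ `^ _)%E; field.
    by rewrite add_neq0_poweRD_def// -mulr2n mulrn_eq0/= invr_eq0.
  have -> : A `^ (1 - r^-1) = A `^ (1 - 2 / r) * A `^ r^-1.
    by rewrite -powRD; [congr (_ `^ _); field|rewrite (gt_eqF A0) implybT].
  rewrite !EFinM.
  rewrite -!muleA; congr (_ * _)%E; rewrite muleCA; congr (_ * _)%E.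
  by rewrite muleCA.
rewrite [in leLHS]unlock; apply: ge0_le_poweR; first by rewrite invr_ge0 ltW.
  by apply: integral_ge0 => x _; exact: poweR_ge0.
have mI : measurable_fun setT (fun x => \int[nu]_y (k (x, y) * `|f y| `^ r)%:E)%E.
  by apply: measurable_kernel_integral => // y; exact: powR_ge0.
apply: (@le_trans _ _ (\int[mu]_x ((A `^ (r - 2))%:E * (B%:E * F) *
    \int[nu]_y (k (x, y) * `|f y| `^ r)%:E))%E); last first.
  have I0 x : setT x -> (0 <= \int[nu]_y (k (x, y) * `|f y| `^ r)%:E)%E.
    by move=> _; apply: integral_ge0 => y _; rewrite lee_fin mulr_ge0 ?powR_ge0.
  rewrite ge0_integralZl//; last first.
    by rewrite !mule_ge0// lee_fin ?powR_ge0// ltW.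
  rewrite lee_wpmul2l//.
    by rewrite !mule_ge0// lee_fin ?powR_ge0// ltW.
  apply: integral_kernel_swap => //; first exact: ltW.
apply: ge0_le_integral => //.
- by move=> x _; exact: poweR_ge0.
- apply: measurable_fun_poweR; apply: measurableT_comp => //.
  by apply: measurable_kernel_integral => // y; exact: sqr_ge0.
- by apply: emeasurable_funM => //; exact: measurable_cst.
move=> x _; rewrite gee0_abs; last first.
  by apply: integral_ge0 => y _; rewrite lee_fin mulr_ge0 ?sqr_ge0.
set I := (\int[nu]_y (k (x, y) * `|f y| `^ r)%:E)%E.
have I0 : (0 <= I)%E by apply: integral_ge0 => y _; rewrite lee_fin mulr_ge0 ?powR_ge0.
have IF : (I <= B%:E * F)%E.
  rewrite -ge0_integralZl_EFin ?(ltW B0)//; last exact/measurable_EFinP.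
  apply: ge0_le_integral => //.
  - by move=> y _; rewrite lee_fin mulr_ge0 ?powR_ge0.
  - by apply/measurable_EFinP/measurable_funM.
  - by apply: measurable_funeM; exact/measurable_EFinP.
  - by move=> y _; rewrite -EFinM lee_fin ler_wpM2r ?powR_ge0.
have J := weighted_jensen r21 A0 (mkx x) mf2 (fun y => k0 _) (fun y => sqr_ge0 _) (kA x).
have {}J : ((\int[nu]_y (k (x, y) * f y ^+ 2)%:E) `^ (r / 2) <= (A `^ (r / 2 - 1))%:E * I)%E.
  apply: (le_trans J); rewrite le_eqVlt; apply/orP; left; apply/eqP; congr (_ * _)%E.
  apply: eq_integral => y _; rewrite -(real_normK (num_real _)) -powR_mulrn// -powRrM.
  by congr (_ * _ `^ _)%:E; field.
have -> : r = r / 2 * 2 by field.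
rewrite poweRrM; apply: (@le_trans _ _ (((A `^ (r / 2 - 1))%:E * I) `^ 2)%E).
  by apply: ge0_le_poweR => //; exact: poweR_ge0.
rewrite poweRM ?lee_fin ?powR_ge0// poweR_EFin -powRrM.
have -> : (r / 2 - 1) * 2 = r / 2 * 2 - 2 by field.
rewrite -muleA lee_wpmul2l ?lee_fin ?powR_ge0//.
have -> : (I `^ 2 = I * I)%E by rewrite (_ : 2 = 1 + 1)%R// poweRD ?poweRe1// add_neq0_poweRD_def.
by rewrite lee_wpmul2r.
Qed.

End schur.

(** * Minkowski's integral inequality *)

Section minkowski_integral.
Context d1 d2 (S : measurableType d1) (X : measurableType d2) (R : realType).
Variable nu : {sigma_finite_measure set S -> \bar R}.
Variable mu : {sigma_finite_measure set X -> \bar R}.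

(** For finite [p], [h] is written as [a g], Jensen is applied with the weight [a], and Tonelli
    concludes. For [p = +oo] the slice bounds hold off null sets that depend on [s], and Tonelli
    turns them into bounds valid for almost every [x]. *)
Lemma Lnorm_integral_le p (h : S * X -> R) (a : S -> R) (A : R) :
  (1 < p)%E -> measurable_fun setT h -> measurable_fun setT a ->
  (forall z, 0 <= h z) -> (forall s, 0 <= a s) ->
  (forall s x, a s = 0 -> h (s, x) = 0) ->
  0 < A -> (\int[nu]_s (a s)%:E <= A%:E)%E ->
  (forall s, 'N[mu]_p[(fun x => (h (s, x))%:E)] <= (a s)%:E)%E ->
  ('N[mu]_p[(fun x => \int[nu]_s (h (s, x))%:E)] <= A%:E)%E.
Proof.
case: p => [r p1|p1|//] mh ma h0 a0 ah A0 aA hN; last first.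
  apply: Lnormy_le; first by rewrite lee_fin ltW.
  pose D := [set z | a z.1 < h z].
  have mD : measurable D.
    rewrite -[D]setTI.
    have := @measurable_fun_ltr _ _ _ setT (fun z => a z.1) h
      (measurableT_comp ma measurable_fst) mh.
    by move=> /(_ measurableT [set true] I); congr (measurable (_ `&` _)).
  pose e z : \bar R := (\1_D z)%:E.
  have me : measurable_fun setT e by apply/measurable_EFinP.
  have e0 z : (0 <= e z)%E by rewrite lee_fin.
  have eS s : (\int[mu]_x e (s, x) = 0)%E.
    rewrite -(@integral0 _ _ _ mu setT).
    apply: ge0_ae_eq_integral => //.
    - exact: (measurableT_comp me (measurable_pair1 s)).
    apply: filterS (ae_le_Lnormy mu (fun x => (h (s, x))%:E)) => x hx _.
    rewrite /e indicE memNset// /D/=; apply/negP; rewrite -leNgt -lee_fin.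
    by have := le_trans hx (hN s); rewrite /= ger0_norm.
  have : (\int[mu]_x \int[nu]_s e (s, x) = 0)%E.
    rewrite -(fubini_tonelli e)//.
    by under eq_integral do rewrite eS; rewrite integral0.
  have me2 : measurable_fun setT (fun x => \int[nu]_s e (s, x))%E.
    exact: (measurable_fun_fubini_tonelli_G e).
  have eX0 x : (0 <= \int[nu]_s e (s, x))%E by exact: integral_ge0.
  move=> ie; have /(ae_eq_integral_abs mu measurableT me2) : 
    (\int[mu]_x `|\int[nu]_s e (s, x)| = 0)%E.
    by under eq_integral do rewrite gee0_abs//.
  apply: filterS => x /(_ I) ex.
  rewrite gee0_abs; last by apply: integral_ge0 => s _; rewrite lee_fin.
  apply: le_trans aA; apply: ae_ge0_le_integral => //.
  - by move=> s _; rewrite lee_fin.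
  - by apply/measurable_EFinP; exact: (measurableT_comp mh (measurable_pair2 x)).
  - by move=> s _; rewrite lee_fin.
  - exact/measurable_EFinP.
  have mex : measurable_fun setT (fun s => e (s, x)).
    exact: (measurableT_comp me (measurable_pair2 x)).
  have /(ae_eq_integral_abs nu measurableT mex) : (\int[nu]_s `|e (s, x)| = 0)%E.
    by under eq_integral do rewrite gee0_abs//.
  apply: filterS => s /(_ I) + _.
  rewrite /e indicE lee_fin leNgt; apply: contra_eqN => Dsx.
  by rewrite mem_set// oner_neq0.
have r1 : 1 < r by rewrite -lte_fin.
have r0 : 0 < r by rewrite (lt_trans _ r1).
have rn0 : r != 0 by rewrite gt_eqF.
(* Division by 0 gives 0, so where [a s = 0] the factorisation rests on the hypothesis that [h]
   vanishes there. *)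
pose g z := h z / a z.1.
have hE s x : h (s, x) = a s * g (s, x).
  rewrite /g/= mulrC; have [/ah ->|as0] := eqVneq (a s) 0; first by rewrite !mul0r.
  by rewrite divfK.
have g0 z : 0 <= g z by rewrite divr_ge0.
have mg : measurable_fun setT g.
  apply: measurable_funM => //.
  by apply: measurable_fun_inv; exact: (measurableT_comp ma measurable_fst).
have mgr : measurable_fun setT (fun z => a z.1 * g z `^ r).
  apply: measurable_funM; first exact: (measurableT_comp ma measurable_fst).
  exact: measurable_fun_powR.
rewrite unlock.
have -> : (A%:E = ((A `^ (r - 1))%:E * A%:E) `^ r^-1)%E.
  rewrite -EFinM poweR_EFin; congr EFin.
  by rewrite mulrC mulr_powRB1 ?ltW// -powRrM mulfV// powRr1// ltW.
apply: ge0_le_poweR; first by rewrite invr_ge0 ltW.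
  by apply: integral_ge0 => x _; exact: poweR_ge0.
apply: (@le_trans _ _ (\int[mu]_x ((A `^ (r - 1))%:E *
    \int[nu]_s (a s * g (s, x) `^ r)%:E))%E).
  apply: ge0_le_integral => //.
  - by move=> x _; exact: poweR_ge0.
  - apply: measurable_fun_poweR; apply: measurableT_comp => //.
    apply: (measurable_fun_fubini_tonelli_G (fun z => (h z)%:E)).
      exact/measurable_EFinP.
    by move=> z; rewrite lee_fin.
  - apply: measurable_funeM.
    apply: (measurable_fun_fubini_tonelli_G (fun z => (a z.1 * g z `^ r)%:E)).
      exact/measurable_EFinP.
    by move=> z; rewrite lee_fin mulr_ge0 ?powR_ge0.
  move=> x _; rewrite gee0_abs; last first.
    by apply: integral_ge0 => s _; rewrite lee_fin.
  under eq_integral do rewrite hE.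
  apply: weighted_jensen => //.
  exact: (measurableT_comp mg (measurable_pair2 x)).
rewrite ge0_integralZl_EFin ?powR_ge0//; first last.
- apply: (measurable_fun_fubini_tonelli_G (fun z => (a z.1 * g z `^ r)%:E)).
    exact/measurable_EFinP.
  by move=> z; rewrite lee_fin mulr_ge0 ?powR_ge0.
- by move=> x _; apply: integral_ge0 => s _; rewrite lee_fin mulr_ge0 ?powR_ge0.
rewrite lee_wpmul2l ?lee_fin ?powR_ge0//.
rewrite -(fubini_tonelli (fun z => (a z.1 * g z `^ r)%:E)); first last.
- by move=> z; rewrite lee_fin mulr_ge0 ?powR_ge0.
- exact/measurable_EFinP.
apply: le_trans aA; apply: ge0_le_integral => //.
- by move=> s _; apply: integral_ge0 => x _; rewrite lee_fin mulr_ge0 ?powR_ge0.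
- apply: (measurable_fun_fubini_tonelli_F (fun z => (a z.1 * g z `^ r)%:E)).
    exact/measurable_EFinP.
  by move=> z; rewrite lee_fin mulr_ge0 ?powR_ge0.
- exact/measurable_EFinP.
move=> s _ /=; have [as0|as0] := eqVneq (a s) 0.
  under eq_integral do rewrite as0 mul0r.
  by rewrite integral0 as0.
have asp : 0 < a s by rewrite lt_neqAle eq_sym as0/=.
under eq_integral => x _.
  rewrite /g/= powRM ?invr_ge0// mulrC -mulrA mulrC EFinM.
  over.
rewrite ge0_integralZl_EFin ?mulr_ge0 ?powR_ge0//; first last.
- apply/measurable_EFinP/measurable_fun_powR.
  exact: (measurableT_comp mh (measurable_pair1 s)).
- by move=> x _; rewrite lee_fin powR_ge0.
have : (\int[mu]_x ((h (s, x) `^ r)%:E) <= (a s `^ r)%:E)%E.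
  rewrite -poweR_EFin; have := hN s.
  move=> /(ge0_le_poweR (ltW r0) (Lnorm_ge0 _ _ _)).
  rewrite LnormEr//; apply: le_trans.
  by under [leRHS]eq_integral do rewrite ger0_norm//.
move=> /(lee_wpmul2l (x := ((a s)^-1 `^ r * a s)%:E)) => /(_ _)/le_trans; apply.
  by rewrite lee_fin mulr_ge0 ?powR_ge0.
rewrite -EFinM lee_fin mulrAC -powRM ?invr_ge0// mulVf// powR1 mul1r//.
Qed.

End minkowski_integral.

(** * Derivatives of the heat kernel *)

Section partial_derivatives.
Variables (R : realType) (n : nat).
Local Notation V := 'rV[R]_n.
Implicit Types (f g : V -> R) (x v : V).

(** A directional derivative is an ordinary derivative along a line, which opens the way to
    one-variable calculus. *)
Lemma is_derive_line (h : R) x v f df : is_derive (h *: v + x) v f df <->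
  is_derive h (1 : R) (fun r => f (r *: v + x)) df.
Proof.
have E : (fun r : R => r^-1 *: (f (r *: v + (h *: v + x)) - f (h *: v + x))) =
    (fun r : R => r^-1 *: (((fun r => f (r *: v + x)) \o shift h) (r *: 1) - f (h *: v + x))).
  by apply/funext => r /=; rewrite [r *: 1]mulr1 scalerDl addrA.
split=> -[]; rewrite /derivable /derive /=.
  by rewrite E => h1 h2; split; rewrite /derivable /derive.
by rewrite -E => h1 h2; split; rewrite /derivable /derive.
Qed.

Lemma is_derive_lineP x v f df :
  is_derive x v f df <-> is_derive (0 : R) (1 : R) (fun h => f (h *: v + x)) df.
Proof. by rewrite -is_derive_line scale0r add0r. Qed.

Lemma is_derive_coord i x v : is_derive x v (fun y => y ord0 i) (v ord0 i).
Proof.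
apply/is_derive_lineP.
rewrite (_ : (fun h : R => _) = (fun h => h * v ord0 i + x ord0 i)); last first.
  by apply/funext => h; rewrite !mxE.
have h1 := is_deriveD (is_deriveM (is_derive_id (0 : R) (1 : R)) (is_derive_cst (v ord0 i) (0 : R) (1 : R)))
  (is_derive_cst (x ord0 i) (0 : R) (1 : R)).
apply: (is_derive_eq h1).
by rewrite /= scaler0 add0r addr0 /GRing.scale/= mulr1.
Qed.

Lemma is_partial_coord i k x :
  is_derive x (delta_mx ord0 k) (fun y => y ord0 i) (i == k)%:R.
Proof. by apply: (is_derive_eq (is_derive_coord i x _)); rewrite mxE eqxx. Qed.

Lemma is_partial_mul k x f g df dg :
  is_derive x (delta_mx ord0 k) f df -> is_derive x (delta_mx ord0 k) g dg ->
  is_derive x (delta_mx ord0 k) (fun y => f y * g y) (df * g x + f x * dg).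
Proof.
move=> hf hg; apply: (is_derive_eq (is_deriveM hf hg)).
by rewrite /GRing.scale/= addrC mulrC [_ * dg]mulrC mulrC [dg * _]mulrC.
Qed.

Lemma is_derive_expR_comp x v f df : is_derive x v f df ->
  is_derive x v (fun y => expR (f y)) (df * expR (f x)).
Proof.
move=> /is_derive_lineP hf; apply/is_derive_lineP.
have h0 := is_derive_expR (f (0 *: v + x)).
apply: (is_derive_eq (is_derive1_comp h0 hf)).
by rewrite mulrC scale0r add0r.
Qed.

(** Differentiation under the integral sign. The domination is required only on the segment
    [|h| < 1] around [x], so that compactly supported majorants are admissible. *)
Lemma is_derive_Rintegral dY (Y : measurableType dY) (mu : {measure set Y -> \bar R})
    (B : set Y) (g g' : Y -> V -> R) (w : Y -> R) (v x : V) :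
  measurable B ->
  (forall h : R, `|h| < 1 -> mu.-integrable B (fun y => (g y (h *: v + x))%:E)) ->
  (forall y z, B y -> is_derive z v (g y) (g' y z)) ->
  (forall (h : R) y, `|h| < 1 -> B y -> `|g' y (h *: v + x)| <= w y) ->
  (forall y, 0 <= w y) -> mu.-integrable B (EFin \o w) ->
  is_derive x v (fun z => \int[mu]_(y in B) g y z) (\int[mu]_(y in B) g' y x).
Proof.
move=> mB ig dg gw w0 iw; apply/is_derive_lineP.
pose f (h : R) y := g y (h *: v + x).
have I0 : `]-1, 1[%classic (0 : R) by rewrite /= in_itv/= ltrN10 ltr01.
have I1 (h : R) : `]-1, 1[%classic h -> `|h| < 1 by rewrite /= in_itv/= ltr_norml.
have df h y : B y -> is_derive h (1 : R) (f ^~ y) (g' y (h *: v + x)).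
  by move=> By; apply/is_derive_line; exact: dg.
have d1 h y : B y -> partial1of2 f h y = g' y (h *: v + x).
  by move=> By; rewrite partial1of2E; have [_ ->] := df h y By.
have h1 h : `]-1, 1[%classic h -> mu.-integrable B (EFin \o f h).
  by move=> /I1; exact: ig.
have h2 h y : `]-1, 1[%classic h -> B y -> derivable (f ^~ y) h 1.
  by move=> _ By; have [] := df h y By.
have h3 h y : `]-1, 1[%classic h -> B y -> `|partial1of2 f h y| <= w y.
  by move=> /I1 hI By; rewrite d1//; exact: gw.
split; first exact: (derivable_under_integral mB I0 h1 h2 w0 iw h3).
have := differentiation_under_integral mB I0 h1 h2 w0 iw h3.
rewrite derive1E => ->; apply: eq_Rintegral => y /[!inE] By.
by rewrite d1// scale0r add0r.
Qed.

End partial_derivatives.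

Section heat_kernel_derivatives.
Variables (R : realType) (d : nat).
Local Notation V := 'rV[R]_d.
Implicit Types (x : V) (s t : R) (i j k : 'I_d).

(** Closed forms of the first, second and third spatial derivatives of the Gaussian. Third order is
    what the kernel of [exp(t Delta) P div] calls for: two derivatives from [P] and one from
    [div]. *)
Definition heat_d1 j s x : R := - (x ord0 j / (2 * s)) * heat_kernel s x.

Definition heat_d2 i j s x : R :=
  (x ord0 i * x ord0 j / (2 * s) ^+ 2 - (i == j)%:R / (2 * s)) * heat_kernel s x.

Definition heat_d3 k i j s x : R :=
  (((i == k)%:R * x ord0 j + (j == k)%:R * x ord0 i + (i == j)%:R * x ord0 k) /
     (2 * s) ^+ 2
   - x ord0 i * x ord0 j * x ord0 k / (2 * s) ^+ 3) * heat_kernel s x.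

Lemma is_partial_heat_kernel j s x : 0 < s ->
  is_derive x (delta_mx ord0 j) (heat_kernel s) (heat_d1 j s x).
Proof.
move=> s0.
have hq : is_derive x (delta_mx ord0 j) (fun y => \sum_i y ord0 i ^+ 2) (2 * x ord0 j).
  rewrite (_ : (fun y : V => _) = \sum_i ((fun y : V => y ord0 i) ^+ 2)); last first.
    by apply/funext => y; rewrite fct_sumE; apply: eq_bigr => i _; rewrite fctE.
  have h i := is_deriveX 2 (is_partial_coord i j x).
  apply: (is_derive_eq (is_derive_sum h)).
  rewrite (bigD1 j)//= eqxx big1 ?addr0.
    by rewrite /GRing.scale/= mulr1 expr1.
  by move=> i /negbTE ->; rewrite scaler0.
pose c := (4 * pi * s) `^ (- (d%:R / 2)).
rewrite (_ : @heat_kernel R d s = (fun y => c * expR (- (4 * s)^-1 * \sum_i y ord0 i ^+ 2))); last first.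
  by apply/funext => y; rewrite /heat_kernel enorm_sqr mulNr [_^-1 * _]mulrC.
have hc := is_derive_cst (- (4 * s)^-1 : R) x (delta_mx ord0 j).
have hc2 := is_derive_cst (c : R) x (delta_mx ord0 j).
have h := is_partial_mul hc2 (is_derive_expR_comp (is_partial_mul hc hq)).
apply: (is_derive_eq h); rewrite /heat_d1 /heat_kernel enorm_sqr -/c.
have -> : - ((\sum_i x ord0 i ^+ 2) / (4 * s)) = - (4 * s)^-1 * \sum_i x ord0 i ^+ 2.
  by rewrite mulNr [_^-1 * _]mulrC.
rewrite /cst; set E := expR _; field.
by rewrite gt_eqF.
Qed.

Lemma is_partial_heat_d1 i j s x : 0 < s ->
  is_derive x (delta_mx ord0 i) (heat_d1 j s) (heat_d2 i j s x).
Proof.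
move=> s0.
have h := is_partial_mul (is_partial_mul (is_derive_cst (- (2 * s)^-1 : R) x _)
  (is_partial_coord j i x)) (is_partial_heat_kernel i x s0).
rewrite (_ : heat_d1 j s = (fun y => (- (2 * s)^-1 * y ord0 j) * heat_kernel s y)); last first.
  by apply/funext => y; rewrite /heat_d1; congr (_ * _); ring.
apply: (is_derive_eq h); rewrite /heat_d1 /heat_d2 /cst (eq_sym j i).
by field; rewrite gt_eqF.
Qed.

Lemma is_partial_heat_d2 k i j s x : 0 < s ->
  is_derive x (delta_mx ord0 k) (heat_d2 i j s) (heat_d3 k i j s x).
Proof.
move=> s0.
have hc (c : R) := is_derive_cst c x (delta_mx ord0 k).
have hq := is_partial_mul (hc ((2 * s) ^- 2))
  (is_partial_mul (is_partial_coord i k x) (is_partial_coord j k x)).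
have h := is_partial_mul (is_deriveB hq (hc ((i == j)%:R / (2 * s))))
  (is_partial_heat_kernel k x s0).
rewrite (_ : heat_d2 i j s = (fun y => ((2 * s) ^- 2 * (y ord0 i * y ord0 j)
   - (i == j)%:R / (2 * s)) * heat_kernel s y)); last first.
  by apply/funext => y; rewrite /heat_d2; congr ((_ - _) * _); ring.
apply: (is_derive_eq h); rewrite /heat_d1 /heat_d3 !fctE /cst.
by field; rewrite gt_eqF.
Qed.


Lemma powR_half2 s : 0 < s -> s `^ (- 2^-1) ^+ 2 = s^-1.
Proof.
move=> s0; rewrite -powR_mulrn ?powR_ge0// -powRrM mulNr mulVf ?pnatr_eq0//.
by rewrite powR_inv1 ?ltW.
Qed.

Lemma heat_kernel_le t x : 0 < t ->
  heat_kernel t x <= (4 * pi) `^ (- (d%:R / 2)) * t `^ (- (d%:R / 2)).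
Proof.
move=> t0; have p0 := pi_gt0 R.
have p4 : 0 <= 4 * pi :> R by rewrite mulr_ge0 ?(ltW p0).
rewrite -(powRM _ p4 (ltW t0)).
rewrite /heat_kernel ler_piMr ?powR_ge0// -[leRHS]expR0 ler_expR oppr_le0.
by rewrite divr_ge0 ?sqr_ge0// ltW ?mulr_gt0.
Qed.

(* Locked, as unification would otherwise unfold it into a product. *)
Definition gauss_const : R := locked (257 * 2 `^ (d%:R / 2)).

Lemma gauss_const_gt0 : 0 < gauss_const.
Proof. by rewrite /gauss_const -lock mulr_gt0 ?ltr0n ?powR_gt0. Qed.

(** The exponent of [G_s] is twice that of [G_(2s)]. The spare factor [exp(- |x|^2 / (8 s))] pays
    for polynomial weights here, and for the tail away from a ball in the sparse estimate. *)
Lemma heat_kernel_double s x : 0 < s -> heat_kernel s x =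
  2 `^ (d%:R / 2) * expR (- (enorm x ^+ 2 / (8 * s))) * heat_kernel (2 * s) x.
Proof.
move=> s0; have p0 := pi_gt0 R.
rewrite /heat_kernel mulrACA; congr (_ * _); last first.
  by rewrite -expRD; congr expR; field; rewrite gt_eqF.
have -> : 4 * pi * (2 * s) = 2 * (4 * pi * s) by ring.
rewrite [X in _ = _ * X]powRM ?mulr_ge0 ?(ltW p0) ?(ltW s0)// mulrA -powRD ?subrr ?powRr0 ?mul1r//.
by rewrite pnatr_eq0 implybT.
Qed.

(** Powers of [|x| / sqrt s] are absorbed by the spare Gaussian factor at the price of doubling the
    time. Derivatives of [G_s] are thereby bounded by a power of [s] times [G_(2s)]. *)
Lemma gauss_moment m s x : 0 < s -> (m <= 4)%N ->
  (enorm x * s `^ (- 2^-1)) ^+ m * heat_kernel s x <=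
  gauss_const * heat_kernel (2 * s) x.
Proof.
move=> s0 m4; set y := enorm x * _.
have y0 : 0 <= y by rewrite mulr_ge0 ?powR_ge0 ?enorm_ge0.
have ym : y ^+ m <= 1 + y ^+ 4.
  have [y1|y1] := leP y 1.
    by rewrite (le_trans (exprn_ile1 _ y0 y1))// lerDl exprn_ge0.
  by rewrite (le_trans (_ : _ <= y ^+ 4)) ?ler_weXn2l ?(ltW y1)// lerDr.
rewrite heat_kernel_double// mulrA.
apply: ler_wpM2r; first exact: heat_kernel_ge0.
rewrite mulrC /gauss_const -lock -mulrA mulrC ler_wpM2r ?powR_ge0//.
set z := _ / _.
have z0 : 0 <= z by rewrite divr_ge0 ?sqr_ge0// mulr_ge0// ltW.
have y4 : y ^+ 4 = 64 * z ^+ 2.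
  rewrite (_ : y ^+ 4 = (enorm x ^+ 2 * (s `^ (- 2^-1)) ^+ 2) ^+ 2); last by rewrite /y; ring.
  by rewrite powR_half2// /z; field; rewrite gt_eqF.
rewrite expRN mulrC ler_pdivrMr ?expR_gt0//; apply: (le_trans ym); rewrite y4.
(* Here [64 z^2 = 256 (z / 2)^2 <= 256 (1 + z / 2)^2], and the remaining 1 is at most
   [(1 + z / 2)^2]: this is the 257 in [gauss_const]. *)
have h : (1 + z / 2) ^+ 2 <= expR z.
  rewrite [in leRHS](_ : z = z / 2 + z / 2); last by field.
  by rewrite expRD -expr2 lerXn2r ?nnegrE ?expR_ge0 ?expR_ge1Dx// addr_ge0// divr_ge0.
nra.
Qed.


Lemma heat_d1_le j s x : 0 < s ->
  `|heat_d1 j s x| <= gauss_const * s `^ (- 2^-1) * heat_kernel (2 * s) x.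
Proof.
move=> s0; have p0 : 0 <= s `^ (- 2^-1) by exact: powR_ge0.
have := gauss_moment x s0 (isT : (1 <= 4)%N); rewrite expr1.
set G := heat_kernel (2 * s) x; set g := heat_kernel s x; set rs := s `^ _ in p0 * => h.
rewrite /heat_d1 normrM (ger0_norm (heat_kernel_ge0 _ _)) -/g normrN normrM.
rewrite [`|(2 * s)^-1|]ger0_norm ?invr_ge0 ?mulr_ge0 ?(ltW s0)//.
have g0 : 0 <= g by exact: heat_kernel_ge0.
have G0 : 0 <= G by exact: heat_kernel_ge0.
have c0 : 0 <= gauss_const := ltW gauss_const_gt0.
have rs2 : rs ^+ 2 = s^-1 := powR_half2 s0.
clearbody g G rs.
have e0 := enorm_ge0 x.
apply: (@le_trans _ _ (enorm x / (2 * s) * g)).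
  by rewrite !ler_wpM2r ?coord_le_enorm// invr_ge0 mulr_ge0// ltW.
have -> : enorm x / (2 * s) * g = 2^-1 * rs * (enorm x * rs * g).
  rewrite invfM -rs2; ring.
have : rs * (enorm x * rs * g) <= rs * (gauss_const * G) by rewrite ler_wpM2l.
have : 0 <= rs * (enorm x * rs * g) by rewrite !mulr_ge0.
nra.
Qed.

Lemma heat_d2_le i j s x : 0 < s ->
  `|heat_d2 i j s x| <= gauss_const * s^-1 * heat_kernel (2 * s) x.
Proof.
move=> s0; have p0 : 0 <= s `^ (- 2^-1) by exact: powR_ge0.
have := gauss_moment x s0 (isT : (2 <= 4)%N).
have := gauss_moment x s0 (isT : (0 <= 4)%N); rewrite expr0 mul1r.
set G := heat_kernel (2 * s) x; set g := heat_kernel s x; set rs := s `^ _ in p0 * => h0 h2.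
have si : 0 < s^-1 by rewrite invr_gt0.
rewrite /heat_d2 normrM (ger0_norm (heat_kernel_ge0 _ _)) -/g.
have g0 : 0 <= g by exact: heat_kernel_ge0.
have G0 : 0 <= G by exact: heat_kernel_ge0.
have c0 : 0 <= gauss_const := ltW gauss_const_gt0.
have rs2 : rs ^+ 2 = s^-1 := powR_half2 s0.
clearbody g G rs.
have e0 := enorm_ge0 x.
apply: (@le_trans _ _ ((enorm x * enorm x * (2 * s) ^- 2 + (2 * s)^-1) * g)).
  rewrite ler_wpM2r// (le_trans (ler_normB _ _))// lerD//.
    rewrite !normrM [`|(_ ^- 2)|]ger0_norm ?invr_ge0 ?sqr_ge0//.
    by rewrite ler_wpM2r ?invr_ge0 ?sqr_ge0// ler_pM ?coord_le_enorm.
  rewrite normrM [`|(2 * s)^-1|]ger0_norm ?invr_ge0 ?mulr_ge0 ?(ltW s0)//.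
  rewrite ger0_norm// ler_piMl ?invr_ge0 ?mulr_ge0 ?(ltW s0)//.
  by case: (i == j).
have -> : (enorm x * enorm x * (2 * s) ^- 2 + (2 * s)^-1) * g =
   s^-1 * (4^-1 * ((enorm x * rs) ^+ 2 * g) + 2^-1 * g).
  rewrite [(enorm x * rs) ^+ 2]exprMn rs2; field; by rewrite gt_eqF.
have -> : gauss_const * s^-1 * G = s^-1 * (gauss_const * G) by ring.
rewrite ler_wpM2l ?(ltW si)//; lra.
Qed.

Lemma heat_d3_le k i j s x : 0 < s ->
  `|heat_d3 k i j s x| <= gauss_const * (s^-1 * s `^ (- 2^-1)) * heat_kernel (2 * s) x.
Proof.
move=> s0; have p0 : 0 <= s `^ (- 2^-1) by exact: powR_ge0.
have := gauss_moment x s0 (isT : (3 <= 4)%N).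
have := gauss_moment x s0 (isT : (1 <= 4)%N); rewrite expr1.
set G := heat_kernel (2 * s) x; set g := heat_kernel s x; set rs := s `^ _ in p0 * => h1 h3.
have si : 0 < s^-1 by rewrite invr_gt0.
rewrite /heat_d3 normrM (ger0_norm (heat_kernel_ge0 _ _)) -/g.
have g0 : 0 <= g by exact: heat_kernel_ge0.
have G0 : 0 <= G by exact: heat_kernel_ge0.
have c0 : 0 <= gauss_const := ltW gauss_const_gt0.
have rs2 : rs ^+ 2 = s^-1 := powR_half2 s0.
clearbody g G rs.
have e0 := enorm_ge0 x.
have b1 (b : bool) l : `|b%:R * x ord0 l| <= enorm x.
  by case: b; rewrite ?mul1r ?mul0r ?normr0// coord_le_enorm.
apply: (@le_trans _ _ ((3 * enorm x * (2 * s) ^- 2 + enorm x * enorm x * enorm x * (2 * s) ^- 3) * g)).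
  rewrite ler_wpM2r// (le_trans (ler_normB _ _))// lerD//.
    rewrite normrM [`|(_ ^- 2)|]ger0_norm ?invr_ge0 ?sqr_ge0//.
    rewrite ler_wpM2r ?invr_ge0 ?sqr_ge0//.
    have -> : 3 * enorm x = enorm x + enorm x + enorm x by ring.
    by rewrite (le_trans (ler_normD _ _))// lerD// (le_trans (ler_normD _ _))// lerD.
  have s30 : 0 <= (2 * s) ^- 3 by rewrite invr_ge0 exprn_ge0// mulr_ge0// ltW.
  rewrite !normrM [`|(_ ^- 3)|]ger0_norm//.
  by rewrite ler_wpM2r// !ler_pM ?mulr_ge0 ?coord_le_enorm.
have -> : (3 * enorm x * (2 * s) ^- 2 + enorm x * enorm x * enorm x * (2 * s) ^- 3) * g =
   s^-1 * (4^-1 * 3 * (s^-1 * enorm x * g) + 8^-1 * (s^-1 * s^-1 * enorm x ^+ 3 * g)).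
  by field; rewrite gt_eqF.
have -> : s^-1 * enorm x * g = rs * (enorm x * rs * g).
  by rewrite -rs2; ring.
have -> : s^-1 * s^-1 * enorm x ^+ 3 * g = rs * ((enorm x * rs) ^+ 3 * g).
  by rewrite -rs2; ring.
have -> : gauss_const * (s^-1 * rs) * G = s^-1 * (rs * (gauss_const * G)) by ring.
rewrite ler_wpM2l ?(ltW si)//.
have : rs * (enorm x * rs * g) <= rs * (gauss_const * G) by rewrite ler_wpM2l.
have : rs * ((enorm x * rs) ^+ 3 * g) <= rs * (gauss_const * G) by rewrite ler_wpM2l.
have : 0 <= rs * (gauss_const * G) := mulr_ge0 p0 (mulr_ge0 c0 G0).
lra.
Qed.

End heat_kernel_derivatives.

(** * Integrals of [s^(-3/2)] over a half-line *)

Section tail_integrals.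
Variable R : realType.
Implicit Types (s t : R).

Lemma powR_3half s : 0 < s -> s^-1 * s `^ (- 2^-1) = s `^ (- (3 / 2)).
Proof.
move=> s0; rewrite -powR_inv1 ?(ltW s0)// -powRD; first by congr (_ `^ _); field.
by rewrite (gt_eqF s0) implybT.
Qed.

Lemma powR_cvg_pinfty (a : R) : 0 < a -> s `^ (- a) @[s --> +oo%R] --> (0 : R).
Proof.
move=> a0; apply/cvgrPdist_lt => e e0; near=> s.
have s0 : 0 < s by near: s; exact: nbhs_pinfty_gt.
rewrite sub0r normrN ger0_norm ?powR_ge0// powRN invf_plt ?posrE ?powR_gt0//.
have : e^-1 `^ a^-1 < s by near: s; apply: nbhs_pinfty_gt; rewrite num_real.
have xn : e^-1 `^ a^-1 \in Num.nneg by rewrite nnegrE powR_ge0.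
have sn : s \in Num.nneg by rewrite nnegrE ltW.
move=> /(gt0_ltr_powR a0 xn sn).
by rewrite -powRrM mulVf ?gt_eqF// powRr1// invr_ge0 ltW.
Unshelve. all: end_near. Qed.

Lemma integral_powR_tail t : 0 < t ->
  (\int[lebesgue_measure]_(s in `]t, +oo[) (s `^ (- (3 / 2)))%:E =
   (2 * t `^ (- 2^-1))%:E)%E.
Proof.
move=> t0.
pose F s := - 2 * s `^ (- 2^-1).
have dF s : 0 < s -> is_derive s (1 : R) F (s `^ (- (3 / 2))).
  move=> s0; have h := is_deriveZ (- 2 : R) (is_derive1_powR (- 2^-1) s0).
  apply: (is_derive_eq h); rewrite /GRing.scale/= mulrA.
  by rewrite mulrNN mulfV// mul1r; congr (_ `^ _); field.
rewrite integral_itv_obnd_cbnd; last first.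
  by apply/measurable_EFinP/measurable_funTS; exact: measurable_powR.
rewrite (@ge0_continuous_FTC2y _ (fun s => s `^ (- (3 / 2))) F t 0).
- by rewrite sub0e -EFinN /F mulNr opprK.
- by move=> s _; exact: powR_ge0.
- apply: continuous_in_subspaceT => s /[!inE]/= /[!in_itv]/= /[!andbT] ts.
  have s0 : 0 < s by rewrite (lt_le_trans t0).
  have [+ _] := is_derive1_powR (- (3 / 2)) s0.
  by move=> /derivable1_diffP/differentiable_continuous.
- rewrite -(mulr0 (- 2)); apply: cvgM; first exact: cvg_cst.
  by apply: powR_cvg_pinfty; rewrite invr_gt0.
- by move=> s ts; have [] := dF s (lt_trans t0 ts).
- apply: cvg_at_right_filter.
  have [+ _] := dF t t0.
  by move=> /derivable1_diffP/differentiable_continuous.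
- move=> s /[!in_itv]/= /[!andbT] ts.
  by rewrite derive1E; have [_ ->] := dF s (lt_trans t0 ts).
Qed.

Lemma integrable_powR_tail t : 0 < t ->
  lebesgue_measure.-integrable `]t, +oo[ (fun s => (s `^ (- (3 / 2)))%:E).
Proof.
move=> t0; apply/integrableP; split.
  by apply/measurable_EFinP/measurable_funTS; exact: measurable_powR.
under eq_integral do rewrite gee0_abs ?lee_fin ?powR_ge0//.
by rewrite integral_powR_tail// ltry.
Qed.

Lemma integrable_powR_tailZ (C t : R) : 0 < t ->
  lebesgue_measure.-integrable `]t, +oo[ (fun s => (C * s `^ (- (3 / 2)))%:E).
Proof.
move=> t0.
have h := integrableZl _ C (integrable_powR_tail t0).
by apply: h; exact: measurable_itv.
Qed.

Lemma integral_powR_tailZ (C t : R) : 0 < t ->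
  (\int[lebesgue_measure]_(s in `]t, +oo[) (C * s `^ (- (3 / 2)))%:E =
   (C * (2 * t `^ (- 2^-1)))%:E)%E.
Proof.
move=> t0; under eq_integral do rewrite EFinM.
rewrite integralZl//; last exact: integrable_powR_tail.
by rewrite integral_powR_tail.
Qed.

Lemma Rintegral_powR_tailZ (C t : R) : 0 < t ->
  \int[lebesgue_measure]_(s in `]t, +oo[) (C * s `^ (- (3 / 2))) =
  C * (2 * t `^ (- 2^-1)).
Proof. by move=> t0; rewrite /Rintegral integral_powR_tailZ. Qed.

End tail_integrals.

(** * The Leray kernel *)

Section measurable_Rintegral.
Context d1 d2 (X : measurableType d1) (Y : measurableType d2) (R : realType).
Variable nu : {sigma_finite_measure set Y -> \bar R}.

(** No integrability is assumed: the integrals of the positive and negative parts are measurable by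
    Tonelli, and so is [fine] of their difference, even where both are infinite. *)
Lemma measurable_Rintegral (h : X * Y -> R) : measurable_fun setT h ->
  measurable_fun setT (fun x => \int[nu]_y h (x, y)).
Proof.
move=> mh; have mH : measurable_fun setT (EFin \o h) by exact/measurable_EFinP.
have E x : (\int[nu]_y (h (x, y))%:E = \int[nu]_y ((EFin \o h)^\+ (x, y)) -
    \int[nu]_y ((EFin \o h)^\- (x, y)))%E.
  rewrite -[LHS]/(\int[nu]_y (((EFin \o h) \o pair x) y))%E integralE.
  by rewrite funepos_comp funeneg_comp.
have mp := measurable_funepos mH; have mn := measurable_funeneg mH.
rewrite /Rintegral; apply: (@measurableT_comp _ _ _ _ _ _ fine) => //.
under eq_fun do rewrite E.
apply: emeasurable_funB.
  have := @measurable_fun_fubini_tonelli_F _ _ X Y R nu _ mp.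
  by apply => z; exact: funepos_ge0.
have := @measurable_fun_fubini_tonelli_F _ _ X Y R nu _ mn.
by apply => z; exact: funeneg_ge0.
Qed.

End measurable_Rintegral.

Lemma Rintegral_sum d (T : measurableType d) (R : realType)
    (mu : {measure set T -> \bar R}) (D : set T) (I : Type) (r : seq I) (f : I -> T -> R) :
  measurable D -> (forall i, mu.-integrable D (fun x => (f i x)%:E)) ->
  \int[mu]_(x in D) (\sum_(i <- r) f i x) = \sum_(i <- r) \int[mu]_(x in D) f i x.
Proof.
move=> mD fi; elim: r => [|i r IHr].
  rewrite big_nil; under eq_Rintegral do rewrite big_nil.
  by rewrite /Rintegral integral0.
rewrite big_cons -IHr -RintegralD//.
  by apply: eq_Rintegral => x _; rewrite big_cons.
  exact: fi.
rewrite (_ : EFin \o _ = (fun x => \sum_(j <- r) (f j x)%:E)%E).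
  by apply: integrable_sum.
by apply/funext => x /=; rewrite sumEFin.
Qed.

Section kernel_measurability.
Variables (R : realType) (d : nat).
Local Notation V := 'rV[R]_d.
Local Notation T := (measurableTypeR R).

Lemma measurable_coord2 (i : 'I_d) :
  measurable_fun setT (fun z : T * V => z.2 ord0 i).
Proof. exact: (measurableT_comp (measurable_coord i) measurable_snd). Qed.

Lemma measurable_heat_kernel2 :
  measurable_fun setT (fun z : T * V => heat_kernel z.1 z.2).
Proof.
have m1 : measurable_fun setT (fun z : T * V => z.1 : R) by exact: measurable_fst.
apply: measurable_funM.
  by apply: measurable_fun_powR; apply: measurable_funM => //; exact: measurable_cst.
apply: (measurableT_comp (@measurable_expR R)).
apply: measurable_funN; apply: measurable_funM.
  apply: measurable_funX.
  exact: (measurableT_comp (@measurable_enorm R d) measurable_snd).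
by apply: measurable_fun_inv; apply: measurable_funM.
Qed.

Lemma measurable_heat_d1 j :
  measurable_fun setT (fun z : T * V => heat_d1 j z.1 z.2).
Proof.
have m1 : measurable_fun setT (fun z : T * V => z.1 : R) by exact: measurable_fst.
apply: measurable_funM; last exact: measurable_heat_kernel2.
apply: measurable_funN; apply: measurable_funM; first exact: measurable_coord2.
by apply: measurable_fun_inv; apply: measurable_funM.
Qed.

Lemma measurable_heat_d2 i j :
  measurable_fun setT (fun z : T * V => heat_d2 i j z.1 z.2).
Proof.
have m1 : measurable_fun setT (fun z : T * V => 2 * z.1 : R).
  by apply: measurable_funM => //; exact: measurable_fst.
apply: measurable_funM; last exact: measurable_heat_kernel2.
apply: measurable_funB; apply: measurable_funM.
- by apply: measurable_funM; exact: measurable_coord2.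
- by apply: measurable_fun_inv; exact: measurable_funX.
- exact: measurable_cst.
- exact: measurable_fun_inv.
Qed.

Lemma measurable_heat_d3 k i j :
  measurable_fun setT (fun z : T * V => heat_d3 k i j z.1 z.2).
Proof.
have m1 : measurable_fun setT (fun z : T * V => 2 * z.1 : R).
  by apply: measurable_funM => //; exact: measurable_fst.
apply: measurable_funM; last exact: measurable_heat_kernel2.
apply: measurable_funB; apply: measurable_funM.
- apply: measurable_funD; first apply: measurable_funD;
    by apply: measurable_funM => //; exact: measurable_coord2.
- by apply: measurable_fun_inv; exact: measurable_funX.
- apply: measurable_funM; first apply: measurable_funM; exact: measurable_coord2.
- by apply: measurable_fun_inv; exact: measurable_funX.
Qed.

End kernel_measurability.

(* [f] stands for the heat kernel or one of its derivatives. *)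
Section tail_integral.
Variables (R : realType) (d : nat).
Hypothesis d3 : (3 <= d)%N.
Local Notation V := 'rV[R]_d.
Local Notation T := (measurableTypeR R).
Implicit Types (f : R -> V -> R) (t s : R) (x : V).

Definition sup_const : R := locked ((4 * pi) `^ (- (d%:R / 2))).

Lemma sup_const_gt0 : 0 < sup_const.
Proof. by rewrite /sup_const -lock powR_gt0// mulr_gt0// pi_gt0. Qed.


Lemma heat_kernel_sup t x : 0 < t ->
  heat_kernel t x <= sup_const * t `^ (- (d%:R / 2)).
Proof. by rewrite /sup_const -lock; exact: heat_kernel_le. Qed.

Lemma heat_kernel_le2 s x : 0 < s ->
  heat_kernel (2 * s) x <= sup_const * s `^ (- (d%:R / 2)).
Proof.
move=> s0; apply: le_trans (heat_kernel_le x _) _; first by rewrite mulr_gt0.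
rewrite /sup_const -lock ler_wpM2l ?powR_ge0// !powRN lef_pV2 ?posrE ?powR_gt0 ?mulr_gt0//.
by apply: ge0_ler_powR; rewrite ?nnegrE ?mulr_ge0 ?divr_ge0 ?(ltW s0)//; lra.
Qed.

(** Dimension at least 3 makes the decay [s^(- d / 2)] beyond [t] at least as fast as [s^(- 3 / 2)],
    which is integrable at infinity, even before any derivative is taken. *)
Lemma powR_dim_le t s : 0 < t -> t < s ->
  s `^ (- (d%:R / 2)) <= t `^ (- ((d%:R - 3) / 2)) * s `^ (- (3 / 2)).
Proof.
move=> t0 ts; have s0 : 0 < s by rewrite (lt_trans t0).
have -> : - (d%:R / 2) = - ((d%:R - 3) / 2) + - (3 / 2) :> R by field.
rewrite powRD; last by rewrite (gt_eqF s0) implybT.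
rewrite ler_wpM2r ?powR_ge0// !powRN lef_pV2 ?posrE ?powR_gt0//.
have d3' : 0 <= (d%:R - 3) / 2 :> R.
  by rewrite divr_ge0// subr_ge0 (ler_nat _ 3).
by apply: ge0_ler_powR; rewrite ?nnegrE ?(ltW t0) ?(ltW s0) ?(ltW ts).
Qed.

(** In the four instances below [a] is half the order of the derivative; a single argument for
    integrability and differentiation then serves them all. *)
Definition tail_dominated f := [/\ measurable_fun setT (fun z : T * V => f z.1 z.2) &
  exists2 a, 0 <= a & forall s x, 0 < s ->
    `|f s x| <= gauss_const R d * s `^ (- a) * heat_kernel (2 * s) x].

Definition tail_integral f t x := \int[lebesgue_measure]_(s in `]t, +oo[) f s x.

Lemma tail_dominatedP f t : tail_dominated f -> 0 < t ->
  exists2 C, 0 < C & forall s x, t < s -> `|f s x| <= C * s `^ (- (3 / 2)).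
Proof.
move=> [_ [a a0 fa]] t0; exists (gauss_const R d * t `^ (- a) * (sup_const * t `^ (- ((d%:R - 3) / 2)))).
  by rewrite !mulr_gt0 ?powR_gt0 ?gauss_const_gt0 ?sup_const_gt0.
move=> s x ts; have s0 : 0 < s by rewrite (lt_trans t0).
apply: (le_trans (fa _ x s0)); rewrite -[leRHS]mulrA.
apply: ler_pM.
- by rewrite mulr_ge0 ?powR_ge0// ltW// gauss_const_gt0.
- exact: heat_kernel_ge0.
- rewrite ler_wpM2l ?(ltW (gauss_const_gt0 _ _))// !powRN lef_pV2 ?posrE ?powR_gt0//.
  by apply: ge0_ler_powR; rewrite ?nnegrE ?(ltW t0) ?(ltW s0) ?(ltW ts).
apply: (le_trans (heat_kernel_le2 x s0)).
by rewrite -mulrA ler_wpM2l ?(ltW sup_const_gt0)// powR_dim_le.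
Qed.

Lemma tail_integrable f t x : tail_dominated f -> 0 < t ->
  lebesgue_measure.-integrable `]t, +oo[ (fun s => (f s x)%:E).
Proof.
move=> hf t0; have [C C0 fC] := tail_dominatedP hf t0.
apply: (le_integrable _ _ _ (integrable_powR_tailZ C t0)) => //.
- apply/measurable_EFinP/measurable_funTS; case: hf => mf _.
  exact: (measurableT_comp mf (measurable_pair2 x)).
- move=> s /=; rewrite in_itv/= andbT => ts.
  by rewrite lee_fin; apply: (le_trans (fC _ _ ts)); exact: ler_norm.
Qed.

Lemma is_partial_tail_integral f g k t x : tail_dominated f -> tail_dominated g ->
  (forall s y, 0 < s -> is_derive y (delta_mx ord0 k) (f s) (g s y)) -> 0 < t ->
  is_derive x (delta_mx ord0 k) (tail_integral f t) (tail_integral g t x).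
Proof.
move=> hf hg dfg t0; have [C C0 gC] := tail_dominatedP hg t0.
apply: (@is_derive_Rintegral R d _ _ lebesgue_measure `]t, +oo[%classic f g
  (fun s => C * s `^ (- (3 / 2)))) => //.
- by move=> h _; exact: tail_integrable.
- by move=> s z /=; rewrite in_itv/= andbT => ts; apply: dfg; rewrite (lt_trans t0).
- by move=> h s _ /=; rewrite in_itv/= andbT => ts; exact: gC.
- by move=> s; rewrite mulr_ge0 ?powR_ge0// ltW.
- exact: integrable_powR_tailZ.
Qed.

Lemma tail_dominated_heat_kernel : tail_dominated (@heat_kernel R d).
Proof.
split; first exact: measurable_heat_kernel2.
exists 0 => // s x s0; rewrite oppr0 powRr0 mulr1 ger0_norm ?heat_kernel_ge0//.
by have := gauss_moment x s0 (isT : (0 <= 4)%N); rewrite expr0 mul1r.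
Qed.

Lemma tail_dominated_heat_d1 j : tail_dominated (@heat_d1 R d j).
Proof.
split; first exact: measurable_heat_d1.
by exists 2^-1; rewrite ?invr_ge0// => s x; exact: heat_d1_le.
Qed.

Lemma tail_dominated_heat_d2 i j : tail_dominated (@heat_d2 R d i j).
Proof.
split; first exact: measurable_heat_d2.
by exists 1 => // s x s0; rewrite powR_inv1 ?(ltW s0)//; exact: heat_d2_le.
Qed.

Lemma tail_dominated_heat_d3 k i j : tail_dominated (@heat_d3 R d k i j).
Proof.
split; first exact: measurable_heat_d3.
exists (3 / 2); first by rewrite divr_ge0.
by move=> s x s0; rewrite -powR_3half//; exact: heat_d3_le.
Qed.

Lemma measurable_tail_integral f : tail_dominated f ->
  measurable_fun setT (fun z : T * V => tail_integral f z.1 z.2).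
Proof.
move=> [mf _].
(* The lower limit of integration is itself a variable, so the domain is encoded by an indicator
   that is jointly measurable. *)
have h1 : measurable_fun setT (fun z : (T * V) * T => f z.2 z.1.2 * (z.1.1 < z.2)%R%:R).
  apply: measurable_funM.
    have m : measurable_fun setT (fun z : (T * V) * T => (z.2, z.1.2)).
      apply: measurable_fun_pair => //.
      exact: (measurableT_comp measurable_snd measurable_fst).
    exact: (measurableT_comp mf m).
  pose D := [set z : (T * V) * T | z.1.1 < z.2].
  have mD : measurable D.
    rewrite -[D]setTI.
    have m11 : measurable_fun setT (fun z : (T * V) * T => z.1.1 : R).
      exact: (measurableT_comp measurable_fst measurable_fst).
    have := measurable_fun_ltr m11 measurable_snd.
    by move=> /(_ measurableT [set true] I); congr (measurable (_ `&` _)).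
  rewrite (_ : (fun z => _) = \1_D); first exact: measurable_indic.
  by apply/funext => z; rewrite indicE /D; congr (nat_of_bool _)%:R; apply/idP/idP; rewrite inE.
rewrite (_ : (fun z => _) = fun z : T * V => \int[lebesgue_measure]_s (f s z.2 * (z.1 < s)%R%:R)).
  exact: (measurable_Rintegral _ h1).
apply/funext => z; rewrite /tail_integral Rintegral_mkcond.
apply: eq_Rintegral => s _; rewrite patchE.
case: ifPn => [/[!inE]/=|/negP /[!inE]/=]; rewrite in_itv/= andbT.
  by move=> ->; rewrite mulr1.
by move/negP/negbTE => ->; rewrite mulr0.
Qed.

Lemma tail_integral_bounded f t : tail_dominated f -> 0 < t ->
  exists M, forall x, `|tail_integral f t x| <= M.
Proof.
move=> hf t0; have [C C0 fC] := tail_dominatedP hf t0.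
exists (C * (2 * t `^ (- 2^-1))) => x.
rewrite (le_trans (le_normr_Rintegral _ (tail_integrable x hf t0)))//.
rewrite -Rintegral_powR_tailZ//.
apply: le_Rintegral => //.
- by apply: integrable_norm; exact: tail_integrable.
- exact: integrable_powR_tailZ.
- by move=> s /=; rewrite in_itv/= andbT => ts; exact: fC.
Qed.

End tail_integral.


(** * Convolution with the heat kernel *)

Section heat_convolution.
Variables (R : realType) (d : nat).
Local Notation V := 'rV[R]_d.
Local Notation mu := (lebesgue_rV R d).
Implicit Types (f g : V -> R) (x y : V) (t : R).

Lemma measurable_sub_const x : measurable_fun setT (fun y : V => x - y).
Proof. exact: (measurableT_comp (@measurable_rV_sub R d) (measurable_pair1 x)). Qed.

Lemma measurable_comp_sub f x : measurable_fun setT f ->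
  measurable_fun setT (fun y => f (x - y)).
Proof. by move=> mf; exact: (measurableT_comp mf (measurable_sub_const x)). Qed.

Lemma measurable_comp_add f x : measurable_fun setT f ->
  measurable_fun setT (fun y => f (y + x)).
Proof.
move=> mf; apply: (measurableT_comp mf).
exact: (measurableT_comp (@measurable_rV_add R d) (measurable_pair2 x)).
Qed.

Lemma integrable_heat_kernel t : 0 < t ->
  mu.-integrable setT (fun y => (heat_kernel t y)%:E).
Proof.
move=> t0; apply/integrableP; split.
  by apply/measurable_EFinP; exact: measurable_heat_kernel.
under eq_integral do rewrite gee0_abs ?lee_fin ?heat_kernel_ge0//.
by rewrite integral_heat_kernel// ltry.
Qed.

Lemma integrable_mul_bounded g f M : mu.-integrable setT (EFin \o g) ->
  measurable_fun setT f -> (forall x, `|f x| <= M) ->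
  mu.-integrable setT (fun y => (g y * f y)%:E).
Proof.
move=> ig mf fM.
have mg : measurable_fun setT g by apply/measurable_EFinP; exact: (measurable_int mu).
have M0 : 0 <= M by exact: le_trans (fM 0).
have igM : mu.-integrable setT (fun y => (M%:E * (EFin \o g) y)%E).
  exact: integrableZl.
apply: (le_integrable measurableT _ _ igM).
  by apply/measurable_EFinP/measurable_funM.
move=> y _; rewrite /= lee_fin !normrM mulrC ler_wpM2r//.
by rewrite (le_trans (fM y))// ler_norm.
Qed.

(** The derivative falls on the bounded factor [f], so that [g] may be merely integrable. *)
Lemma is_partial_convolution k g f f' M M' x : mu.-integrable setT (EFin \o g) ->
  measurable_fun setT f -> (forall x, `|f x| <= M) ->
  (forall x, `|f' x| <= M') ->
  (forall x, is_derive x (delta_mx ord0 k) f (f' x)) ->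
  is_derive x (delta_mx ord0 k) (fun x => \int[mu]_y (g y * f (x - y)))
    (\int[mu]_y (g y * f' (x - y))).
Proof.
move=> ig mf fM fM' df.
have mg : measurable_fun setT g by apply/measurable_EFinP; exact: (measurable_int mu).
have M0 : 0 <= M' by exact: le_trans (fM' 0).
apply: (@is_derive_Rintegral R d _ _ mu setT (fun y z => g y * f (z - y))
  (fun y z => g y * f' (z - y)) (fun y => M' * `|g y|)) => //.
- move=> h _; apply: (@integrable_mul_bounded _ (fun y => f (h *: delta_mx ord0 k + x - y)) M) => //.
  exact: measurable_comp_sub.
- move=> y z _; have /is_derive_lineP h := df (z - y); apply/is_derive_lineP.
  have h2 := is_deriveZ (g y) h.
  rewrite (_ : (fun h : R => _) = g y \*: (fun h : R => f (h *: delta_mx ord0 k + (z - y)))).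
    exact: (is_derive_eq h2).
  by apply/funext => r; rewrite /= addrA.
- by move=> h y _ _; rewrite normrM mulrC ler_wpM2r.
- by move=> y; rewrite mulr_ge0.
- have h := integrableZl measurableT M' (integrable_norm ig).
  exact: h.
Qed.

(** Differentiates in [x] the identity stating that [F] is the convolution of [G_t] with [f]. Three
    applications lift the semigroup law from the kernel of [(-Delta)^-1 exp(t Delta)] to its third
    derivatives. *)
Lemma heat_convolution_partial k t f f' F F' M M' : 0 < t ->
  measurable_fun setT f -> (forall x, `|f x| <= M) -> (forall x, `|f' x| <= M') ->
  (forall x, is_derive x (delta_mx ord0 k) f (f' x)) ->
  (forall x, is_derive x (delta_mx ord0 k) F (F' x)) ->
  (forall x, \int[mu]_y (heat_kernel t y * f (x - y)) = F x) ->
  forall x, \int[mu]_y (heat_kernel t y * f' (x - y)) = F' x.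
Proof.
move=> t0 mf fM fM' df dF fF x.
have h := is_partial_convolution x (integrable_heat_kernel t0) mf fM fM' df.
have e : (fun x => \int[mu]_y (heat_kernel t y * f (x - y))) = F.
  by apply/funext => z; exact: fF.
rewrite e in h; have [_ <-] := h; by have [_ <-] := dF x.
Qed.

End heat_convolution.

Section inverse_laplace_kernel.
Variables (R : realType) (d : nat).
Hypothesis d3 : (3 <= d)%N.
Local Notation V := 'rV[R]_d.
Local Notation T := (measurableTypeR R).
Local Notation mu := (lebesgue_rV R d).
Implicit Types (t s : R) (x : V).

Lemma ge0_integral_tail_shift (f : T -> \bar R) t s : measurable_fun setT f ->
  (forall r, 0 <= f r)%E ->
  (\int[lebesgue_measure]_(r in `]t, +oo[) f (s + r)%R =
   \int[lebesgue_measure]_(r in `](s + t)%R, +oo[) f r)%E.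
Proof.
move=> mf f0.
rewrite [LHS]integral_mkcond [RHS]integral_mkcond.
have mfi : measurable_fun setT (f \_ `](s + t)%R, +oo[).
  by apply/measurable_restrict => //; exact: measurable_funTS.
rewrite -(ge0_integral_signed_shift1 false s mfi); last first.
  by move=> r; rewrite patchE; case: ifP.
apply: eq_integral => r _; rewrite !patchE expr0 mul1r.
congr (if _ then _ else _); apply/idP/idP; rewrite !inE/= !in_itv/= !andbT ltrD2l//.
Qed.

(** By Tonelli and the semigroup law, convolution with [G_s] turns each [G_r] into [G_(s + r)],
    which moves the range of integration from [r > t] to [r > s + t]. *)
Lemma heat_convolution_inv_laplace t s x : 0 < t -> 0 < s ->
  \int[mu]_y (heat_kernel s y * inv_laplace_heat_kernel t (x - y)) =
  inv_laplace_heat_kernel (s + t) x.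
Proof.
move=> t0 s0; have st0 : 0 < s + t by rewrite addr_gt0.
rewrite /inv_laplace_heat_kernel /Rintegral; congr fine.
have mG := @measurable_heat_kernel2 R d.
have mGx (r : R) (z : V) : measurable_fun setT (fun y : V => heat_kernel r (z - y)).
  by apply: measurable_comp_sub; exact: measurable_heat_kernel.
transitivity (\int[mu]_y \int[lebesgue_measure]_r
    (heat_kernel s y * heat_kernel r (x - y) * (t < r)%R%:R)%:E)%E.
  apply: eq_integral => y _.
  have i := tail_integrable d3 (x - y) (tail_dominated_heat_kernel R d) t0.
  rewrite EFinM fineK; last exact: integrable_fin_num.
  rewrite -integralZl// integral_mkcond; apply: eq_integral => r _.
  rewrite patchE; case: ifPn => [/[!inE]/=|/negP /[!inE]/=]; rewrite in_itv/= andbT.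
    by move=> ->; rewrite mulr1 EFinM.
  by move/negP/negbTE => ->; rewrite mulr0.
pose H (z : V * T) := (heat_kernel s z.1 * heat_kernel z.2 (x - z.1) * (t < z.2)%R%:R)%:E.
have mH : measurable_fun setT H.
  apply/measurable_EFinP; apply: measurable_funM; first apply: measurable_funM.
  - have m := @measurable_heat_kernel R d s.
    by apply: (measurableT_comp m); exact: measurable_fst.
  - have m : measurable_fun setT (fun z : V * T => (z.2, x - z.1)).
      apply: measurable_fun_pair => //.
      exact: (measurableT_comp (measurable_sub_const x) measurable_fst).
    exact: (measurableT_comp mG m).
  pose D := [set r : T | t < r].
  have mD : measurable D.
    rewrite (_ : D = `]t, +oo[%classic)//.
    by apply/seteqP; split => r; rewrite /D/= in_itv/= andbT.
  rewrite (_ : (fun z => _) = (\1_D : T -> R) \o snd).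
    exact: measurableT_comp.
  by apply/funext => z; rewrite /= indicE /D; congr (nat_of_bool _)%:R; apply/idP/idP; rewrite inE.
have H0 z : (0 <= H z)%E.
  rewrite /H lee_fin; apply: mulr_ge0; last exact: ler0n.
  by apply: mulr_ge0; exact: heat_kernel_ge0.
rewrite -[LHS]/(\int[mu]_y \int[lebesgue_measure]_r H (y, r))%E fubini_tonelli//.
rewrite -(@ge0_integral_tail_shift (fun r => (heat_kernel r x)%:E)); first last.
- by move=> r; rewrite lee_fin heat_kernel_ge0.
- by apply/measurable_EFinP; exact: (measurableT_comp mG (measurable_pair2 x)).
rewrite [RHS]integral_mkcond; apply: eq_integral => r _.
rewrite patchE; case: ifPn => [/[!inE]/=|/negP /[!inE]/=]; rewrite in_itv/= andbT /H/=.
  move=> tr; rewrite tr; under eq_integral do rewrite mulr1.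
  rewrite -[RHS](heat_kernel_conv x s0 (lt_trans t0 tr)).
  rewrite -[LHS](ge0_integral_reflect x).
  - by apply: eq_integral => y _; rewrite subKr.
  - by apply/measurable_EFinP/measurable_funM => //; exact: measurable_heat_kernel.
  - by move=> y; rewrite lee_fin mulr_ge0 ?heat_kernel_ge0.
move/negP/negbTE => ->; under eq_integral do rewrite mulr0.
exact: integral0.
Qed.

(** The derivative [d_k] of the [(i, j)] entry of the kernel of [exp(t Delta) P], with the
    derivatives of [(-Delta)^-1] taken under the time integral. *)
Definition leray_d1 k i j t x : R :=
  (i == j)%:R * heat_d1 k t x + tail_integral (heat_d3 k i j) t x.

Let tG := tail_dominated_heat_kernel R d.
Let t1 := @tail_dominated_heat_d1 R d.
Let t2 := @tail_dominated_heat_d2 R d.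
Let t3 := @tail_dominated_heat_d3 R d.

Lemma is_partial_inv_laplace j t x : 0 < t ->
  is_derive x (delta_mx ord0 j) (inv_laplace_heat_kernel t)
    (tail_integral (heat_d1 j) t x).
Proof.
move=> t0.
apply: (is_partial_tail_integral d3 (k := j) x tG (t1 j) _ t0).
by move=> s y; exact: is_partial_heat_kernel.
Qed.

Lemma is_partial_tail_heat_d1 i j t x : 0 < t ->
  is_derive x (delta_mx ord0 i) (tail_integral (heat_d1 j) t)
    (tail_integral (heat_d2 i j) t x).
Proof.
move=> t0; apply: (is_partial_tail_integral d3 (k := i) x (t1 j) (t2 i j) _ t0).
by move=> s y; exact: is_partial_heat_d1.
Qed.

Lemma is_partial_tail_heat_d2 k i j t x : 0 < t ->
  is_derive x (delta_mx ord0 k) (tail_integral (heat_d2 i j) t)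
    (tail_integral (heat_d3 k i j) t x).
Proof.
move=> t0; apply: (is_partial_tail_integral d3 (k := k) x (t2 i j) (t3 k i j) _ t0).
by move=> s y; exact: is_partial_heat_d2.
Qed.

Lemma leray_heat_kernelE t i j : 0 < t -> leray_heat_kernel t i j =
  (fun x => (i == j)%:R * heat_kernel t x + tail_integral (heat_d2 i j) t x).
Proof.
move=> t0; apply/funext => x; rewrite /leray_heat_kernel; congr (_ + _).
rewrite /partial (_ : (fun x => 'D__ (inv_laplace_heat_kernel t) x) = tail_integral (heat_d1 j) t).
  by have [_ ->] := is_partial_tail_heat_d1 i j x t0.
by apply/funext => y; have [_ ->] := is_partial_inv_laplace j y t0.
Qed.

Lemma is_partial_leray k i j t x : 0 < t ->
  is_derive x (delta_mx ord0 k) (leray_heat_kernel t i j) (leray_d1 k i j t x).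
Proof.
move=> t0; rewrite leray_heat_kernelE//.
have h := is_deriveD (is_deriveZ ((i == j)%:R : R) (is_partial_heat_kernel k x t0))
  (is_partial_tail_heat_d2 k i j x t0).
exact: (is_derive_eq h).
Qed.

Lemma partial_leray k i j t x : 0 < t ->
  partial k (leray_heat_kernel t i j) x = leray_d1 k i j t x.
Proof. by move=> t0; rewrite /partial; have [_ ->] := is_partial_leray k i j x t0. Qed.

Lemma measurable_leray_d1 k i j :
  measurable_fun setT (fun z : T * V => leray_d1 k i j z.1 z.2).
Proof.
apply: measurable_funD; last exact: measurable_tail_integral.
by apply: measurable_funM => //; exact: measurable_heat_d1.
Qed.

Lemma measurable_leray_d1_at k i j t : measurable_fun setT (leray_d1 k i j t).
Proof. exact: (measurableT_comp (measurable_leray_d1 k i j) (measurable_pair1 t)). Qed.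

Lemma measurable_tail_integral_at f t : tail_dominated f ->
  measurable_fun setT (tail_integral (d := d) f t).
Proof.
by move=> hf; exact: (measurableT_comp (measurable_tail_integral hf) (measurable_pair1 t)).
Qed.

(** Bounds for the supremum and, next, for the mass of the kernel. The 3 counts one heat term and
    two from the tail, as [s^(-3/2)] integrates to [2 t^(-1/2)] beyond [t]. *)
Definition leray_sup t : R :=
  3 * gauss_const R d * sup_const R d * (t `^ (- 2^-1) * t `^ (- (d%:R / 2))).

Definition leray_mass t : R := 3 * gauss_const R d * t `^ (- 2^-1).

Lemma leray_sup_gt0 t : 0 < t -> 0 < leray_sup t.
Proof.
move=> t0; apply: mulr_gt0; last by apply: mulr_gt0; exact: powR_gt0.
apply: mulr_gt0; last exact: sup_const_gt0.
by apply: mulr_gt0 => //; exact: gauss_const_gt0.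
Qed.

Lemma leray_mass_gt0 t : 0 < t -> 0 < leray_mass t.
Proof.
move=> t0; apply: mulr_gt0; last exact: powR_gt0.
by apply: mulr_gt0 => //; exact: gauss_const_gt0.
Qed.

Lemma heat_d1_term_le k (b : bool) t x : 0 < t ->
  `|b%:R * heat_d1 k t x| <= gauss_const R d * t `^ (- 2^-1) * heat_kernel (2 * t) x.
Proof.
move=> t0; have h := heat_d1_le k x t0.
case: b; first by rewrite mul1r.
by rewrite mul0r normr0 (le_trans _ h).
Qed.

Lemma leray_d1_le k i j t x : 0 < t -> `|leray_d1 k i j t x| <= leray_sup t.
Proof.
move=> t0; have g0 := ltW (gauss_const_gt0 R d); have s0 := ltW (sup_const_gt0 R d).
have h1 : `|(i == j)%:R * heat_d1 k t x| <=
    gauss_const R d * sup_const R d * (t `^ (- 2^-1) * t `^ (- (d%:R / 2))).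
  apply: (le_trans (heat_d1_term_le k _ x t0)).
  have := heat_kernel_le2 x t0.
  have : 0 <= gauss_const R d * t `^ (- 2^-1) by rewrite mulr_ge0 ?powR_ge0.
  by move=> h /(ler_wpM2l h)/le_trans; apply; rewrite le_eqVlt; apply/orP; left; apply/eqP; ring.
have h2 : `|tail_integral (heat_d3 k i j) t x| <=
    2 * (gauss_const R d * sup_const R d * (t `^ (- 2^-1) * t `^ (- (d%:R / 2)))).
  pose C := gauss_const R d * sup_const R d * t `^ (- (d%:R / 2)).
  have -> : 2 * (gauss_const R d * sup_const R d * (t `^ (- 2^-1) * t `^ (- (d%:R / 2)))) =
     C * (2 * t `^ (- 2^-1)) by rewrite /C; ring.
  rewrite (le_trans (le_normr_Rintegral _ (tail_integrable d3 x (t3 k i j) t0)))//.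
  rewrite -Rintegral_powR_tailZ//; apply: le_Rintegral => //.
  - by apply: integrable_norm; exact: tail_integrable.
  - exact: integrable_powR_tailZ.
  move=> s /=; rewrite in_itv/= andbT => ts; have s0' : 0 < s by rewrite (lt_trans t0).
  have [_ [a a0 _]] := t3 k i j.
  apply: (le_trans (heat_d3_le k i j x s0')); rewrite powR_3half//.
  have h : 0 <= gauss_const R d * s `^ (- (3 / 2)) by rewrite mulr_ge0 ?powR_ge0.
  apply: (@le_trans _ _ (gauss_const R d * s `^ (- (3 / 2)) * (sup_const R d * t `^ (- (d%:R / 2))))).
    apply: (ler_wpM2l h); apply: (le_trans (heat_kernel_le2 x s0')).
    rewrite ler_wpM2l// !powRN lef_pV2 ?posrE ?powR_gt0//.
    by apply: ge0_ler_powR; rewrite ?nnegrE ?divr_ge0 ?(ltW t0) ?(ltW s0') ?(ltW ts).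
  by rewrite /C le_eqVlt; apply/orP; left; apply/eqP; ring.
apply: (le_trans (ler_normD _ _)); apply: (le_trans (lerD h1 h2)).
by rewrite le_eqVlt /leray_sup; apply/orP; left; apply/eqP; ring.
Qed.

(** When [x] is integrated first, every Gaussian [G_(2s)] has mass 1, and only the integral of
    [s^(-3/2)] remains. *)
Lemma integral_leray_d1_le k i j t : 0 < t ->
  (\int[mu]_x (`|leray_d1 k i j t x|)%:E <= (leray_mass t)%:E)%E.
Proof.
move=> t0; have g0 := ltW (gauss_const_gt0 R d).
pose c1 := gauss_const R d * t `^ (- 2^-1).
have c10 : 0 <= c1 by rewrite mulr_ge0 ?powR_ge0.
pose B := `]t, +oo[%classic : set T.
pose H (z : V * T) := ((gauss_const R d * z.2 `^ (- (3 / 2)) * heat_kernel (2 * z.2) z.1) * (\1_B z.2))%:E.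
have mH : measurable_fun setT H.
  apply/measurable_EFinP; apply: measurable_funM; first apply: measurable_funM.
  - apply: measurable_funM => //; apply: measurable_fun_powR; exact: measurable_snd.
  - have m : measurable_fun setT (fun z : V * T => (2 * z.2, z.1) : T * V).
      apply: measurable_fun_pair => //=.
      by apply: measurable_funM => //; exact: measurable_snd.
    exact: (measurableT_comp (@measurable_heat_kernel2 R d) m).
  apply: (measurableT_comp _ (@measurable_snd _ _ V T)).
  by apply: measurable_indic; exact: measurable_itv.
have H0 z : (0 <= H z)%E.
  rewrite /H lee_fin; apply: mulr_ge0; last by rewrite indicE.
  by rewrite !mulr_ge0 ?powR_ge0 ?heat_kernel_ge0.
have mG r : measurable_fun setT (@heat_kernel R d r) by exact: measurable_heat_kernel.
have I1 : (\int[mu]_x (c1 * heat_kernel (2 * t) x)%:E = c1%:E)%E.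
  under eq_integral do rewrite EFinM.
  rewrite ge0_integralZl_EFin ?integral_heat_kernel ?mule1 ?mulr_gt0//.
  - by move=> x _; rewrite lee_fin heat_kernel_ge0.
  - exact/measurable_EFinP.
have I2 : (\int[mu]_x \int[lebesgue_measure]_s H (x, s) = (2 * c1)%:E)%E.
  rewrite (fubini_tonelli H)//.
  have -> : (2 * c1)%:E = (\int[lebesgue_measure]_(s in B) (gauss_const R d * s `^ (- (3 / 2)))%:E)%E.
    by rewrite integral_powR_tailZ// /c1; congr EFin; ring.
  rewrite [RHS]integral_mkcond; apply: eq_integral => s _.
  rewrite /H/= patchE indicE; case: ifPn => sB.
    under eq_integral do rewrite mulr1 EFinM.
    have s0 : 0 < s by move: sB; rewrite inE /B/= in_itv/= andbT; exact: lt_trans.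
    rewrite ge0_integralZl_EFin ?integral_heat_kernel ?mule1 ?mulr_gt0//.
    - by move=> x _; rewrite lee_fin heat_kernel_ge0.
    - exact/measurable_EFinP.
    - by rewrite mulr_ge0 ?powR_ge0.
  by under eq_integral do rewrite mulr0; rewrite integral0.
have mIH : measurable_fun setT (fun x => \int[lebesgue_measure]_s H (x, s))%E.
  exact: (measurable_fun_fubini_tonelli_F H).
apply: (@le_trans _ _ (\int[mu]_x ((c1 * heat_kernel (2 * t) x)%:E +
    \int[lebesgue_measure]_s H (x, s)))%E); last first.
  rewrite ge0_integralD//.
  - rewrite I1 I2 -EFinD lee_fin /leray_mass /c1 le_eqVlt; apply/orP; left; apply/eqP; ring.
  - by move=> x _; rewrite lee_fin mulr_ge0 ?heat_kernel_ge0.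
  - by apply/measurable_EFinP; exact: measurable_funM.
  - by move=> x _; exact: integral_ge0.
apply: ge0_le_integral => //.
- by apply/measurable_EFinP; apply: measurableT_comp => //; exact: measurable_leray_d1_at.
- by apply: emeasurable_funD => //; apply/measurable_EFinP; exact: measurable_funM.
move=> x _; apply: (@le_trans _ _ (`|(i == j)%:R * heat_d1 k t x|%:E +
  `|tail_integral (heat_d3 k i j) t x|%:E)%E).
  by rewrite -EFinD lee_fin; exact: ler_normD.
apply: leeD; first by rewrite lee_fin; exact: heat_d1_term_le.
have iB := tail_integrable d3 x (t3 k i j) t0.
rewrite /tail_integral EFin_normr_Rintegral//.
apply: (le_trans (le_abse_integral _ _ (measurable_int _ iB))) => //.
rewrite integral_mkcond; apply: ge0_le_integral => //.
- by move=> s _; rewrite patchE; case: ifP.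
- apply/(measurable_restrictT _ _).1 => //.
  by apply: measurableT_comp => //; exact: (measurable_int _ iB).
- exact: (measurableT_comp mH (measurable_pair1 x)).
move=> s _; rewrite patchE /H/= indicE; case: ifPn => sB; last by rewrite mulr0.
have s0 : 0 < s by move: sB; rewrite inE /B/= in_itv/= andbT; exact: lt_trans.
by rewrite mulr1 lee_fin -powR_3half//; exact: heat_d3_le.
Qed.

Lemma heat_convolution_leray k i j t s x : 0 < t -> 0 < s ->
  \int[mu]_y (heat_kernel s y * leray_d1 k i j t (x - y)) = leray_d1 k i j (s + t) x.
Proof.
move=> t0 s0; have st0 : 0 < s + t by rewrite addr_gt0.
have [M0 hM0] := tail_integral_bounded d3 tG t0.
have [M1 hM1] := tail_integral_bounded d3 (t1 j) t0.
have [M2 hM2] := tail_integral_bounded d3 (t2 i j) t0.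
have [M3 hM3] := tail_integral_bounded d3 (t3 k i j) t0.
(* The law for [inv_laplace_heat_kernel] differentiated once, twice and three times, each form being
   obtained from the one before. *)
have c1 := heat_convolution_partial s0 (measurable_tail_integral_at t tG) hM0 hM1
  (fun y => is_partial_inv_laplace j y t0) (fun y => is_partial_inv_laplace j y st0)
  (fun y => heat_convolution_inv_laplace y t0 s0).
have c2 := heat_convolution_partial s0 (measurable_tail_integral_at t (t1 j)) hM1 hM2
  (fun y => is_partial_tail_heat_d1 i j y t0) (fun y => is_partial_tail_heat_d1 i j y st0) c1.
have c3 := heat_convolution_partial s0 (measurable_tail_integral_at t (t2 i j)) hM2 hM3
  (fun y => is_partial_tail_heat_d2 k i j y t0) (fun y => is_partial_tail_heat_d2 k i j y st0) c2.
have hG (y : V) : `|heat_kernel t y| <= sup_const R d * t `^ (- (d%:R / 2)).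
  by rewrite ger0_norm ?heat_kernel_ge0//; exact: heat_kernel_sup.
have hd1 (y : V) : `|heat_d1 k t y| <=
    gauss_const R d * t `^ (- 2^-1) * (sup_const R d * t `^ (- (d%:R / 2))).
  apply: (le_trans (heat_d1_le k y t0)); apply: ler_wpM2l (heat_kernel_le2 y t0).
  by apply: mulr_ge0; [exact: ltW (gauss_const_gt0 R d)|exact: powR_ge0].
have cG (y : V) : \int[mu]_z (heat_kernel s z * heat_kernel t (y - z)) = heat_kernel (s + t) y.
  rewrite /Rintegral addrC.
  under eq_integral do rewrite mulrC.
  by rewrite heat_kernel_conv.
have c0 := heat_convolution_partial s0 (@measurable_heat_kernel R d t) hG hd1
  (fun y => is_partial_heat_kernel k y t0) (fun y => is_partial_heat_kernel k y st0) cG.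
have md1 : measurable_fun setT (@heat_d1 R d k t).
  exact: (measurableT_comp (measurable_heat_d1 k) (measurable_pair1 t)).
have i1 := integrable_mul_bounded (integrable_heat_kernel d s0)
  (measurable_comp_sub x md1) (fun y => hd1 _).
have i3 := integrable_mul_bounded (integrable_heat_kernel d s0)
  (measurable_comp_sub x (measurable_tail_integral_at t (t3 k i j))) (fun y => hM3 _).
rewrite /leray_d1 -c0 -c3.
under eq_Rintegral do rewrite mulrDr mulrCA.
rewrite RintegralD//.
- by rewrite RintegralZl.
- have h := integrableZl measurableT ((i == j)%:R) i1.
  exact: h.
Qed.

Lemma sum_heat_d3 j s x : \sum_i heat_d3 i i j s x =
  ((2 + d%:R) * x ord0 j / (2 * s) ^+ 2 - x ord0 j * enorm x ^+ 2 / (2 * s) ^+ 3) *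
  heat_kernel s x.
Proof.
rewrite -mulr_suml; congr (_ * _); rewrite big_split/= sumrN -!mulr_suml.
congr (_ / _ - _ / _).
  rewrite !big_split/=.
  under eq_bigr do rewrite eqxx mul1r.
  rewrite sumr_const card_ord.
  rewrite (bigD1 j)//= eqxx mul1r big1 ?addr0; last first.
    by move=> i /negbTE ij; rewrite eq_sym ij mul0r.
  rewrite (bigD1 j)//= eqxx mul1r big1 ?addr0; last first.
    by move=> i /negbTE ij; rewrite ij mul0r.
  by rewrite -mulr_natl; ring.
rewrite enorm_sqr mulr_sumr; apply: eq_bigr => i _; ring.
Qed.

(** The heat equation for [d_j G], the right-hand side being its Laplacian. Integrated over [s > t],
    it evaluates the divergence of the tail term as [- d_j G_t]. *)
Lemma is_derive_time_heat_d1 j s x : 0 < s ->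
  is_derive s (1 : R) (fun s => heat_d1 j s x) (\sum_i heat_d3 i i j s x).
Proof.
move=> s0; have p0 := pi_gt0 R; have sn0 : s != 0 by rewrite gt_eqF.
pose a := - (d%:R / 2) : R.
pose F (r : R) := r^-1 * (r `^ a * expR (- (enorm x ^+ 2 / 4) * r^-1)).
pose c := - (x ord0 j / 2) * (4 * pi) `^ a.
have hV := is_deriveV sn0 (is_derive_id s (1 : R)).
have hE := @is_derive1_comp _ expR (fun r => - (enorm x ^+ 2 / 4) * r^-1) s _ _
   (is_derive_expR _) (is_deriveZ (- (enorm x ^+ 2 / 4)) hV).
have hP := is_derive1_powR a s0.
have h := is_deriveZ c (is_deriveM hV (is_deriveM hP hE)).
have hc : forall r, 0 < r -> heat_d1 j r x = c * F r.
  move=> r r0; rewrite /heat_d1 /heat_kernel /c /F -/a powRM ?mulr_ge0 ?(ltW p0) ?(ltW r0)//.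
  rewrite (_ : - (enorm x ^+ 2 / (4 * r)) = - (enorm x ^+ 2 / 4) * r^-1).
    by field; rewrite gt_eqF.
  by field; rewrite gt_eqF.
have hcF : is_derive s (1 : R) (fun r => c * F r) (\sum_i heat_d3 i i j s x).
  apply: (is_derive_eq h).
  rewrite sum_heat_d3.
  rewrite /heat_kernel -/a powRM ?mulr_ge0 ?(ltW p0) ?(ltW s0)//.
  rewrite (_ : - (enorm x ^+ 2 / (4 * s)) = - (enorm x ^+ 2 / 4) * s^-1); last by field.
  have -> : s `^ (a - 1) = s `^ a / s.
    rewrite powRD ?powR_inv1 ?(ltW s0)//.
    by rewrite sn0 implybT.
  set E := expR (- (enorm x ^+ 2 / 4) * s^-1); set P := s `^ a.
  transitivity (c * (s^-1 * (P * (E * (- (enorm x ^+ 2 / 4) * (- s ^- 2 * 1))) +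
      E * (a * (P / s))) + (P * E) * (- s ^- 2 * 1))); first by [].
  rewrite /c; set Q := (4 * pi) `^ a.
  rewrite /a; field.
  by rewrite sn0.
apply: (@near_eq_is_derive _ _ _ (fun r => c * F r)) => //.
near=> r; rewrite -hc//.
near: r; exact: lt_nbhsr.
Unshelve. all: end_near. Qed.

(* Adding a multiple of [s `^ (- 3 / 2)] makes the integrand nonnegative, as the
   fundamental theorem of calculus on a half-line requires. *)
Lemma tail_integral_div j t x : 0 < t ->
  \sum_i tail_integral (heat_d3 i i j) t x = - heat_d1 j t x.
Proof.
move=> t0; have h0 : 0 < t / 2 by rewrite divr_gt0.
pose D s := \sum_i heat_d3 i i j s x.
have ex_C : exists2 C, 0 <= C & forall s, t / 2 < s -> `|D s| <= C * s `^ (- (3 / 2)).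
  have /choice[C hC] : forall i, exists C, 0 <= C /\
      forall s, t / 2 < s -> `|heat_d3 i i j s x| <= C * s `^ (- (3 / 2)).
    move=> i; have [C C0 hC] := tail_dominatedP d3 (t3 i i j) h0.
    by exists C; split; [exact: ltW|move=> s; exact: hC].
  exists (\sum_i C i); first by rewrite sumr_ge0// => i _; have [] := hC i.
  move=> s hs; rewrite (le_trans (ler_norm_sum _ _ _))// mulr_suml.
  by apply: ler_sum => i _; have [_] := hC i; apply.
have [C C0 DC] := ex_C.
have [C1 C10 d1C] := tail_dominatedP d3 (t1 j) h0.
have tI i := tail_integrable d3 x (t3 i i j) t0.
have -> : \sum_i tail_integral (heat_d3 i i j) t x =
    \int[lebesgue_measure]_(s in `]t, +oo[) D s.
  by rewrite Rintegral_sum.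
have iw := integrable_powR_tailZ C t0.
have iD : lebesgue_measure.-integrable `]t, +oo[ (EFin \o D).
  rewrite (_ : _ \o _ = (fun s => \sum_i (heat_d3 i i j s x)%:E)%E); last first.
    by apply/funext => s /=; rewrite sumEFin.
  by apply: integrable_sum.
pose f s := D s + C * s `^ (- (3 / 2)).
pose F s := heat_d1 j s x + C * (- 2 * s `^ (- 2^-1)).
have dF s : 0 < s -> is_derive s (1 : R) F (f s).
  move=> s0.
  have h := is_deriveD (is_derive_time_heat_d1 j x s0)
    (is_deriveZ C (is_deriveZ (- 2 : R) (is_derive1_powR (- 2^-1) s0))).
  apply: (is_derive_eq h); rewrite /f /D; congr (_ + _); rewrite /GRing.scale/=; congr (_ * _).
  by rewrite mulrA mulrNN mulfV// mul1r; congr (_ `^ _); field.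
have hf s : t <= s -> 0 <= f s.
  move=> ts; have : t / 2 < s by apply: lt_le_trans ts; rewrite ltr_pdivrMr// ltr_pMr// ltr1n.
  by move=> /DC; rewrite ler_norml => /andP[h _]; rewrite /f -lerBlDr sub0r.
have If : (\int[lebesgue_measure]_(s in `]t, +oo[) (f s)%:E = (- F t)%:E)%E.
  rewrite integral_itv_obnd_cbnd; last first.
    apply/measurable_EFinP; apply: measurable_funD.
      by apply/measurable_EFinP; exact: (measurable_int _ iD).
    by apply/measurable_EFinP; exact: (measurable_int _ iw).
  rewrite (@ge0_continuous_FTC2y _ f F t 0)//.
  - by rewrite sub0e.
  - apply: continuous_in_subspaceT => s /[!inE]/= /[!in_itv]/= /[!andbT] ts.
    have s0 : 0 < s by rewrite (lt_le_trans t0).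
    apply: cvgD; last first.
      apply: cvgM; first exact: cvg_cst.
      have [+ _] := is_derive1_powR (- (3 / 2)) s0.
      by move=> /derivable1_diffP/differentiable_continuous.
    (* [D] is a polynomial in [1 / r] times [d_j G], from which its continuity can be read off. *)
    have ED r : D r = (enorm x ^+ 2 / 4 * (r^-1 * r^-1) - (2 + d%:R) / 2 * r^-1) *
        heat_d1 j r x.
      have [->|r0] := eqVneq r 0.
        by rewrite /D sum_heat_d3 /heat_d1 !mulr0 !expr0n/= !invr0 !(mulr0, oppr0, subr0, mul0r).
      by rewrite /D sum_heat_d3 /heat_d1; field.
    have cV : r^-1 @[r --> s] --> s^-1 by apply: cvgV; [rewrite gt_eqF|exact: cvg_id].
    rewrite (_ : D = (fun r => (enorm x ^+ 2 / 4 * (r^-1 * r^-1) - (2 + d%:R) / 2 * r^-1) *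
      heat_d1 j r x)); last by apply/funext => r; exact: ED.
    apply: cvgM.
      apply: cvgB; apply: cvgM; try exact: cvg_cst; last by [].
      exact: cvgM.
    have [+ _] := is_derive_time_heat_d1 j x s0.
    by move=> /derivable1_diffP/differentiable_continuous.
  - rewrite -[X in _ --> X](addr0 0); apply: cvgD.
      apply/norm_cvg0P; apply: (@squeeze_cvgr _ _ _ _ (cst 0) (fun s => C1 * s `^ (- (3 / 2)))).
      + near=> s; rewrite normr_ge0/=; apply: d1C.
        by near: s; apply: nbhs_pinfty_gt; rewrite num_real.
      + exact: cvg_cst.
      rewrite -(mulr0 C1); apply: cvgM; first exact: cvg_cst.
      by apply: powR_cvg_pinfty; rewrite divr_gt0.
    rewrite -(mulr0 C) -(mulr0 (- 2)); apply: cvgM; first exact: cvg_cst.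
    apply: cvgM; first exact: cvg_cst.
    by apply: powR_cvg_pinfty; rewrite invr_gt0.
  - by move=> s ts; have [] := dF s (lt_trans t0 ts).
  - apply: cvg_at_right_filter.
    have [+ _] := dF t t0.
    by move=> /derivable1_diffP/differentiable_continuous.
  - move=> s /[!in_itv]/= /[!andbT] ts.
    by rewrite derive1E; have [_ ->] := dF s (lt_trans t0 ts).
have : \int[lebesgue_measure]_(s in `]t, +oo[) f s = - F t by rewrite /Rintegral If.
rewrite RintegralD// Rintegral_powR_tailZ// => /eqP.
by rewrite -subr_eq0 => /eqP h; apply/eqP; rewrite -subr_eq0 -h /F; apply/eqP; ring.
Unshelve. all: end_near. Qed.

(** The range of [P] is divergence free: the tail term cancels the heat term. *)
Lemma leray_d1_div j t x : 0 < t -> \sum_i leray_d1 i i j t x = 0.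
Proof.
move=> t0; rewrite big_split/= tail_integral_div// (bigD1 j)//= eqxx mul1r big1 ?addr0.
  by rewrite subrr.
by move=> i /negbTE ->; rewrite mul0r.
Qed.

End inverse_laplace_kernel.

(** * Vector fields in Lp *)

Section enorm_theory.
Variables (R : realType) (d : nat).
Implicit Types x y : 'rV[R]_d.

Lemma enormN x : enorm (- x) = enorm x.
Proof. by rewrite /enorm; under eq_bigr do rewrite mxE sqrrN. Qed.

Lemma enorm0 : enorm (0 : 'rV[R]_d) = 0.
Proof. by rewrite /enorm big1 ?sqrtr0// => i _; rewrite mxE expr0n. Qed.

Lemma enorm_eq0 x : enorm x = 0 -> x = 0.
Proof.
move=> x0; apply/rowP => i; rewrite mxE; apply/eqP; rewrite -normr_le0 -x0.
exact: coord_le_enorm.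
Qed.

Lemma enormD x y : enorm (x + y) <= enorm x + enorm y.
Proof.
have := enorm_ge0 x; rewrite le_eqVlt => /predU1P[/esym/enorm_eq0 ->|x0].
  by rewrite add0r lerDr enorm_ge0.
have := enorm_ge0 y; rewrite le_eqVlt => /predU1P[/esym/enorm_eq0 ->|y0].
  by rewrite addr0 lerDl enorm_ge0.
rewrite -ler_sqr ?nnegrE ?addr_ge0 ?enorm_ge0// enorm_sqr.
set a := enorm x in x0 *; set b := enorm y in y0 *.
(* [2 s t <= s^2 b / a + t^2 a / b] in each coordinate *)
apply: (@le_trans _ _ (\sum_i ((1 + b / a) * x ord0 i ^+ 2 + (1 + a / b) * y ord0 i ^+ 2))).
  apply: ler_sum => i _; rewrite mxE -subr_ge0.
  rewrite (_ : _ - _ = (x ord0 i * b - y ord0 i * a) ^+ 2 / (a * b)); last first.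
    by field; rewrite !gt_eqF.
  by rewrite divr_ge0 ?sqr_ge0// mulr_ge0// ltW.
rewrite big_split/= -!mulr_sumr -!enorm_sqr -/a -/b le_eqVlt; apply/orP; left.
by apply/eqP; field; rewrite !gt_eqF.
Qed.

Lemma enorm_le_sum x : enorm x <= \sum_i `|x ord0 i|.
Proof.
rewrite -ler_sqr ?nnegrE ?enorm_ge0 ?sumr_ge0// enorm_sqr expr2 mulr_suml.
apply: ler_sum => i _; rewrite -real_normK ?num_real// expr2 ler_wpM2l//.
by rewrite (bigD1 i)//= lerDl sumr_ge0.
Qed.

Lemma enormB_sqr_coord x y i j :
  `|x ord0 i * x ord0 j - y ord0 i * y ord0 j| <=
  enorm (x - y) * (enorm (x - y) + 2 * enorm y).
Proof.
rewrite (_ : _ - _ = (x - y) ord0 i * (x - y) ord0 j + (x - y) ord0 i * y ord0 j +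
  y ord0 i * (x - y) ord0 j); last by rewrite !mxE; ring.
have e0 := enorm_ge0 (x - y); have y0 := enorm_ge0 y.
have h1 := coord_le_enorm (x - y) i; have h2 := coord_le_enorm (x - y) j.
have h3 := coord_le_enorm y i; have h4 := coord_le_enorm y j.
apply: (le_trans (ler_normD _ _)); apply: (le_trans (lerD (ler_normD _ _) (lexx _))).
rewrite !normrM (_ : enorm _ * _ = enorm (x - y) * enorm (x - y) +
  enorm (x - y) * enorm y + enorm y * enorm (x - y)); last by ring.
by rewrite !lerD// ler_pM.
Qed.

End enorm_theory.

Section Lpnorm_theory.
Variables (R : realType) (d : nat) (p : \bar R).
Hypothesis p1 : (1 <= p)%E.
Local Notation V := 'rV[R]_d.
Local Notation mu := (lebesgue_rV R d).
Implicit Types v w : V -> V.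

Let p0 : (0 < p)%E.
Proof. by rewrite (lt_le_trans _ p1). Qed.

Lemma measurable_enorm_comp v : measurable_fun setT v ->
  measurable_fun setT (fun x => enorm (v x)).
Proof. exact: (measurableT_comp (@measurable_enorm R d)). Qed.

Lemma measurable_fun_rV_add v w : measurable_fun setT v -> measurable_fun setT w ->
  measurable_fun setT (fun x => v x + w x).
Proof.
move=> mv mw; apply/measurable_fun_rVP => i; under eq_fun do rewrite mxE.
by apply: measurable_funD; exact: (measurable_fun_rVP _).1.
Qed.

Lemma measurable_fun_rV_opp v : measurable_fun setT v ->
  measurable_fun setT (fun x => - v x).
Proof.
move=> mv; apply/measurable_fun_rVP => i; under eq_fun do rewrite mxE.
by apply: measurableT_comp => //; exact: (measurable_fun_rVP _).1.
Qed.

Lemma Lpnorm_setT v :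
  Lpnorm p setT v = ('N[mu]_p[EFin \o (fun x => enorm (v x))])%E.
Proof. by rewrite /Lpnorm patch_setT. Qed.

Lemma Lpnorm_le (f : V -> \bar R) v : measurable_fun setT v -> measurable_fun setT f ->
  {ae mu, forall x, ((enorm (v x))%:E <= f x)%E} ->
  (Lpnorm p setT v <= 'N[mu]_p[f])%E.
Proof.
move=> mv mf vf; rewrite Lpnorm_setT; apply: le_Lnorm => //.
  by apply/measurable_EFinP; exact: measurable_enorm_comp.
apply: filterS vf => x /= h; rewrite ger0_norm ?enorm_ge0//.
by rewrite gee0_abs// (le_trans _ h)// lee_fin enorm_ge0.
Qed.

Lemma ae_eq_Lpnorm v w : measurable_fun setT v -> measurable_fun setT w ->
  {ae mu, forall x, v x = w x} -> Lpnorm p setT v = Lpnorm p setT w.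
Proof.
move=> mv mw vw; rewrite !Lpnorm_setT; apply: ae_eq_Lnorm => //.
- by apply/measurable_EFinP; exact: measurable_enorm_comp.
- by apply/measurable_EFinP; exact: measurable_enorm_comp.
by apply: filterS vw => x /= ->.
Qed.

Lemma Lpnorm_ge0 v : (0 <= Lpnorm p setT v)%E.
Proof. exact: Lnorm_ge0. Qed.

Lemma LpnormN v : Lpnorm p setT (fun x => - v x) = Lpnorm p setT v.
Proof. by rewrite !Lpnorm_setT; under [in LHS]eq_fun do rewrite enormN. Qed.

Lemma LpnormD v w : measurable_fun setT v -> measurable_fun setT w ->
  (Lpnorm p setT (fun x => v x + w x)%R <= Lpnorm p setT v + Lpnorm p setT w)%E.
Proof.
move=> mv mw; rewrite [X in (_ <= X + _)%E]Lpnorm_setT [X in (_ <= _ + X)%E]Lpnorm_setT.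
apply: le_trans (eminkowski _ _ _ p1).
- apply: Lpnorm_le; first exact: measurable_fun_rV_add.
    by apply/measurable_EFinP; apply: measurable_funD; exact: measurable_enorm_comp.
  by apply: aeW => x; rewrite lee_fin enormD.
- exact: measurable_enorm_comp.
- exact: measurable_enorm_comp.
Qed.

Lemma LpnormB v w : measurable_fun setT v -> measurable_fun setT w ->
  (Lpnorm p setT (fun x => v x - w x)%R <= Lpnorm p setT v + Lpnorm p setT w)%E.
Proof.
move=> mv mw; rewrite -(LpnormN w); apply: LpnormD => //.
exact: measurable_fun_rV_opp.
Qed.

Lemma Lpnorm_eq0 v : measurable_fun setT v -> Lpnorm p setT v = 0%E ->
  {ae mu, forall x, v x = 0}.
Proof.
rewrite Lpnorm_setT => mv /Lnorm_eq0_eq0 h.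
have : ae_eq mu setT (EFin \o (fun x => enorm (v x))) (cst 0%E).
  by apply: h => //; apply/measurable_EFinP; exact: measurable_enorm_comp.
apply: filterS => x /= /(_ Logic.I) [vx]; exact: enorm_eq0.
Qed.

Lemma Lpnorm0 : Lpnorm p setT (fun=> 0 : V) = 0%E.
Proof.
rewrite Lpnorm_setT (_ : _ \o _ = cst 0%E); last first.
  by apply/funext => x /=; rewrite enorm0.
by rewrite Lnorm0// gt_eqF.
Qed.

Lemma normLpK v : in_Lp p v -> (normLp p v)%:E = Lpnorm p setT v.
Proof. by case=> mv foo; rewrite /normLp fineK// ge0_fin_numE// Lpnorm_ge0. Qed.

Lemma normLp_ge0 v : 0 <= normLp p v.
Proof. by rewrite fine_ge0// Lpnorm_ge0. Qed.

End Lpnorm_theory.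

Lemma Lnorm_ae_lty dT (T : measurableType dT) (R : realType)
    (mu : {measure set T -> \bar R}) p (f : T -> \bar R) : (0 < p)%E ->
  measurable_fun setT f -> ('N[mu]_p[f] < +oo)%E ->
  {ae mu, forall x, (`|f x| < +oo)%E}.
Proof.
case: p => [r| |]//.
- rewrite lte_fin => r0 mf foo.
  have : mu.-integrable setT (fun x => `|f x| `^ r)%E.
    apply/integrableP; split.
      by apply: measurable_fun_poweR; exact: measurableT_comp.
    under eq_integral do rewrite gee0_abs ?poweR_ge0//.
    by rewrite -(poweR_Lnorm _ _ (lt0r_neq0 r0)) poweR_lty.
  move/integrable_ae => /(_ measurableT); apply: filterS => x /(_ Logic.I).
  by case: (`|f x|%E) => [y| |] //; rewrite ?ltry// poweRyr ?gt_eqF.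
- move=> _ mf foo; apply: filterS (ae_le_Lnormy mu f) => x h.
  exact: le_lt_trans foo.
Qed.

(** As [q] takes countably many values, no joint measurability in the index is needed. This serves
    for functions of a point rounded to a grid. *)
Lemma measurable_countable_pieces d1 d2 (X : measurableType d1) (Z : measurableType d2)
    (I : countType) (q : X -> I) (f : I -> X -> Z) :
  (forall i, measurable (q @^-1` [set i])) -> (forall i, measurable_fun setT (f i)) ->
  measurable_fun setT (fun x => f (q x) x).
Proof.
move=> mq mf _ B mB; rewrite setTI.
rewrite (_ : _ @^-1` _ = \bigcup_(i in @setT I) (q @^-1` [set i] `&` f i @^-1` B)).
  apply: countable_bigcupT_measurable; first exact: countableP.
  move=> i; apply: measurableI => //.
  by rewrite -[X in measurable X]setTI; exact: mf.
apply/seteqP; split => x /=; first by move=> Bx; exists (q x).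
by move=> [i _ [/= -> ]].
Qed.

(** * Measurability by rounding to a grid *)

Section grid.
Variable R : realType.

Definition grid (n : nat) (s : R) : R := (Num.floor (s * n.+1%:R))%:~R / n.+1%:R.

Lemma grid_dist n s : `|s - grid n s| <= n.+1%:R^-1.
Proof.
have n0 : (0 : R) < n.+1%:R by [].
have /andP[h1 h2] := floor_itv (s * n.+1%:R).
rewrite /grid ger0_norm.
  rewrite -(ler_pM2r n0) mulVf ?gt_eqF// mulrBl divfK ?gt_eqF//.
  by rewrite lerBlDr addrC; move: h2; rewrite intrD => /ltW.
by rewrite subr_ge0 ler_pdivrMr.
Qed.

Lemma grid_cvg s : grid n s @[n --> \oo] --> s.
Proof.
apply/cvgrPdist_le => e e0; near=> n.
apply: le_trans (grid_dist _ _) _; near: n.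
have /cvgrPdist_le/(_ e e0) := @cvg_harmonic R.
apply: filterS => n; rewrite sub0r normrN /harmonic/= ger0_norm// invr_ge0.
Unshelve. all: end_near. Qed.

Lemma measurable_floor_fibre n (i : int) :
  measurable [set s : measurableTypeR R | Num.floor (s * n.+1%:R) = i].
Proof.
have n0 : (0 : R) < n.+1%:R by [].
rewrite (_ : mkset _ = `[(i%:~R / n.+1%:R : R), ((i + 1)%:~R / n.+1%:R)[%classic).
  exact: measurable_itv.
apply/seteqP; split => s /=.
  move=> <-; rewrite in_itv/= ler_pdivrMr// ltr_pdivlMr//.
  exact: floor_itv.
by rewrite in_itv/= ler_pdivrMr// ltr_pdivlMr// => h; exact: floor_def.
Qed.

(** The sigma-algebra on row vectors is generated by the coordinates, not by the open sets. A
    continuous [f] is the pointwise limit of its values at rounded points, and these functions are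
    constant on countably many boxes. *)
Lemma measurable_continuous_rV d (f : 'rV[R]_d -> R) :
  (forall x, {for x, continuous f}) -> measurable_fun setT f.
Proof.
move=> cf.
pose F (n : nat) (x : 'rV[R]_d) := f (\row_i grid n (x ord0 i)).
apply: (@measurable_fun_cvg _ _ _ setT F) => [n|x _].
  pose q (x : 'rV[R]_d) : 'rV[int]_d := \row_i Num.floor (x ord0 i * n.+1%:R).
  pose g (z : 'rV[int]_d) (_ : 'rV[R]_d) := f (\row_i ((z ord0 i)%:~R / n.+1%:R)).
  rewrite (_ : F n = fun x => g (q x) x).
    apply: measurable_countable_pieces => z; last exact: measurable_cst.
    rewrite (_ : q @^-1` [set z] = [set x | forall i,
        [set s | Num.floor (s * n.+1%:R) = z ord0 i] (x ord0 i)]).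
      apply: (@measurable_box R d (fun i s => Num.floor (s * n.+1%:R) = z ord0 i)) => i.
      exact: measurable_floor_fibre.
    apply/seteqP; split => x /=; first by move=> <- i; rewrite mxE.
    by move=> h; apply/rowP => i; rewrite mxE.
  apply/funext => x; rewrite /F /g; congr f; apply/rowP => i; rewrite !mxE.
  by [].
rewrite /F; apply: (@continuous_cvg _ _ _ _ _ (fun n => \row_i grid n (x ord0 i)) f x) => //.
apply/cvgrPdist_le => e e0; near=> n.
rewrite /Num.norm/= mx_normrE; apply: bigmax_le => [|[i j] _] /=; first exact: ltW.
rewrite !mxE [i]ord1; apply: le_trans (grid_dist _ _) _; near: n.
have /cvgrPdist_le/(_ e e0) := @cvg_harmonic R.
apply: filterS => n; rewrite sub0r normrN /harmonic/= ger0_norm// invr_ge0.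
Unshelve. all: end_near. Qed.

End grid.

Section integral_tools.
Context dT (T : measurableType dT) (R : realType) (mu : {measure set T -> \bar R}).
Implicit Types f g : T -> R.

(** No integrability is assumed: where the integral is infinite its real value is 0. *)
Lemma abs_Rintegral_le D f : measurable D -> measurable_fun D f ->
  ((`|\int[mu]_(x in D) f x|)%:E <= \int[mu]_(x in D) (`|f x|)%:E)%E.
Proof.
move=> mD /measurable_EFinP mf.
apply: (le_trans _ (le_abse_integral mu mD mf)).
rewrite /Rintegral; case: (\int[mu]_(x in D) (EFin \o f) x)%E => [r| |] //=.
- by rewrite normr0 leey.
- by rewrite normr0 leey.
Qed.

Lemma le_integrable_lty D f g : measurable D -> measurable_fun D f -> measurable_fun D g ->
  (forall x, D x -> `|f x| <= g x) -> (\int[mu]_(x in D) (g x)%:E < +oo)%E ->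
  mu.-integrable D (EFin \o f).
Proof.
move=> mD mf mg fg goo; apply/integrableP; split; first exact/measurable_EFinP.
apply: le_lt_trans goo; apply: ge0_le_integral => //.
- by apply: measurableT_comp => //; exact/measurable_EFinP.
- exact/measurable_EFinP.
Qed.

End integral_tools.

(** * Quadratic forms with a bounded integrable kernel *)

Section quadratic_form.
Context (R : realType) (d : nat) (p : \bar R).
Local Notation V := 'rV[R]_d.
Local Notation mu := (lebesgue_rV R d).
Hypothesis p2 : (2%:E < p)%E.
Variables (k : V -> R) (A B : R).
Hypotheses (A0 : 0 < A) (B0 : 0 < B) (mk : measurable_fun setT k)
  (kB : forall x, `|k x| <= B) (kA : (\int[mu]_x (`|k x|)%:E <= A%:E)%E).
Implicit Types v w a b : V -> V.

Let p1 : (1 <= p)%E.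
Proof. by rewrite ltW// (le_lt_trans _ p2)// lee_fin ler1n. Qed.

Definition quad_const : R := A `^ (1 - 2 * inv_exp p) * B `^ (2 * inv_exp p).

Let C0 : 0 < quad_const. Proof. by rewrite mulr_gt0// powR_gt0. Qed.

Lemma integral_quad_le v : measurable_fun setT v ->
  (\int[mu]_y (`|k y| * enorm (v y) ^+ 2)%:E <=
   quad_const%:E * Lpnorm p setT v `^ 2)%E.
Proof.
move=> mv; rewrite Lpnorm_setT; apply: integral_kernel_sqr_le => //.
- exact: measurableT_comp.
- exact: measurable_enorm_comp.
Qed.

Lemma measurable_coord_mul v i j : measurable_fun setT v ->
  measurable_fun setT (fun y => v y ord0 i * v y ord0 j).
Proof. by move=> mv; apply: measurable_funM; exact: (measurable_fun_rVP _).1. Qed.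

Lemma integrable_quad v i j : in_Lp p v ->
  mu.-integrable setT (fun y => (k y * (v y ord0 i * v y ord0 j))%:E).
Proof.
move=> [mv voo]; apply: (@le_integrable_lty _ _ _ _ _ _ (fun y => `|k y| * enorm (v y) ^+ 2)) => //.
- by apply: measurable_funM => //; exact: measurable_coord_mul.
- apply: measurable_funM; first exact: measurableT_comp.
  by apply: measurable_funX; exact: measurable_enorm_comp.
- move=> y _; rewrite normrM ler_wpM2l// normrM expr2.
  by rewrite ler_pM// coord_le_enorm.
- apply: le_lt_trans (integral_quad_le mv) _.
  by rewrite lte_mul_pinfty ?lee_fin ?ltW// poweR_lty.
Qed.

(* [2 e w <= e^2 / delta + delta w^2] absorbs the cross term. *)
Lemma quad_continuity a b delta M i j : in_Lp p a -> in_Lp p b ->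
  0 < delta -> delta <= 1 -> 0 <= M ->
  (Lpnorm p setT (fun x => a x - b x)%R <= delta%:E)%E ->
  (Lpnorm p setT b <= M%:E)%E ->
  `|\int[mu]_y (k y * (a y ord0 i * a y ord0 j)) -
    \int[mu]_y (k y * (b y ord0 i * b y ord0 j))| <=
  delta * (quad_const * (2 + M ^+ 2)).
Proof.
move=> La Lb d0 d1 M0 ab bM; have [ma _] := La; have [mb _] := Lb.
have mab : measurable_fun setT (fun x => a x - b x).
  by apply: measurable_fun_rV_add => //; exact: measurable_fun_rV_opp.
rewrite -RintegralB//; try exact: integrable_quad.
have mf : measurable_fun setT (fun y => k y * (a y ord0 i * a y ord0 j) -
    k y * (b y ord0 i * b y ord0 j)).
  by apply: measurable_funB; apply: measurable_funM => //; exact: measurable_coord_mul.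
rewrite -lee_fin; apply: le_trans (abs_Rintegral_le mu measurableT mf) _.
pose e y := enorm (a y - b y); pose w y := enorm (b y).
have me : measurable_fun setT e by exact: (measurable_enorm_comp mab).
have mw : measurable_fun setT w by exact: measurable_enorm_comp.
have mke : measurable_fun setT (fun y => `|k y| * e y ^+ 2).
  by apply: measurable_funM; [exact: measurableT_comp | exact: measurable_funX].
have mkw : measurable_fun setT (fun y => `|k y| * w y ^+ 2).
  by apply: measurable_funM; [exact: measurableT_comp | exact: measurable_funX].
have c0 : 0 <= 1 + delta^-1 by rewrite addr_ge0// invr_ge0 ltW.
have ke0 y : 0 <= `|k y| * e y ^+ 2 by rewrite mulr_ge0 ?sqr_ge0.
have kw0 y : 0 <= `|k y| * w y ^+ 2 by rewrite mulr_ge0 ?sqr_ge0.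
apply: (@le_trans _ _ (\int[mu]_y ((1 + delta^-1)%:E * (`|k y| * e y ^+ 2)%:E +
    delta%:E * (`|k y| * w y ^+ 2)%:E))%E).
  apply: ge0_le_integral => //.
  - by apply/measurable_EFinP; exact: measurableT_comp.
  - apply: emeasurable_funD; apply: emeasurable_funM => //; exact/measurable_EFinP.
  move=> y _; rewrite -!EFinM -EFinD lee_fin -mulrBr normrM.
  rewrite [leRHS](_ : _ = `|k y| * ((1 + delta^-1) * e y ^+ 2 + delta * w y ^+ 2)); last by ring.
  rewrite ler_wpM2l//.
  apply: le_trans (enormB_sqr_coord _ _ _ _) _; rewrite -/(e y) -/(w y) -subr_ge0.
  rewrite (_ : _ - _ = (e y - delta * w y) ^+ 2 / delta); last first.
    by field; rewrite gt_eqF.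
  by rewrite divr_ge0 ?sqr_ge0// ltW.
rewrite ge0_integralD//; last 4 first.
- by move=> y _; rewrite -!EFinM lee_fin; apply: mulr_ge0.
- by apply: emeasurable_funM => //; exact/measurable_EFinP.
- by move=> y _; rewrite -!EFinM lee_fin; apply: mulr_ge0 => //; exact: ltW.
- by apply: emeasurable_funM => //; exact/measurable_EFinP.
rewrite !ge0_integralZl//; try (by move=> y _; rewrite lee_fin);
  try (exact/measurable_EFinP); try (by rewrite lee_fin ltW).
have he := integral_quad_le mab; have hw := integral_quad_le mb.
have sq v r : 0 <= r -> (Lpnorm p setT v <= r%:E)%E ->
    (quad_const%:E * Lpnorm p setT v `^ 2 <= (quad_const * r ^+ 2)%:E)%E.
  move=> r0 vr; rewrite [leRHS]EFinM; apply: lee_wpmul2l; first by rewrite lee_fin ltW.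
  rewrite -(powR_mulrn 2 r0) -poweR_EFin; apply: ge0_le_poweR => //.
  exact: Lpnorm_ge0.
have he' := le_trans he (sq _ _ (ltW d0) ab); have hw' := le_trans hw (sq _ _ M0 bM).
apply: (@le_trans _ _ ((1 + delta^-1)%:E * (quad_const * delta ^+ 2)%:E +
    delta%:E * (quad_const * M ^+ 2)%:E)%E).
  by apply: leeD; apply: lee_wpmul2l => //; rewrite lee_fin ltW.
rewrite -!EFinM -EFinD lee_fin.
rewrite (_ : _ + _ = delta * (quad_const * (1 + delta + M ^+ 2))); last first.
  by field; rewrite gt_eqF.
by rewrite ler_wpM2l ?(ltW d0)// ler_wpM2l ?(ltW C0)// lerD2r lerD2l.
Qed.

Lemma quad_cvg (a : nat -> V -> V) b i j : (forall n, measurable_fun setT (a n)) ->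
  in_Lp p b -> Lpnorm p setT (fun x => a n x - b x) @[n --> \oo] --> 0%E ->
  \int[mu]_y (k y * (a n y ord0 i * a n y ord0 j)) @[n --> \oo] -->
  \int[mu]_y (k y * (b y ord0 i * b y ord0 j)).
Proof.
move=> ma Lb ab; have [mb boo] := Lb; pose M := normLp p b.
have bM : Lpnorm p setT b = M%:E by rewrite /M normLpK.
have M0 : 0 <= M by exact: normLp_ge0.
have K0 : 0 < quad_const * (2 + M ^+ 2) by rewrite mulr_gt0// ltr_pwDl// sqr_ge0.
apply/cvgrPdist_le => e e0; pose delta := Num.min 1 (e / (quad_const * (2 + M ^+ 2))).
have d0 : 0 < delta by rewrite lt_min ltr01 divr_gt0.
have : \forall n \near \oo, (Lpnorm p setT (fun x => a n x - b x)%R < delta%:E)%E.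
  move: ab => /(_ [set y | (y < delta%:E)%E]); apply.
  by apply: open_nbhs_nbhs; split; [exact: open_ereal_lt_ereal | rewrite /= lte_fin].
apply: filterS => n abn.
(* Only measurability of [a n] is given; its closeness to [b] puts it in [L^p]. *)
have Lan : in_Lp p (a n).
  split; first exact: ma.
  rewrite (_ : a n = fun x => (a n x - b x) + b x); last first.
    by apply/funext => x; rewrite subrK.
  have mab : measurable_fun setT (fun x => a n x - b x).
    by apply: measurable_fun_rV_add => //; exact: measurable_fun_rV_opp.
  apply: le_lt_trans (LpnormD p1 mab mb) _; rewrite lte_add_pinfty//.
  by rewrite (lt_le_trans abn)// leey.
rewrite distrC; apply: (le_trans (quad_continuity i j Lan Lb d0 _ M0 (ltW abn) _)).
- by rewrite ge_min lexx.
- by rewrite bM.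
- by rewrite -ler_pdivlMr// ge_min lexx orbT.
Qed.

End quadratic_form.

(** * The bilinear estimate *)

Section scaling_exponent.
Variables (R : realType) (d : nat) (p : \bar R).
Hypotheses (d3 : (3 <= d)%N) (hp : (d%:R%:E < p)%E).

Let dR : (0 : R) < d%:R. Proof. by rewrite ltr0n (leq_trans _ d3). Qed.

Lemma exponent_gt2 : (2%:E < p)%E.
Proof. by rewrite (le_lt_trans _ hp)// lee_fin ler_nat ltnW. Qed.

Lemma exponent_gt1 : (1 < p)%E.
Proof. by rewrite (lt_trans _ exponent_gt2)// lte_fin ltr1n. Qed.

Lemma dim_inv_exp_lt1 : d%:R * inv_exp p < 1.
Proof.
case: p hp => [r| |]; last by rewrite ltNge leNye.
- rewrite lte_fin => dr; have r0 := lt_trans dR dr.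
  by rewrite inv_exp_fin ?gt_eqF// ltr_pdivrMr// mul1r.
- by rewrite inv_exp_pinfty mulr0 ltr01.
Qed.

Lemma scal_exp_gt0 : 0 < scal_exp d p.
Proof. by rewrite divr_gt0// subr_gt0 dim_inv_exp_lt1. Qed.

End scaling_exponent.

Section leray_form.
Variables (R : realType) (d : nat) (p : \bar R).
Hypotheses (d3 : (3 <= d)%N) (hp : (d%:R%:E < p)%E).
Local Notation V := 'rV[R]_d.
Local Notation T := (measurableTypeR R).
Local Notation mu := (lebesgue_rV R d).
Local Notation idx := ('I_d * 'I_d * 'I_d)%type.
Implicit Types (v w : V -> V) (t s : R) (x y z : V) (l : idx).

Let p1 : (1 < p)%E := exponent_gt1 d3 hp.
Let p2 : (2%:E < p)%E := exponent_gt2 d3 hp.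

(** One scalar kernel that dominates all entries and derivatives at once, so that a scalar estimate
    bounds the vector-valued form. *)
Definition leray_abs t z : R := \sum_(l : idx) `|leray_d1 l.2 l.1.1 l.1.2 t z|.

Definition leray_form t v x : V :=
  \row_i \sum_j \sum_k
    \int[mu]_y (leray_d1 k i j t (x - y) * (v y ord0 j * v y ord0 k)).

Lemma heat_leray_divE t v x : 0 < t -> heat_leray_div t (tensor v) x = leray_form t v x.
Proof.
move=> t0; apply/rowP => i; rewrite !mxE.
apply: eq_bigr => j _; apply: eq_bigr => k _; apply: eq_Rintegral => y _.
by rewrite partial_leray// /tensor mxE big_ord1 !mxE.
Qed.

Lemma leray_abs_ge0 t z : 0 <= leray_abs t z.
Proof. exact: sumr_ge0. Qed.

Lemma measurable_leray_abs t : measurable_fun setT (leray_abs t).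
Proof.
apply: measurable_sum => l; apply: measurableT_comp => //.
exact: measurable_leray_d1_at.
Qed.

Definition index_card : R := #|{: idx}|%:R.

Let index_card_gt0 : 0 < index_card.
Proof.
rewrite ltr0n; apply/card_gt0P; pose i : 'I_d := Ordinal (ltnW (ltnW d3)).
by exists (i, i, i).
Qed.

Lemma leray_abs_le t z : 0 < t -> leray_abs t z <= index_card * leray_sup d t.
Proof.
move=> t0; rewrite mulr_natl -sumr_const; apply: ler_sum => l _.
exact: leray_d1_le.
Qed.

Lemma integral_leray_abs_le t : 0 < t ->
  (\int[mu]_x (leray_abs t x)%:E <= (index_card * leray_mass d t)%:E)%E.
Proof.
move=> t0; under eq_integral do rewrite -sumEFin.
rewrite ge0_integral_sum//; last first.
  move=> l; apply/measurable_EFinP; apply: measurableT_comp => //.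
  exact: measurable_leray_d1_at.
rewrite mulr_natl -sumr_const -sumEFin; apply: lee_sum => l _.
exact: integral_leray_d1_le.
Qed.

Lemma measurable_leray_d1_sub t k i j x :
  measurable_fun setT (fun y => leray_d1 k i j t (x - y)).
Proof. by apply: measurable_comp_sub; exact: measurable_leray_d1_at. Qed.

Lemma integral_leray_d1_sub_le t k i j x : 0 < t ->
  (\int[mu]_y (`|leray_d1 k i j t (x - y)|)%:E <= (leray_mass d t)%:E)%E.
Proof.
move=> t0; rewrite (ge0_integral_reflect x (f := fun z => (`|leray_d1 k i j t z|)%:E))//.
  exact: integral_leray_d1_le.
by apply/measurable_EFinP; apply: measurableT_comp => //; exact: measurable_leray_d1_at.
Qed.

Lemma integral_leray_abs_sub_le t x : 0 < t ->
  (\int[mu]_y (leray_abs t (x - y))%:E <= (index_card * leray_mass d t)%:E)%E.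
Proof.
move=> t0; rewrite (ge0_integral_reflect x (f := fun z => (leray_abs t z)%:E))//.
- exact: integral_leray_abs_le.
- by apply/measurable_EFinP; exact: measurable_leray_abs.
- by move=> z; rewrite lee_fin leray_abs_ge0.
Qed.

Lemma integral_leray_abs_subr_le t y : 0 < t ->
  (\int[mu]_x (leray_abs t (x - y))%:E <= (index_card * leray_mass d t)%:E)%E.
Proof.
move=> t0; rewrite (ge0_integral_shift (- y) (f := fun z => (leray_abs t z)%:E))//.
- exact: integral_leray_abs_le.
- by apply/measurable_EFinP; exact: measurable_leray_abs.
- by move=> z; rewrite lee_fin leray_abs_ge0.
Qed.

Lemma measurable_leray_abs_sub t x : measurable_fun setT (fun y => leray_abs t (x - y)).
Proof. by apply: measurable_comp_sub; exact: measurable_leray_abs. Qed.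

Lemma measurable_leray_abs2 t : measurable_fun setT (fun z : V * V => leray_abs t (z.1 - z.2)).
Proof. by apply: (measurableT_comp (measurable_leray_abs t)); exact: measurable_rV_sub. Qed.

Definition leray_density t v x : \bar R :=
  (\int[mu]_y (leray_abs t (x - y) * enorm (v y) ^+ 2)%:E)%E.

Lemma leray_form_le t v x : measurable_fun setT v ->
  ((\sum_i `|leray_form t v x ord0 i|)%:E <= leray_density t v x)%E.
Proof.
move=> mv.
have mK (l : idx) : measurable_fun setT
    (fun y => leray_d1 l.2 l.1.1 l.1.2 t (x - y) * (v y ord0 l.1.2 * v y ord0 l.2)).
  by apply: measurable_funM; [exact: measurable_leray_d1_sub | exact: measurable_coord_mul].
apply: (@le_trans _ _ (\sum_(l : idx) (`|\int[mu]_y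
    (leray_d1 l.2 l.1.1 l.1.2 t (x - y) * (v y ord0 l.1.2 * v y ord0 l.2))|)%:E)%E).
  rewrite sumEFin lee_fin.
  rewrite -(pair_bigA_idem _ (fun (ij : 'I_d * 'I_d) (k : 'I_d) => `|\int[mu]_y
    (leray_d1 k ij.1 ij.2 t (x - y) * (v y ord0 ij.2 * v y ord0 k))|))/=; last exact: addr0.
  rewrite -(pair_bigA_idem _ (fun i j : 'I_d => \sum_(k : 'I_d) `|\int[mu]_y
    (leray_d1 k i j t (x - y) * (v y ord0 j * v y ord0 k))|))/=; last exact: addr0.
  apply: ler_sum => i _; rewrite mxE.
  apply: (le_trans (ler_norm_sum _ _ _)); apply: ler_sum => j _.
  exact: ler_norm_sum.
apply: (@le_trans _ _ (\sum_(l : idx) \int[mu]_y (`|leray_d1 l.2 l.1.1 l.1.2 t (x - y) *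
    (v y ord0 l.1.2 * v y ord0 l.2)|)%:E)%E).
  by apply: lee_sum => l _; exact: (abs_Rintegral_le mu measurableT (mK l)).
rewrite -ge0_integral_sum//; last first.
  by move=> l; apply/measurable_EFinP; exact: measurableT_comp.
apply: ge0_le_integral => //.
- by move=> y _; apply: sume_ge0 => l _.
- by apply: emeasurable_sum => l; apply/measurable_EFinP; exact: measurableT_comp.
- apply/measurable_EFinP; apply: measurable_funM; first exact: measurable_leray_abs_sub.
  by apply: measurable_funX; exact: measurable_enorm_comp.
move=> y _; rewrite sumEFin lee_fin mulr_suml; apply: ler_sum => l _.
by rewrite normrM ler_wpM2l// normrM expr2 ler_pM// coord_le_enorm.
Qed.

Lemma measurable_leray_density t v : measurable_fun setT v ->
  measurable_fun setT (leray_density t v).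
Proof.
move=> mv; apply: (measurable_kernel_integral mu (measurable_leray_abs2 t)).
- by move=> z; exact: leray_abs_ge0.
- by apply: measurable_funX; exact: measurable_enorm_comp.
- by move=> y; exact: sqr_ge0.
Qed.

(** A bound uniform in [x]; it provides the absolute convergence that Fubini needs when the form is
    paired with an integrable function. *)
Lemma leray_density_sup t : 0 < t -> exists2 C, 0 < C & forall v x,
  measurable_fun setT v -> (leray_density t v x <= C%:E * Lpnorm p setT v `^ 2)%E.
Proof.
move=> t0; have A0 := mulr_gt0 index_card_gt0 (leray_mass_gt0 d t0).
have B0 := mulr_gt0 index_card_gt0 (leray_sup_gt0 d t0).
exists (quad_const p (index_card * leray_mass d t) (index_card * leray_sup d t)).
  by rewrite mulr_gt0// powR_gt0.
move=> v x mv; apply: le_trans (integral_quad_le p2 A0 B0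
  (measurable_leray_abs_sub t x) _ _ mv).
- by under [leRHS]eq_integral do rewrite ger0_norm ?leray_abs_ge0//.
- by move=> y; rewrite ger0_norm ?leray_abs_ge0// leray_abs_le.
- under eq_integral do rewrite ger0_norm ?leray_abs_ge0//.
  exact: integral_leray_abs_sub_le.
Qed.

Definition leray_rate : R :=
  (index_card * (3 * gauss_const R d)) `^ (1 - inv_exp p) *
  (index_card * (3 * gauss_const R d * sup_const R d)) `^ inv_exp p.

Let g0 := gauss_const_gt0 R d.
Let s0 := sup_const_gt0 R d.
Let c10 : 0 < index_card * (3 * gauss_const R d).
Proof. by apply: mulr_gt0 => //; apply: mulr_gt0. Qed.
Let c20 : 0 < index_card * (3 * gauss_const R d * sup_const R d).
Proof. by apply: mulr_gt0 => //; apply: mulr_gt0 => //; apply: mulr_gt0. Qed.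

Lemma leray_rate_gt0 : 0 < leray_rate.
Proof. by apply: mulr_gt0; exact: powR_gt0. Qed.

(** Interpolating [t^(-1/2)] and [t^(-(d+1)/2)] with weights [1 - 1/p] and [1/p] gives the exponent
    [-1/2 - d/(2p)], which is [scal_exp - 1]. It exceeds -1 because [p > d], so the singularity is
    integrable in time. *)
Lemma leray_rateE t : 0 < t ->
  (index_card * leray_mass d t) `^ (1 - inv_exp p) *
  (index_card * leray_sup d t) `^ inv_exp p =
  leray_rate * t `^ (scal_exp d p - 1).
Proof.
move=> t0; rewrite /leray_mass /leray_sup.
have [c1' c2'] := (c10, c20); move: c1' c2'.
set a := gauss_const R d; set b := sup_const R d => c1' c2'.
have h1 : 0 <= t `^ (- 2^-1) := powR_ge0 _ _.
have h2 : 0 <= t `^ (- (d%:R / 2)) := powR_ge0 _ _.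
rewrite [index_card * (3 * a * _)]mulrA powRM ?(ltW c1')//.
rewrite [index_card * (3 * a * b * _)]mulrA.
rewrite [X in _ * _ * X]powRM ?(ltW c2') ?mulr_ge0//.
rewrite [X in _ * (_ * X)]powRM// /leray_rate -/a -/b -!powRrM.
rewrite mulrACA; congr (_ * _); rewrite -!powRD ?(gt_eqF t0) ?implybT//.
by congr (_ `^ _); rewrite /scal_exp; field.
Qed.

Lemma Lnorm_leray_density t v : 0 < t -> measurable_fun setT v ->
  ('N[mu]_p[leray_density t v] <=
   (leray_rate * t `^ (scal_exp d p - 1))%:E * Lpnorm p setT v `^ 2)%E.
Proof.
move=> t0 mv; rewrite -leray_rateE// Lpnorm_setT.
have A0 := mulr_gt0 index_card_gt0 (leray_mass_gt0 d t0).
have B0 := mulr_gt0 index_card_gt0 (leray_sup_gt0 d t0).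
apply: (Lnorm_kernel_sqr_le A0 B0 (measurable_leray_abs2 t)) => //.
- by move=> z; exact: leray_abs_ge0.
- by move=> x; exact: integral_leray_abs_sub_le.
- exact: measurable_enorm_comp.
- by move=> z; exact: leray_abs_le.
- by move=> y; exact: integral_leray_abs_subr_le.
Qed.

End leray_form.

(** * The Duhamel integral *)

Section singular_integral.
Variable R : realType.
Local Notation T := (measurableTypeR R).
Implicit Types a s t : R.

Lemma ge0_integral_powR_le a t : 0 < a -> 0 < t ->
  (\int[lebesgue_measure]_(s in `]0%R, t[) (s `^ (a - 1))%:E <= (t `^ a / a)%:E)%E.
Proof.
(* The integrand may be singular at 0, so the interval is exhausted by closed ones; [n.+2] keeps the
   left end strictly below [t] already for [n = 0]. *)
move=> a0 t0; pose F n : set T := `[t / n.+2%:R, t]%classic.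
have Fpos n s : F n s -> 0 < s.
  by rewrite /F/= in_itv/= => /andP[+ _]; apply: lt_le_trans; rewrite divr_gt0.
have mp : measurable_fun setT (fun s : T => (s `^ (a - 1))%:E).
  by apply/measurable_EFinP; exact: measurable_powR.
have mS (D : set T) : measurable_fun D (fun s : T => (s `^ (a - 1))%:E).
  exact: measurable_funTS.
have p0 s : (0 <= (s `^ (a - 1))%:E)%E by rewrite lee_fin powR_ge0.
apply: (@le_trans _ _ (\int[lebesgue_measure]_(s in \bigcup_n F n) (s `^ (a - 1))%:E)%E).
  apply: ge0_subset_integral => //.
  - by apply: bigcup_measurable => n _; exact: measurable_itv.
  move=> s /=; rewrite in_itv/= => /andP[s0 st].
  have [n tn] : exists n : nat, t / s < n.+2%:R.
    exists (Num.truncn (t / s)); apply: lt_trans (truncnS_gt _) _.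
    by rewrite ltr_nat.
  exists n => //; rewrite /F/= in_itv/= (ltW st) andbT ler_pdivrMr//.
  by rewrite mulrC -ler_pdivrMr// ltW.
have nF : nondecreasing_seq F.
  move=> m n mn; apply/subsetPset => s; rewrite /F/= !in_itv/= => /andP[h ->].
  by rewrite andbT (le_trans _ h)// ler_pM2l// lef_pV2 ?posrE// ler_nat !ltnS.
have cF := ge0_nondecreasing_set_cvg_integral (mu := @lebesgue_measure R) nF
  (fun n => measurable_itv _) (fun n => mS (F n)) (fun n s _ => p0 s).
rewrite -(cvg_lim _ cF)//; apply: lime_le; first by apply: cvgP cF.
apply: nearW => n.
pose G s := a^-1 * s `^ a.
have dG s : 0 < s -> is_derive s (1 : R) G (s `^ (a - 1)).
  move=> s0; have h := is_deriveZ (a^-1 : R) (is_derive1_powR a s0).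
  by apply: (is_derive_eq h); rewrite /GRing.scale/= mulrA mulVf ?mul1r// gt_eqF.
have cG s : 0 < s -> {for s, continuous G}.
  by move=> s0; have [+ _] := dG s s0; move=> /derivable1_diffP/differentiable_continuous.
have t20 : 0 < t / n.+2%:R by rewrite divr_gt0.
have t2t : t / n.+2%:R < t by rewrite ltr_pdivrMr// ltr_pMr// ltr1n.
rewrite (@continuous_FTC2 _ (fun s => s `^ (a - 1)) G)//.
- rewrite -EFinB lee_fin /G -mulrBr mulrC ler_wpM2r ?invr_ge0 ?(ltW a0)//.
  by rewrite gerBl powR_ge0.
- apply: continuous_in_subspaceT => s /[!inE]/= /Fpos s0.
  have [+ _] := is_derive1_powR (a - 1) s0.
  by move=> /derivable1_diffP/differentiable_continuous.
- split.
  + by move=> s; rewrite in_itv/= => /andP[/(lt_trans t20)/dG[+ _] _].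
  + by apply: cvg_at_right_filter; exact: cG.
  + by apply: cvg_at_left_filter; exact: cG.
- move=> s; rewrite in_itv/= => /andP[/(lt_trans t20) s0 _].
  by rewrite derive1E; have [_ ->] := dG s s0.
Qed.

Lemma ge0_integral_powR_sub_le a t : 0 < a -> 0 < t ->
  (\int[lebesgue_measure]_s (\1_(`]0%R, t[%classic) s * (t - s) `^ (a - 1))%:E <=
   (t `^ a / a)%:E)%E.
Proof.
move=> a0 t0; apply: le_trans (ge0_integral_powR_le a0 t0).
pose f (s : T) : \bar R := (\1_(`]0%R, t[%classic) s * s `^ (a - 1))%:E.
have mf : measurable_fun setT f.
  apply/measurable_EFinP; apply: measurable_funM; last exact: measurable_powR.
  by apply: measurable_indic; exact: measurable_itv.
have f0 s : (0 <= f s)%E by rewrite lee_fin mulr_ge0// powR_ge0.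
have := ge0_integral_signed_shift1 true t mf f0.
rewrite [in LHS](_ : (fun s => _) = (fun s : T =>
    (\1_(`]0%R, t[%classic) s * (t - s) `^ (a - 1))%:E)); last first.
  apply/funext => s; rewrite /f expr1 mulN1r; congr (_ * _)%:E.
  by rewrite !indicE !mem_setE !in_itv/= subr_gt0 gtrBl andbC.
move=> ->; rewrite [leRHS]integral_mkcond; apply: ge0_le_integral => //.
- apply: (measurable_restrictT _ _).1; first exact: measurable_itv.
  by apply/measurable_EFinP/measurable_funTS; exact: measurable_powR.
move=> s _; rewrite /f patchE indicE.
by case: ifP => _; rewrite ?mul1r ?mul0r.
Qed.

End singular_integral.

Section Lp_path.
Variables (R : realType) (d : nat) (p : \bar R).
Hypotheses (d3 : (3 <= d)%N) (hp : (d%:R%:E < p)%E).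
Local Notation V := 'rV[R]_d.
Local Notation T := (measurableTypeR R).
Local Notation mu := (lebesgue_rV R d).
Implicit Types (u : R -> V -> V) (t s M : R) (x y : V).

Let p1 : (1 < p)%E := exponent_gt1 d3 hp.
Let p2 : (2%:E < p)%E := exponent_gt2 d3 hp.
Let p0 : (0 < p)%E. Proof. by rewrite (lt_trans _ p1). Qed.

(** What a strong solution provides on []0, t[]. Continuity is two-sided, since the interval is
    open. *)
Definition Lp_path t M u := forall s, 0 < s < t ->
  [/\ in_Lp p (u s), (Lpnorm p setT (u s) <= M%:E)%E &
    Lpnorm p setT (fun x => u r x - u s x) @[r --> s] --> 0%E].

(** The Duhamel integrand, extended by 0 to all times so that it lives on the whole product
    space. *)
Definition leray_path u t (z : T * V) : V :=
  if 0 < z.1 < t then leray_form (t - z.1) (u z.1) z.2 else 0.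

Let trunc u t s : V -> V := if 0 < s < t then u s else fun=> 0.

Lemma measurable_leray_path t M u i : Lp_path t M u ->
  measurable_fun setT (fun z : T * V => leray_path u t z ord0 i).
Proof.
move=> Lu.
have mtr s : measurable_fun setT (trunc u t s).
  rewrite /trunc; case: ifPn => [/Lu[[]]//|_]; exact: measurable_cst.
(* [u] is replaced by its step functions [u \o grid n], which have countably many
   values and converge to [u] by continuity in time. *)
pose F (n : nat) (z : T * V) : R := \1_(`]0, t[%classic) z.1 * \sum_j \sum_k
  \int[mu]_y (leray_d1 k i j (t - z.1) (z.2 - y) *
    (trunc u t (grid n z.1) y ord0 j * trunc u t (grid n z.1) y ord0 k)).
apply: (@measurable_fun_cvg _ _ _ setT F) => [n|[s x] _].
  apply: measurable_funM.
    apply: (@measurableT_comp _ _ _ _ _ _ (\1_(`]0, t[%classic) : T -> R) _ fst) => //.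
  apply: measurable_sum => j; apply: measurable_sum => k.
  have mtrj (l : 'I_d) : measurable_fun setT
      (fun w : (T * V) * V => trunc u t (grid n w.1.1) w.2 ord0 l).
    apply: (measurable_countable_pieces
      (q := fun w : (T * V) * V => Num.floor (w.1.1 * n.+1%:R))
      (f := fun (m : int) (w : (T * V) * V) => trunc u t (m%:~R / n.+1%:R) w.2 ord0 l)).
      move=> m; rewrite -[X in measurable X]setTI.
      have mS := measurableT_comp (measurable_fst (T1 := T) (T2 := V))
        (measurable_fst (T1 := (T * V)%type) (T2 := V)).
      exact: (mS measurableT _ (measurable_floor_fibre n m)).
    move=> m; apply: (measurableT_comp (measurable_coord l)).
    exact: (measurableT_comp (mtr _) measurable_snd).
  apply: (measurable_Rintegral mu (h := fun w : (T * V) * V =>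
    leray_d1 k i j (t - w.1.1) (w.1.2 - w.2) *
    (trunc u t (grid n w.1.1) w.2 ord0 j * trunc u t (grid n w.1.1) w.2 ord0 k))).
  apply: measurable_funM; last by apply: measurable_funM; exact: mtrj.
  have mw1 : measurable_fun setT (fun w : (T * V) * V => w.1.1).
    exact: (measurableT_comp measurable_fst measurable_fst).
  have mw2 : measurable_fun setT (fun w : (T * V) * V => w.1.2).
    exact: (measurableT_comp measurable_snd measurable_fst).
  have mw12 : measurable_fun setT (fun w : (T * V) * V => w.1.2 - w.2).
    have h : measurable_fun setT (fun w : (T * V) * V => (w.1.2, w.2)).
      by apply: measurable_fun_pair => //; exact: measurable_snd.
    exact: (measurableT_comp (@measurable_rV_sub R d) h).
  pose g (w : (T * V) * V) : T * V := (t - w.1.1, w.1.2 - w.2).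
  have mw : measurable_fun setT g.
    apply: measurable_fun_pair => //.
    by apply: measurable_funB => //; exact: measurable_cst.
  exact: (measurableT_comp (measurable_leray_d1 k i j) mw).
rewrite /leray_path/F /=; case: ifPn => [st|nst]; last first.
  rewrite indicE memNset/=; last by rewrite in_itv/=; exact/negP.
  under eq_fun do rewrite mul0r; rewrite mxE; exact: cvg_cst.
rewrite indicE mem_set/=; last by rewrite in_itv/=.
under eq_fun do rewrite mul1r.
rewrite mxE; apply: cvg_big => [|j _]; first exact: add_continuous.
apply: cvg_big => [|k _]; first exact: add_continuous.
have /andP[s0 s_t] := st; have ts0 : 0 < t - s by rewrite subr_gt0.
have [Ls sM cs] := Lu s st.
apply: (quad_cvg p2 (leray_mass_gt0 d ts0) (leray_sup_gt0 d ts0)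
  (measurable_leray_d1_sub (t - s) k i j x)
  (fun y => leray_d1_le d3 k i j (x - y) ts0)
  (integral_leray_d1_sub_le d3 k i j x ts0) (fun n => mtr (grid n s)) Ls).
have := cvg_comp _ _ (@grid_cvg R s) cs.
apply: cvg_trans; apply: near_eq_cvg.
have tn : \forall r \near s, 0 < r < t.
  have := @near_in_itvoo R 0 t s; rewrite in_itv/= => /(_ st).
  by apply: filterS => r; rewrite in_itv.
have := @grid_cvg R s _ tn; apply: (@filterS _ \oo) => n /= rt.
by rewrite /trunc rt.
Qed.

Lemma duhamelE u t x i : duhamel u t x ord0 i =
  \int[lebesgue_measure]_s leray_path u t (s, x) ord0 i.
Proof.
rewrite mxE Rintegral_mkcond; apply: eq_Rintegral => s _; rewrite patchE /leray_path/=.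
rewrite mem_setE in_itv/=; case: ifPn => [/andP[_ st]|_]; last by rewrite mxE.
by rewrite heat_leray_divE// subr_gt0.
Qed.

Lemma measurable_duhamel t M u : Lp_path t M u -> measurable_fun setT (duhamel u t).
Proof.
move=> Lu; apply/measurable_fun_rVP => i; under eq_fun do rewrite duhamelE.
apply: (measurable_Rintegral (@lebesgue_measure R)
  (h := fun z : V * T => leray_path u t (z.2, z.1) ord0 i)).
have msw : measurable_fun setT (fun z : V * T => (z.2, z.1)).
  by apply: measurable_fun_pair; [exact: measurable_snd|exact: measurable_fst].
exact: (measurableT_comp (measurable_leray_path i Lu) msw).
Qed.

Definition path_sum u t (z : T * V) : R := \sum_i `|leray_path u t z ord0 i|.

Lemma path_sum_ge0 u t z : 0 <= path_sum u t z.
Proof. exact: sumr_ge0. Qed.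

Lemma measurable_path_sum t M u : Lp_path t M u -> measurable_fun setT (path_sum u t).
Proof.
move=> Lu; apply: measurable_sum => i; apply: measurableT_comp => //.
exact: measurable_leray_path Lu.
Qed.

(** It majorises the Duhamel term; being in [L^p], it is finite almost everywhere, which justifies
    the later uses of Fubini. *)
Definition path_mass u t x : \bar R :=
  (\int[lebesgue_measure]_s (path_sum u t (s, x))%:E)%E.

Lemma path_mass_ge0 u t x : (0 <= path_mass u t x)%E.
Proof. by apply: integral_ge0 => s _; rewrite lee_fin path_sum_ge0. Qed.

Lemma measurable_path_mass t M u : Lp_path t M u -> measurable_fun setT (path_mass u t).
Proof.
move=> Lu; have mh : measurable_fun setT (fun z : V * T => (path_sum u t (z.2, z.1))%:E).
  apply/measurable_EFinP.
  have msw : measurable_fun setT (fun z : V * T => (z.2, z.1)).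
    by apply: measurable_fun_pair; [exact: measurable_snd|exact: measurable_fst].
  exact: (measurableT_comp (measurable_path_sum Lu) msw).
have := @measurable_fun_fubini_tonelli_F _ _ V T R (@lebesgue_measure R) _ mh.
by apply => z; rewrite lee_fin path_sum_ge0.
Qed.

Lemma measurable_leray_path_at t M u i x : Lp_path t M u ->
  measurable_fun setT (fun s : T => leray_path u t (s, x) ord0 i).
Proof.
by move=> Lu; exact: (measurableT_comp (measurable_leray_path i Lu) (measurable_pair2 x)).
Qed.

Lemma duhamel_le_path_mass t M u x : Lp_path t M u ->
  ((enorm (duhamel u t x))%:E <= path_mass u t x)%E.
Proof.
move=> Lu; apply: (@le_trans _ _ (\sum_i (`|duhamel u t x ord0 i|)%:E)%E).
  by rewrite sumEFin lee_fin enorm_le_sum.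
apply: (@le_trans _ _ (\sum_i \int[lebesgue_measure]_s
    (`|leray_path u t (s, x) ord0 i|)%:E)%E).
  apply: lee_sum => i _; rewrite duhamelE.
  apply: (abs_Rintegral_le (@lebesgue_measure R) measurableT).
  exact: measurable_leray_path_at Lu.
rewrite -ge0_integral_sum//.
  apply: ge0_le_integral => //.
  - by move=> s _; apply: sume_ge0.
  - apply: emeasurable_sum => i; apply/measurable_EFinP; apply: measurableT_comp => //.
    exact: measurable_leray_path_at Lu.
  - apply/measurable_EFinP; apply: (measurableT_comp (measurable_path_sum Lu)).
    exact: measurable_pair2.
  - by move=> s _; rewrite sumEFin.
move=> i; apply/measurable_EFinP; apply: measurableT_comp => //.
exact: measurable_leray_path_at Lu.
Qed.

Lemma Lnorm_path_mass t M u : 0 < t -> 0 < M -> Lp_path t M u ->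
  ('N[mu]_p[path_mass u t] <=
   (leray_rate d p * M ^+ 2 * (t `^ scal_exp d p / scal_exp d p))%:E)%E.
Proof.
move=> t0 M0 Lu; set al := scal_exp d p; have al0 : 0 < al := scal_exp_gt0 d3 hp.
pose c := leray_rate d p * M ^+ 2 : R.
have c0 : 0 < c by rewrite mulr_gt0 ?exprn_gt0// (leray_rate_gt0 p d3).
(* Majorant of the norms of the time slices: [(t - s)^(scal_exp - 1)] has integral at most
   [t^scal_exp / scal_exp] over []0, t[]. *)
pose a (s : T) : R := c * (\1_(`]0, t[%classic) s * (t - s) `^ (al - 1)).
have ind0 (s : T) : 0 <= \1_(`]0, t[%classic) s * (t - s) `^ (al - 1) :> R.
  by rewrite mulr_ge0 ?powR_ge0.
have mind : measurable_fun setT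
    (fun s : T => \1_(`]0, t[%classic) s * (t - s) `^ (al - 1) : R).
  apply: measurable_funM; first by apply: measurable_indic; exact: measurable_itv.
  by apply: measurable_fun_powR; apply: measurable_funB => //; exact: measurable_cst.
apply: (@Lnorm_integral_le _ _ T V R _ mu p (path_sum u t) a) => //.
- exact: measurable_path_sum Lu.
- by apply: measurable_funM => //; exact: measurable_cst.
- by move=> z; exact: path_sum_ge0.
- by move=> s; rewrite mulr_ge0 ?(ltW c0).
- move=> s x /eqP; rewrite mulf_eq0 gt_eqF//= mulf_eq0 => as0.
  apply: big1 => i _; rewrite /leray_path/=; case: ifPn => [/andP[s0 st]|]; last first.
    by rewrite mxE normr0.
  move: as0; rewrite indicE mem_set/=; last by rewrite in_itv/= s0.
  by rewrite oner_eq0/= powR_eq0 subr_eq0 gt_eqF.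
- by rewrite mulr_gt0// divr_gt0// powR_gt0.
- under eq_integral do rewrite EFinM.
  rewrite ge0_integralZl//; last 3 first.
  + exact/measurable_EFinP.
  + by move=> s _; rewrite lee_fin.
  + by rewrite lee_fin ltW.
  rewrite [leRHS]EFinM lee_wpmul2l ?lee_fin ?(ltW c0)//.
  exact: ge0_integral_powR_sub_le.
- move=> s; rewrite /a; have [st|nst] := boolP (0 < s < t); last first.
    rewrite (_ : (fun x => _) = cst 0%E); last first.
      apply/funext => x; rewrite /path_sum big1// => i _.
      by rewrite /leray_path/= (negbTE nst) mxE normr0.
    by rewrite Lnorm0 ?gt_eqF// lee_fin mulr_ge0 ?(ltW c0).
  have [[mus _] usM _] := Lu s st; have /andP[_ s_t] := st.
  have ts0 : 0 < t - s by rewrite subr_gt0.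
  rewrite indicE mem_set/=; last by rewrite in_itv/=.
  rewrite mul1r; apply: (@le_trans _ _ ('N[mu]_p[leray_density (t - s) (u s)])%E).
    apply: le_Lnorm => //.
    + apply/measurable_EFinP.
      exact: (measurableT_comp (measurable_path_sum Lu) (measurable_pair1 _)).
    + exact: measurable_leray_density.
    apply: aeW => x /=; rewrite ger0_norm ?path_sum_ge0//.
    rewrite gee0_abs; last first.
      by apply: integral_ge0 => y _; rewrite lee_fin mulr_ge0 ?leray_abs_ge0 ?sqr_ge0.
    rewrite /path_sum /leray_path/= st; exact: leray_form_le.
  apply: le_trans (Lnorm_leray_density d3 hp ts0 mus) _.
  rewrite (_ : c * _ = leray_rate d p * (t - s) `^ (al - 1) * M ^+ 2); last first.
    by rewrite /c; ring.
  rewrite [leRHS]EFinM; apply: lee_wpmul2l.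
    by rewrite lee_fin mulr_ge0 ?powR_ge0// ltW// (leray_rate_gt0 p d3).
  rewrite -(powR_mulrn 2 (ltW M0)) -poweR_EFin; apply: ge0_le_poweR => //.
  exact: Lpnorm_ge0.
Qed.

Definition duhamel_const : R := leray_rate d p / scal_exp d p.

Lemma duhamel_const_gt0 : 0 < duhamel_const.
Proof. by rewrite divr_gt0 ?(leray_rate_gt0 p d3)// (scal_exp_gt0 d3 hp). Qed.

Lemma Lpnorm_duhamel_le t M u : 0 < t -> 0 < M -> Lp_path t M u ->
  (Lpnorm p setT (duhamel u t) <= (duhamel_const * t `^ scal_exp d p * M ^+ 2)%:E)%E.
Proof.
move=> t0 M0 Lu.
rewrite (_ : _ * _ = leray_rate d p * M ^+ 2 * (t `^ scal_exp d p / scal_exp d p)); last first.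
  by rewrite /duhamel_const; ring.
apply: le_trans (Lnorm_path_mass t0 M0 Lu); apply: Lpnorm_le => //.
- exact: ltW.
- exact: measurable_duhamel Lu.
- exact: measurable_path_mass Lu.
- by apply: aeW => x; exact: duhamel_le_path_mass Lu.
Qed.

(** A function with finite [L^p] norm is finite almost everywhere, and a finite [path_mass] means
    that every component is absolutely integrable in time. *)
Lemma ae_integrable_leray_path t M u : 0 < t -> 0 < M -> Lp_path t M u ->
  {ae mu, forall x, forall i, lebesgue_measure.-integrable setT
     (fun s : T => (leray_path u t (s, x) ord0 i)%:E)}.
Proof.
move=> t0 M0 Lu.
have := Lnorm_ae_lty p0 (measurable_path_mass Lu)
  (le_lt_trans (Lnorm_path_mass t0 M0 Lu) (ltry _)).
apply: filterS => x; rewrite gee0_abs ?path_mass_ge0// => xoo i.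
apply: (le_integrable_lty (g := fun s : T => path_sum u t (s, x))) xoo => //.
- exact: measurable_leray_path_at Lu.
- exact: (measurableT_comp (measurable_path_sum Lu) (measurable_pair2 x)).
- by move=> s _; rewrite /path_sum (bigD1 i)//= lerDl sumr_ge0.
Qed.

End Lp_path.

(** * The heat semigroup *)

Section Rintegral_fubini.
Context d1 d2 (X : measurableType d1) (Y : measurableType d2) (R : realType).
Variable m1 : {sigma_finite_measure set X -> \bar R}.
Variable m2 : {sigma_finite_measure set Y -> \bar R}.
Variable f : X * Y -> R.
Hypothesis mf : measurable_fun setT f.
Hypothesis foo : (\int[m1]_x \int[m2]_y (`|f (x, y)|)%:E < +oo)%E.

Let imf : (m1 \x m2)%E.-integrable setT (EFin \o f).
Proof. by apply/integrable12ltyP => //; exact/measurable_EFinP. Qed.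

Let mf2 : measurable_fun setT (fun z : Y * X => f (z.2, z.1)).
Proof.
have msw : measurable_fun setT (fun z : Y * X => (z.2, z.1)).
  by apply: measurable_fun_pair; [exact: measurable_snd|exact: measurable_fst].
exact: (measurableT_comp mf msw).
Qed.

Let ae_fst : {ae m1, forall x,
  (\int[m2]_y f (x, y))%:E = fubini_F m2 (EFin \o f) x}.
Proof.
have := ae_integrable1 imf; apply: filterS => x ix.
by rewrite /Rintegral fineK//; exact: integrable_fin_num.
Qed.

Let ae_snd : {ae m2, forall y,
  (\int[m1]_x f (x, y))%:E = fubini_G m1 (EFin \o f) y}.
Proof.
have := ae_integrable2 imf; apply: filterS => y iy.
by rewrite /Rintegral fineK//; exact: integrable_fin_num.
Qed.

Lemma integrable_Rintegral :
  m1.-integrable setT (fun x => (\int[m2]_y f (x, y))%:E).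
Proof.
have mF : measurable_fun setT (fun x => (\int[m2]_y f (x, y))%:E).
  by apply/measurable_EFinP; exact: measurable_Rintegral.
apply/integrableP; split=> //; apply: le_lt_trans foo.
have mf' : measurable_fun setT (fun z => (`|f z|)%:E).
  by apply/measurable_EFinP; exact: measurableT_comp.
apply: ge0_le_integral => //.
- exact: measurableT_comp.
- have := @measurable_fun_fubini_tonelli_F _ _ X Y R m2 _ mf'.
  by apply => z; rewrite lee_fin.
move=> x _; apply: (abs_Rintegral_le m2 measurableT).
exact: (measurableT_comp mf (measurable_pair1 x)).
Qed.

(** Sections are integrable only almost everywhere; the values of the real integrals at the other
    points affect neither side. *)
Lemma Rintegral_swap :
  \int[m1]_x (\int[m2]_y f (x, y)) = \int[m2]_y (\int[m1]_x f (x, y)).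
Proof.
rewrite /Rintegral; congr fine.
rewrite (ae_eq_integral (fubini_F m2 (EFin \o f)))//.
- rewrite (integral12_prod_meas1 imf) -(integral21_prod_meas1 imf).
  apply/esym/ae_eq_integral => //.
  + apply/measurable_EFinP; exact: (measurable_Rintegral m1 mf2).
  + exact: measurable_fubini_G imf.
  + by apply: filterS ae_snd => x + _ => ->.
- by apply/measurable_EFinP; exact: measurable_Rintegral.
- exact: measurable_fubini_F imf.
- by apply: filterS ae_fst => x + _ => ->.
Qed.

End Rintegral_fubini.

Section Rintegral_change.
Variable R : realType.

(** Writes a real integral with two nonnegative ones, so that changes of variables carry over with
    no integrability assumption. *)
Lemma Rintegral_pos_neg dT (T : measurableType dT) (mu : {measure set T -> \bar R})
    (f : T -> R) : \int[mu]_x f x =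
  fine (\int[mu]_x (Num.max (f x) 0)%:E - \int[mu]_x (Num.max (- f x) 0)%:E)%E.
Proof.
rewrite /Rintegral integralE; congr (fine (_ - _)%E); apply: eq_integral => x _.
  by rewrite funeposE EFin_max.
by rewrite funenegE EFin_max.
Qed.

Lemma Rintegral_signed_shift1 (b : bool) (a : R) (f : measurableTypeR R -> R) :
  measurable_fun setT f ->
  \int[lebesgue_measure]_t f (a + (-1) ^+ b * t) = \int[lebesgue_measure]_t f t.
Proof.
move=> mf; rewrite Rintegral_pos_neg [RHS]Rintegral_pos_neg.
rewrite (ge0_integral_signed_shift1 b a (f := fun t => (Num.max (f t) 0)%:E)).
- rewrite (ge0_integral_signed_shift1 b a (f := fun t => (Num.max (- f t) 0)%:E))//.
  + by apply/measurable_EFinP; apply: measurable_maxr => //; exact: measurableT_comp.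
  + by move=> x; rewrite lee_fin le_max lexx orbT.
- by apply/measurable_EFinP; exact: measurable_maxr.
- by move=> x; rewrite lee_fin le_max lexx orbT.
Qed.

Lemma Rintegral_signed_shift n (b : bool) (a : 'rV[R]_n) (f : 'rV[R]_n -> R) :
  measurable_fun setT f ->
  \int[lebesgue_rV R n]_x f (a + (-1) ^+ b *: x) = \int[lebesgue_rV R n]_x f x.
Proof.
move=> mf; rewrite Rintegral_pos_neg [RHS]Rintegral_pos_neg.
rewrite (ge0_integral_signed_shift b a (f := fun t => (Num.max (f t) 0)%:E)).
- rewrite (ge0_integral_signed_shift b a (f := fun t => (Num.max (- f t) 0)%:E))//.
  + by apply/measurable_EFinP; apply: measurable_maxr => //; exact: measurableT_comp.
  + by move=> x; rewrite lee_fin le_max lexx orbT.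
- by apply/measurable_EFinP; exact: measurable_maxr.
- by move=> x; rewrite lee_fin le_max lexx orbT.
Qed.

Lemma Rintegral_shift n (a : 'rV[R]_n) (f : 'rV[R]_n -> R) : measurable_fun setT f ->
  \int[lebesgue_rV R n]_x f (x + a) = \int[lebesgue_rV R n]_x f x.
Proof.
move=> mf; rewrite -(Rintegral_signed_shift false a mf).
by under [RHS]eq_Rintegral do rewrite scale1r addrC.
Qed.

Lemma Rintegral_reflect n (a : 'rV[R]_n) (f : 'rV[R]_n -> R) : measurable_fun setT f ->
  \int[lebesgue_rV R n]_x f (a - x) = \int[lebesgue_rV R n]_x f x.
Proof.
move=> mf; rewrite -(Rintegral_signed_shift true a mf).
by under [RHS]eq_Rintegral do rewrite scaleN1r.
Qed.

End Rintegral_change.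

(** [f] is extended-valued so as to cover [path_mass]; since its norm is finite, it agrees almost
    everywhere with a real function. The mass and the bound are increased by 1 to be positive, as
    [integral_kernel_le] asks. *)
Lemma integral_kernel_lty dT (T : measurableType dT) (R : realType)
    (mu : {measure set T -> \bar R}) p (k : T -> R) (B : R) (f : T -> \bar R) :
  (1 < p)%E -> measurable_fun setT k -> (forall x, 0 <= k x) -> (forall x, k x <= B) ->
  (\int[mu]_x (k x)%:E < +oo)%E -> measurable_fun setT f -> (forall x, 0 <= f x)%E ->
  ('N[mu]_p[f] < +oo)%E -> (\int[mu]_x ((k x)%:E * f x) < +oo)%E.
Proof.
move=> p1 mk k0 kB koo mf f0 foo; have p0 : (0 < p)%E by rewrite (lt_trans _ p1).
pose A := 1 + fine (\int[mu]_x (k x)%:E).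
have ik0 : (0 <= \int[mu]_x (k x)%:E)%E by apply: integral_ge0 => x _; rewrite lee_fin.
have kA : (\int[mu]_x (k x)%:E <= A%:E)%E.
  by rewrite EFinD fineK ?leeDr// ge0_fin_numE.
have A0 : 0 < A by rewrite ltr_pwDl// fine_ge0.
pose g y := fine (f y); have mg : measurable_fun setT g by exact: measurableT_comp.
have fg : {ae mu, forall y, f y = (g y)%:E}.
  apply: filterS (Lnorm_ae_lty p0 mf foo) => y yoo.
  by rewrite /g fineK// fin_numElt (lt_le_trans _ (f0 y))// -(gee0_abs (f0 y)).
have g0 y : 0 <= g y by rewrite fine_ge0.
rewrite (ae_eq_integral (fun y => (k y * `|g y|)%:E))//.
- have B0 : 0 < 1 + `|B| by rewrite ltr_pwDl.
  apply: le_lt_trans (integral_kernel_le p1 A0 B0 mk mg k0 _ kA) _.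
  + by move=> y; rewrite (le_trans (kB y))// (le_trans (ler_norm _))// lerDr.
  + rewrite lte_mul_pinfty ?lee_fin ?mulr_ge0 ?powR_ge0//.
    rewrite (_ : 'N[mu]_p[EFin \o g] = 'N[mu]_p[f])%E//.
    apply: ae_eq_Lnorm => //; first exact/measurable_EFinP.
    by apply: filterS fg => y /= ->.
- by apply: emeasurable_funM => //; exact/measurable_EFinP.
- by apply/measurable_EFinP; apply: measurable_funM => //; exact: measurableT_comp.
- by apply: filterS fg => y -> _; rewrite ger0_norm// EFinM.
Qed.

Section heat_semigroup.
Variables (R : realType) (d : nat) (p : \bar R).
Hypothesis p1 : (1 < p)%E.
Local Notation V := 'rV[R]_d.
Local Notation mu := (lebesgue_rV R d).
Implicit Types (f : V -> R) (v w : V -> V) (x y : V) (t s : R).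

Let p0 : (0 < p)%E. Proof. by rewrite (lt_trans _ p1). Qed.

Lemma measurable_heat_kernel_sub t x :
  measurable_fun setT (fun y : V => heat_kernel t (x - y)).
Proof. by apply: measurable_comp_sub; exact: measurable_heat_kernel. Qed.

Lemma measurable_heat_kernel_subr t z :
  measurable_fun setT (fun y : V => heat_kernel t (y - z)).
Proof.
by apply: (measurable_comp_add (f := heat_kernel t)); exact: measurable_heat_kernel.
Qed.

Lemma measurable_heat_kernel_sub2 t :
  measurable_fun setT (fun z : V * V => heat_kernel t (z.1 - z.2)).
Proof. exact: (measurableT_comp (measurable_heat_kernel t) (@measurable_rV_sub R d)). Qed.

Lemma integral_heat_kernel_sub t x : 0 < t ->
  (\int[mu]_y (heat_kernel t (x - y))%:E = 1)%E.
Proof.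
move=> t0; rewrite (ge0_integral_reflect x (f := fun z => (heat_kernel t z)%:E)).
- exact: integral_heat_kernel.
- by apply/measurable_EFinP; exact: measurable_heat_kernel.
- by move=> z; rewrite lee_fin heat_kernel_ge0.
Qed.

Lemma integral_heat_kernel_subr t y : 0 < t ->
  (\int[mu]_x (heat_kernel t (x - y))%:E = 1)%E.
Proof.
by move=> t0; under eq_integral do rewrite heat_kernel_sub; exact: integral_heat_kernel_sub.
Qed.

Lemma heat_kernel_bounded t : 0 < t -> exists2 B, 0 < B & forall x : V, heat_kernel t x <= B.
Proof.
move=> t0; exists (sup_const R d * t `^ (- (d%:R / 2))).
  by rewrite mulr_gt0 ?powR_gt0// sup_const_gt0.
by move=> x; exact: heat_kernel_sup.
Qed.

Lemma integral_heat_lty t x (f : V -> \bar R) : 0 < t -> measurable_fun setT f ->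
  (forall y, 0 <= f y)%E -> ('N[mu]_p[f] < +oo)%E ->
  (\int[mu]_y ((heat_kernel t (x - y))%:E * f y) < +oo)%E.
Proof.
move=> t0 mf f0 foo; have [B B0 GB] := heat_kernel_bounded t0.
apply: (integral_kernel_lty p1 (measurable_heat_kernel_sub t x)) foo => //.
- by move=> y; exact: heat_kernel_ge0.
- by rewrite integral_heat_kernel_sub// ltry.
Qed.

Lemma integrable_heat t x f : 0 < t -> measurable_fun setT f ->
  ('N[mu]_p[EFin \o f] < +oo)%E ->
  mu.-integrable setT (fun y => (heat_kernel t (x - y) * f y)%:E).
Proof.
move=> t0 mf foo.
apply: (@le_integrable_lty _ _ _ _ _ _ (fun y => heat_kernel t (x - y) * `|f y|)) => //.
- by apply: measurable_funM => //; exact: measurable_heat_kernel_sub.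
- by apply: measurable_funM; [exact: measurable_heat_kernel_sub|exact: measurableT_comp].
- by move=> y _; rewrite normrM (ger0_norm (heat_kernel_ge0 _ _)).
- have := @integral_heat_lty t x (fun y => (`|f y|)%:E) t0.
  under [in X in _ -> _ -> _ -> X]eq_integral do rewrite -EFinM; apply => //.
  + by apply/measurable_EFinP; exact: measurableT_comp.
  + by move: foo; rewrite -Lnorm_abse.
Qed.

Lemma Lnorm_coord_lty v i : in_Lp p v ->
  ('N[mu]_p[EFin \o (fun y => v y ord0 i)] < +oo)%E.
Proof.
move=> [mv voo]; apply: le_lt_trans voo; rewrite Lpnorm_setT; apply: le_Lnorm => //.
- by apply/measurable_EFinP; exact: (measurable_fun_rVP _).1.
- by apply/measurable_EFinP; exact: measurable_enorm_comp.
by apply: aeW => x; rewrite /= lee_fin (ger0_norm (enorm_ge0 _)) coord_le_enorm.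
Qed.

Lemma integrable_heat_coord t x v i : 0 < t -> in_Lp p v ->
  mu.-integrable setT (fun y => (heat_kernel t (x - y) * v y ord0 i)%:E).
Proof.
move=> t0 Lv; apply: integrable_heat => //; first exact: (measurable_fun_rVP _).1 Lv.1 i.
exact: Lnorm_coord_lty.
Qed.

Lemma heatB t v w x : 0 < t -> in_Lp p v -> in_Lp p w ->
  heat t (fun y => v y - w y) x = heat t v x - heat t w x.
Proof.
move=> t0 Lv Lw; apply/rowP => i; rewrite !mxE.
rewrite -RintegralB//; try exact: integrable_heat_coord.
by apply: eq_Rintegral => y _; rewrite !mxE mulrBr.
Qed.

Lemma ae_eq_heat t v w x : measurable_fun setT v -> measurable_fun setT w ->
  {ae mu, forall y, v y = w y} -> heat t v x = heat t w x.
Proof.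
move=> mv mw vw; apply/rowP => i; rewrite !mxE /Rintegral; congr fine.
apply: ae_eq_integral => //.
- apply/measurable_EFinP; apply: measurable_funM; first exact: measurable_heat_kernel_sub.
  exact: (measurable_fun_rVP _).1.
- apply/measurable_EFinP; apply: measurable_funM; first exact: measurable_heat_kernel_sub.
  exact: (measurable_fun_rVP _).1.
by apply: filterS vw => y + _ => ->.
Qed.

Lemma measurable_heat t v : measurable_fun setT v -> measurable_fun setT (heat t v).
Proof.
move=> mv; apply/measurable_fun_rVP => i; under eq_fun do rewrite mxE.
apply: (measurable_Rintegral mu (h := fun z : V * V => heat_kernel t (z.1 - z.2) * v z.2 ord0 i)).
apply: measurable_funM; first exact: measurable_heat_kernel_sub2.
exact: (measurableT_comp ((measurable_fun_rVP _).1 mv i) measurable_snd).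
Qed.

Lemma heat_kernel_conv_sub t s x z : 0 < t -> 0 < s ->
  (\int[mu]_y (heat_kernel t (x - y) * heat_kernel s (y - z))%:E =
   (heat_kernel (t + s) (x - z))%:E)%E.
Proof.
move=> t0 s0; rewrite -(heat_kernel_conv (x - z) t0 s0).
rewrite -[RHS](ge0_integral_shift (- z)); last 2 first.
- apply/measurable_EFinP; apply: measurable_funM; first exact: measurable_heat_kernel_sub.
  exact: measurable_heat_kernel.
- by move=> y; rewrite lee_fin mulr_ge0// heat_kernel_ge0.
apply: eq_integral => y _.
by rewrite (_ : x - y = x - z - (y - z))// opprB addrA subrK.
Qed.

(** Fubini and the convolution law. The absolute double integral is computed exactly: it is the heat
    integral of [|v_i|] at time [t + s]. *)
Lemma heat_semigroup t s v x : 0 < t -> 0 < s -> in_Lp p v ->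
  heat t (heat s v) x = heat (t + s) v x.
Proof.
move=> t0 s0 Lv; have [mv _] := Lv; apply/rowP => i; rewrite !mxE.
have mvi : measurable_fun setT (fun y => v y ord0 i) by exact: (measurable_fun_rVP _).1.
pose f (z : V * V) := heat_kernel t (x - z.1) * (heat_kernel s (z.1 - z.2) * v z.2 ord0 i).
have mf : measurable_fun setT f.
  apply: measurable_funM.
    exact: (measurableT_comp (measurable_heat_kernel_sub t x) measurable_fst).
  apply: measurable_funM; first exact: measurable_heat_kernel_sub2.
  exact: (measurableT_comp mvi measurable_snd).
have mabsf : measurable_fun setT (fun z => (`|f z|)%:E).
  by apply/measurable_EFinP; exact: measurableT_comp.
have inner z : (\int[mu]_y (`|f (y, z)|)%:E = (heat_kernel (t + s) (x - z) * `|v z ord0 i|)%:E)%E.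
  rewrite EFinM -heat_kernel_conv_sub// -ge0_integralZr//.
  - apply: eq_integral => y _; rewrite /f/= normrM (normrM (heat_kernel s _)).
    by rewrite !(ger0_norm (heat_kernel_ge0 _ _)) -EFinM mulrA.
  - apply/measurable_EFinP; apply: measurable_funM; first exact: measurable_heat_kernel_sub.
    exact: measurable_heat_kernel_subr.
  - by move=> y _; rewrite lee_fin mulr_ge0// heat_kernel_ge0.
transitivity (\int[mu]_y (\int[mu]_z f (y, z))).
  apply: eq_Rintegral => y _; rewrite mxE -RintegralZl//.
  exact: integrable_heat_coord.
rewrite (Rintegral_swap (m1 := mu) (m2 := mu) mf); last first.
  rewrite (fubini_tonelli (fun z => (`|f z|)%:E))//=.
  under eq_integral do rewrite inner.
  have /integrableP[_] := integrable_heat_coord x i (addr_gt0 t0 s0) Lv.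
  apply: le_lt_trans; rewrite le_eqVlt; apply/orP; left; apply/eqP/eq_integral => y _.
  by rewrite abse_EFin normrM (ger0_norm (heat_kernel_ge0 _ _)).
apply: eq_Rintegral => z _; rewrite /f/=.
under eq_Rintegral do rewrite mulrA.
rewrite RintegralZr//.
  by congr (_ * _); rewrite /Rintegral heat_kernel_conv_sub.
have mGG : measurable_fun setT (fun y => heat_kernel t (x - y) * heat_kernel s (y - z)).
  by apply: measurable_funM; [exact: measurable_heat_kernel_sub|exact: measurable_heat_kernel_subr].
apply: (le_integrable_lty measurableT mGG mGG).
  by move=> y _; rewrite (ger0_norm (mulr_ge0 (heat_kernel_ge0 _ _) (heat_kernel_ge0 _ _))).
by rewrite heat_kernel_conv_sub// ltry.
Qed.

End heat_semigroup.

(** * Splitting the Duhamel integral *)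

Lemma ae_eq_Rintegral dT (T : measurableType dT) (R : realType)
    (mu : {measure set T -> \bar R}) (f g : T -> R) : measurable_fun setT f ->
  measurable_fun setT g -> {ae mu, forall x, f x = g x} ->
  \int[mu]_x f x = \int[mu]_x g x.
Proof.
move=> mf mg fg; rewrite /Rintegral; congr fine; apply: ae_eq_integral => //.
- exact/measurable_EFinP.
- exact/measurable_EFinP.
by apply: filterS fg => x /= -> _.
Qed.

(** The second summand comes translated, as the later part of a Duhamel integral does once its time
    starts again at 0. *)
Lemma RintegralD_shift (R : realType) (a : R) (f g : measurableTypeR R -> R) :
  lebesgue_measure.-integrable setT (EFin \o f) ->
  lebesgue_measure.-integrable setT (EFin \o (fun s => g (a + s))) ->
  measurable_fun setT g ->
  \int[lebesgue_measure]_s (f s + g (a + s)) =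
  \int[lebesgue_measure]_s f s + \int[lebesgue_measure]_s g s.
Proof.
move=> fi gi mg; rewrite RintegralD//; congr (_ + _).
rewrite -(Rintegral_signed_shift1 false a mg).
by apply: eq_Rintegral => s _; rewrite expr0 mul1r.
Qed.

Section duhamel_splitting.
Variables (R : realType) (d : nat) (p : \bar R).
Hypotheses (d3 : (3 <= d)%N) (hp : (d%:R%:E < p)%E).
Local Notation V := 'rV[R]_d.
Local Notation T := (measurableTypeR R).
Local Notation mu := (lebesgue_rV R d).
Implicit Types (v : V -> V) (u : R -> V -> V) (a t s tau M : R) (x y : V).

Let p1 : (1 < p)%E := exponent_gt1 d3 hp.
Let p2 : (2%:E < p)%E := exponent_gt2 d3 hp.

Lemma heat_convolution_leray_sub tau t k i j x z : 0 < tau -> 0 < t ->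
  \int[mu]_y (heat_kernel tau (x - y) * leray_d1 k i j t (y - z)) =
  leray_d1 k i j (tau + t) (x - z).
Proof.
move=> tau0 t0; rewrite -(heat_convolution_leray d3 k i j (x - z) t0 tau0).
rewrite -[RHS](Rintegral_reflect x).
  apply: eq_Rintegral => y _; rewrite (_ : x - z - (x - y) = y - z)//.
  by apply/rowP => l; rewrite !mxE; ring.
apply: measurable_funM; first exact: measurable_heat_kernel.
by apply: measurable_comp_sub; exact: measurable_leray_d1_at.
Qed.

Lemma leray_formE t v x i : leray_form t v x ord0 i = \sum_j \sum_k
  \int[mu]_y (leray_d1 k i j t (x - y) * (v y ord0 j * v y ord0 k)).
Proof. by rewrite mxE. Qed.

Lemma Lp_path_shift a t M u : 0 < a -> Lp_path p (a + t) M u ->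
  Lp_path p t M (fun s => u (a + s)).
Proof.
move=> a0 Lu s /andP[s0 st].
have [|Ls sM cs] := Lu (a + s); first by rewrite addr_gt0//= ltrD2l.
split=> //; apply: cvg_comp cs.
by apply: cvgD; [exact: cvg_cst|exact: cvg_id].
Qed.

Lemma Lp_path_le a t M u : a <= t -> Lp_path p t M u -> Lp_path p a M u.
Proof. by move=> a_t Lu s /andP[s0 sa]; apply: Lu; rewrite s0 (lt_le_trans sa). Qed.

Lemma leray_path_at u t s x : 0 < s < t ->
  leray_path u t (s, x) = leray_form (t - s) (u s) x.
Proof. by rewrite /leray_path/= => ->. Qed.

Lemma leray_path_out u t s x : ~~ (0 < s < t) -> leray_path u t (s, x) = 0.
Proof. by rewrite /leray_path/= => /negbTE ->. Qed.

Section pairing.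
Variable kappa : V -> R.
Hypotheses (mkappa : measurable_fun setT kappa)
  (ikappa : mu.-integrable setT (EFin \o kappa)).

Let kappaoo : (\int[mu]_y (`|kappa y|)%:E < +oo)%E.
Proof. by have /integrableP[] := ikappa. Qed.

(* [kappa] is a translated heat kernel in the semigroup property and a derivative of a
   test function in the divergence-free condition. *)
Lemma pairing_leray_form t v i : 0 < t -> in_Lp p v ->
  let h j k z := (\int[mu]_y (kappa y * leray_d1 k i j t (y - z))) *
    (v z ord0 j * v z ord0 k) in
  (forall j k, mu.-integrable setT (EFin \o h j k)) /\
  \int[mu]_y (kappa y * leray_form t v y ord0 i) = \sum_j \sum_k \int[mu]_z h j k z.
Proof.
move=> t0 Lv h; have [mv voo] := Lv.
have [C C0 densC] := leray_density_sup d3 hp t0.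
pose F j k z := v z ord0 j * v z ord0 k.
have mF j k : measurable_fun setT (F j k) by exact: measurable_coord_mul.
pose f j k (w : V * V) := kappa w.1 * (leray_d1 k i j t (w.1 - w.2) * F j k w.2).
have mf j k : measurable_fun setT (f j k).
  apply: measurable_funM; first exact: (measurableT_comp mkappa measurable_fst).
  apply: measurable_funM.
    exact: (measurableT_comp (measurable_leray_d1_at k i j t) (@measurable_rV_sub R d)).
  exact: (measurableT_comp (mF j k) measurable_snd).
have iq j k y : mu.-integrable setT (fun z => (leray_d1 k i j t (y - z) * F j k z)%:E).
  apply: (integrable_quad p2 (leray_mass_gt0 d t0) (leray_sup_gt0 d t0)) => //.
  - exact: measurable_leray_d1_sub.
  - by move=> z; exact: leray_d1_le.
  - exact: integral_leray_d1_sub_le.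
have mdens y : measurable_fun setT (fun z : V => leray_abs t (y - z) * enorm (v z) ^+ 2).
  apply: measurable_funM; first exact: measurable_leray_abs_sub.
  by apply: measurable_funX; exact: measurable_enorm_comp.
(* The majorant depends on [y] only through [|kappa y|], so the integrability of [kappa] suffices
   for Fubini. *)
have inner j k y : (\int[mu]_z (`|f j k (y, z)|)%:E <=
    (`|kappa y|)%:E * (C%:E * Lpnorm p setT v `^ 2))%E.
  apply: (@le_trans _ _ ((`|kappa y|)%:E * leray_density t v y)%E); last first.
    by apply: lee_wpmul2l => //; exact: densC.
  rewrite /leray_density -ge0_integralZl//; last 2 first.
  - exact/measurable_EFinP.
  - by move=> z _; rewrite lee_fin mulr_ge0 ?leray_abs_ge0 ?sqr_ge0.
  apply: ge0_le_integral => //.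
  - apply/measurable_EFinP; apply: measurableT_comp => //.
    exact: (measurableT_comp (mf j k) (measurable_pair1 y)).
  - by apply: emeasurable_funM => //; exact/measurable_EFinP.
  move=> z _; rewrite -EFinM lee_fin /f/= normrM; apply: ler_wpM2l => //.
  rewrite normrM; apply: ler_pM => //.
    rewrite /leray_abs (bigD1 (i, j, k))//= lerDl; exact: sumr_ge0.
  by rewrite normrM expr2; apply: ler_pM => //; exact: coord_le_enorm.
have ffin j k : (\int[mu]_y \int[mu]_z (`|f j k (y, z)|)%:E < +oo)%E.
  apply: (@le_lt_trans _ _ (\int[mu]_y ((`|kappa y|)%:E * (C%:E * Lpnorm p setT v `^ 2)))%E).
    apply: ge0_le_integral => //.
    - by move=> y _; exact: integral_ge0.
    - have mabs : measurable_fun setT (fun w => (`|f j k w|)%:E).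
        by apply/measurable_EFinP; exact: measurableT_comp.
      have := @measurable_fun_fubini_tonelli_F _ _ V V R mu _ mabs.
      by apply => w; rewrite lee_fin.
    - by apply: emeasurable_funM => //; apply/measurable_EFinP; exact: measurableT_comp.
  rewrite ge0_integralZr//.
  - rewrite lte_mul_pinfty// ?integral_ge0//; first by rewrite ge0_fin_numE// integral_ge0.
    by rewrite lte_mul_pinfty ?lee_fin ?(ltW C0)// poweR_lty.
  - by apply/measurable_EFinP; exact: measurableT_comp.
  - by rewrite mule_ge0 ?lee_fin ?(ltW C0) ?poweR_ge0.
have fE j k y : \int[mu]_z f j k (y, z) =
    kappa y * \int[mu]_z (leray_d1 k i j t (y - z) * F j k z).
  by rewrite /f/= (RintegralZl _ measurableT (iq j k y)).
have hE j k z : h j k z = \int[mu]_y f j k (y, z).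
  rewrite /h /f/=; under [RHS]eq_Rintegral do rewrite mulrA.
  rewrite RintegralZr//; apply: (integrable_mul_bounded (M := leray_sup d t)) => //.
  - by apply: (measurable_comp_add (f := leray_d1 k i j t)); exact: measurable_leray_d1_at.
  - by move=> y; exact: leray_d1_le.
split=> [j k|].
  rewrite (_ : EFin \o h j k = fun z => (\int[mu]_y f j k (y, z))%:E); last first.
    by apply/funext => z /=; rewrite hE.
  have msw : measurable_fun setT (fun w : V * V => (w.2, w.1)).
    by apply: measurable_fun_pair; [exact: measurable_snd|exact: measurable_fst].
  apply: (integrable_Rintegral (m1 := mu) (m2 := mu) (f := fun w => f j k (w.2, w.1))).
    exact: (measurableT_comp (mf j k) msw).
  rewrite -(fubini_tonelli (fun w => (`|f j k w|)%:E))//.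
  by apply/measurable_EFinP; exact: measurableT_comp.
transitivity (\int[mu]_y (\sum_j \sum_k \int[mu]_z f j k (y, z))).
  apply: eq_Rintegral => y _; rewrite leray_formE mulr_sumr; apply: eq_bigr => j _.
  by rewrite mulr_sumr; apply: eq_bigr => k _; rewrite fE.
have ifjk j k : mu.-integrable setT (fun y => (\int[mu]_z f j k (y, z))%:E).
  exact: integrable_Rintegral.
rewrite Rintegral_sum//; last first.
  move=> j; under eq_fun do rewrite -sumEFin.
  by apply: integrable_sum => // k _; exact: ifjk.
apply: eq_bigr => j _; rewrite Rintegral_sum//; apply: eq_bigr => k _.
rewrite (Rintegral_swap (m1 := mu) (m2 := mu) (mf j k) (ffin j k)).
by apply: eq_Rintegral => z _; rewrite hE.
Qed.

Variable B : R.
Hypothesis kappaB : forall y, `|kappa y| <= B.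

(** The bound in [leray_density_sup] need not be integrable in time. Hence [kappa] is paired with
    [path_mass], known only to be in [L^p], and for this it has to be bounded as well as
    integrable. *)
Lemma pairing_duhamel a M u i : 0 < a -> 0 < M -> Lp_path p a M u ->
  let h (s : T) := if 0 < s < a
    then \int[mu]_y (kappa y * leray_form (a - s) (u s) y ord0 i) else 0 in
  lebesgue_measure.-integrable setT (EFin \o h) /\
  \int[mu]_y (kappa y * duhamel u a y ord0 i) = \int[lebesgue_measure]_s h s.
Proof.
move=> a0 M0 Lu h.
have mpath := measurable_leray_path d3 hp i Lu.
pose f (z : V * T) := kappa z.1 * leray_path u a (z.2, z.1) ord0 i.
pose f' (z : T * V) := kappa z.2 * leray_path u a z ord0 i.
have msw : measurable_fun setT (fun z : V * T => (z.2, z.1)).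
  by apply: measurable_fun_pair; [exact: measurable_snd|exact: measurable_fst].
have mf : measurable_fun setT f.
  apply: measurable_funM; first exact: (measurableT_comp mkappa measurable_fst).
  exact: (measurableT_comp mpath msw).
have mf' : measurable_fun setT f'.
  by apply: measurable_funM => //; exact: (measurableT_comp mkappa measurable_snd).
have mabs : measurable_fun setT (fun w => (`|f w|)%:E).
  by apply/measurable_EFinP; exact: measurableT_comp.
have mpm := measurable_path_mass d3 hp Lu.
have ffin : (\int[mu]_y \int[lebesgue_measure]_s (`|f (y, s)|)%:E < +oo)%E.
  have mk : measurable_fun setT (fun y => `|kappa y|) by exact: measurableT_comp.
  apply: le_lt_trans (integral_kernel_lty p1 mk _ kappaB kappaoo mpm (path_mass_ge0 u a)
    (le_lt_trans (Lnorm_path_mass d3 hp a0 M0 Lu) (ltry _))) => //.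
  apply: ge0_le_integral => //.
  - by move=> y _; exact: integral_ge0.
  - have := @measurable_fun_fubini_tonelli_F _ _ V T R (@lebesgue_measure R) _ mabs.
    by apply => w; rewrite lee_fin.
  - by apply: emeasurable_funM => //; exact/measurable_EFinP.
  move=> y _; have mps := measurable_path_sum d3 hp Lu.
  have mpsy : measurable_fun setT (fun s : T => path_sum u a (s, y)).
    exact: (measurableT_comp mps (measurable_pair2 y)).
  rewrite /path_mass -ge0_integralZl//; last 2 first.
  - exact/measurable_EFinP.
  - by move=> s _; rewrite lee_fin path_sum_ge0.
  apply: ge0_le_integral => //.
  - exact: (measurableT_comp mabs (measurable_pair1 y)).
  - by apply: emeasurable_funM => //; exact/measurable_EFinP.
  move=> s _; rewrite -EFinM lee_fin /f/= normrM; apply: ler_wpM2l => //.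
  by rewrite /path_sum (bigD1 i)//= lerDl sumr_ge0.
have hE s : h s = \int[mu]_y f' (s, y).
  rewrite /h /f'/=; case: ifPn => [sa|nsa].
    by under [RHS]eq_Rintegral do rewrite leray_path_at//.
  under [RHS]eq_Rintegral do rewrite leray_path_out// mxE mulr0.
  by rewrite Rintegral_cst//= mul0r.
split.
  rewrite (_ : EFin \o h = fun s => (\int[mu]_y f' (s, y))%:E); last first.
    by apply/funext => s /=; rewrite hE.
  apply: integrable_Rintegral => //.
  by rewrite -(fubini_tonelli (fun z => (`|f z|)%:E)).
transitivity (\int[mu]_y (\int[lebesgue_measure]_s f (y, s))).
  apply: ae_eq_Rintegral.
  - apply: measurable_funM => //.
    exact: (measurable_fun_rVP _).1 (measurable_duhamel d3 hp Lu) i.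
  - exact: measurable_Rintegral.
  apply: filterS (ae_integrable_leray_path d3 hp a0 M0 Lu) => y iy.
  by rewrite (duhamelE d3) /f/= (RintegralZl _ measurableT (iy i)).
rewrite (Rintegral_swap (m1 := mu) (m2 := @lebesgue_measure R) mf ffin).
by apply: eq_Rintegral => s _; rewrite hE.
Qed.

End pairing.

Lemma integrable_heat_kernel_sub tau x : 0 < tau ->
  mu.-integrable setT (EFin \o (fun y => heat_kernel tau (x - y))).
Proof.
move=> tau0; have mG := measurable_heat_kernel_sub tau x.
apply: (le_integrable_lty measurableT mG mG).
  by move=> y _; rewrite (ger0_norm (heat_kernel_ge0 _ _)).
by rewrite integral_heat_kernel_sub// ltry.
Qed.

Lemma heat_leray_form tau t v x i : 0 < tau -> 0 < t -> in_Lp p v ->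
  \int[mu]_y (heat_kernel tau (x - y) * leray_form t v y ord0 i) =
  leray_form (tau + t) v x ord0 i.
Proof.
move=> tau0 t0 Lv.
have [_ ->] := pairing_leray_form (measurable_heat_kernel_sub tau x)
  (integrable_heat_kernel_sub x tau0) i t0 Lv; rewrite leray_formE.
apply: eq_bigr => j _; apply: eq_bigr => k _; apply: eq_Rintegral => z _.
by rewrite heat_convolution_leray_sub.
Qed.

(** The heat flow passes under the time integral and adds [tau] to the time of each kernel. *)
Lemma heat_duhamel a tau M u x i : 0 < a -> 0 < tau -> 0 < M -> Lp_path p a M u ->
  heat tau (duhamel u a) x ord0 i =
  \int[lebesgue_measure]_s (if 0 < s < a
    then leray_form (tau + a - s) (u s) x ord0 i else 0).
Proof.
move=> a0 tau0 M0 Lu; rewrite mxE; have [B B0 GB] := heat_kernel_bounded d tau0.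
have GB' y : `|heat_kernel tau (x - y)| <= B by rewrite (ger0_norm (heat_kernel_ge0 _ _)).
have [_ ->] := pairing_duhamel (measurable_heat_kernel_sub tau x)
  (integrable_heat_kernel_sub x tau0) GB' i a0 M0 Lu.
apply: eq_Rintegral => s _; case: ifPn => // sa.
have /andP[s0 s_a] := sa; have [Ls _ _] := Lu s sa.
by rewrite -addrA; apply: heat_leray_form => //; rewrite subr_gt0.
Qed.

(** The time integral is cut at [a]. For [s < a] the kernel at time [a + tau - s] is the heat flow
    of the one at [a - s]; for [s > a] a shift of time leaves a Duhamel term of length [tau]. *)
Lemma duhamel_split a tau M u : 0 < a -> 0 < tau -> 0 < M -> Lp_path p (a + tau) M u ->
  {ae mu, forall x, duhamel u (a + tau) x =
    heat tau (duhamel u a) x + duhamel (fun s => u (a + s)) tau x}.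
Proof.
move=> a0 tau0 M0 Lu.
have at0 : 0 < a + tau by rewrite addr_gt0.
have La : Lp_path p a M u by apply: Lp_path_le Lu; rewrite lerDl ltW.
have Ls := Lp_path_shift a0 Lu.
apply: filterS (ae_integrable_leray_path d3 hp at0 M0 Lu) => x ix.
have rD (y z : V) i : (y + z) ord0 i = y ord0 i + z ord0 i by rewrite mxE.
suff E i : \int[lebesgue_measure]_s leray_path u (a + tau) (s, x) ord0 i =
    \int[lebesgue_measure]_s (if 0 < s < a
      then leray_form (tau + a - s) (u s) x ord0 i else 0) +
    \int[lebesgue_measure]_s leray_path (fun s => u (a + s)) tau (s, x) ord0 i.
  apply/rowP => i; rewrite rD; apply: etrans (duhamelE d3 _ _ _ _) _.
  apply: etrans (E i) _; apply: esym; apply: (f_equal2 +%R).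
    exact: heat_duhamel La.
  exact: duhamelE.
pose f (s : T) := leray_path u (a + tau) (s, x) ord0 i.
pose f1 (s : T) := if 0 < s < a then leray_form (tau + a - s) (u s) x ord0 i else 0.
pose f2 (s : T) := leray_path (fun s => u (a + s)) tau (s, x) ord0 i.
have mf : measurable_fun setT f by exact: (measurable_leray_path_at d3 hp i x Lu).
have mf2 : measurable_fun setT f2 by exact: (measurable_leray_path_at d3 hp i x Ls).
have mI (D : set T) : measurable D -> measurable_fun setT (\1_D : T -> R).
  by move=> mD; exact: measurable_indic.
have ei : a + tau = tau + a by rewrite addrC.
(* The cut is made by an indicator on the whole line; at times [s <= 0] both sides vanish. *)
have f1E : f1 = fun s => f s * \1_(`]-oo, a[%classic : set T) s.
  apply/funext => s; rewrite /f1 /f indicE mem_setE in_itv/=.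
  case: (ltP s a) => sa; rewrite ?andbF ?mulr0// andbT mulr1.
  case: ifPn => [s0|s0]; first by rewrite leray_path_at ?ei// s0 -ei (lt_trans sa)// ltrDl.
  by rewrite leray_path_out ?mxE// negb_and s0.
have shiftE s : f2 (- a + s) = f s * \1_(`]a, +oo[%classic : set T) s.
  rewrite /f2 /f indicE mem_setE in_itv/= andbT.
  case: (ltP a s) => sa; rewrite ?mulr0 ?mulr1.
    have h0 : 0 < - a + s by rewrite addrC subr_gt0.
    have h1 : (- a + s < tau) = (s < a + tau) by rewrite addrC ltrBlDl.
    have s0 : 0 < s by rewrite (lt_trans a0).
    have [sat|sat] := boolP (s < a + tau).
      rewrite !leray_path_at ?h0 ?h1 ?s0// addrA subrr add0r opprD opprK.
      by rewrite addrA [tau + a]addrC.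
    by rewrite !leray_path_out ?h0 ?h1 ?s0.
  by rewrite leray_path_out ?mxE// negb_and -leNgt addrC subr_le0 sa.
have if_ := ix i.
have idx (D : set T) : measurable D ->
    lebesgue_measure.-integrable setT (fun s : T => (f s * \1_D s)%:E).
  move=> mD; have mfD : measurable_fun setT (fun s : T => f s * \1_D s : R).
    by apply: measurable_funM => //; exact: mI.
  have mfa : measurable_fun setT (fun s : T => `|f s|) by exact: measurableT_comp.
  apply: (le_integrable_lty measurableT mfD mfa).
    by move=> s _; rewrite normrM ler_piMr// indicE; case: (_ \in _); rewrite ?normr0 ?normr1.
  by have /integrableP[] := if_.
rewrite -/f1 -/f2 -/f.
transitivity (\int[lebesgue_measure]_s (f1 s + f2 (- a + s))).
  apply: ae_eq_Rintegral => //.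
    under eq_fun do rewrite shiftE f1E.
    by apply: measurable_funD; apply: measurable_funM => //; apply: mI; exact: measurable_itv.
  (* Both halves are cut off strictly, so their sum misses the integrand only on the null set
     [s = a]. *)
  exists [set a]; split; [exact: measurable_set1|exact: lebesgue_measure_set1|].
  move=> s /= h; apply: contrapT => /eqP sa; apply: h.
  rewrite f1E shiftE !indicE !mem_setE !in_itv/= andbT.
  by case: (ltgtP s a) sa => // _ _; rewrite ?mulr1 ?mulr0 ?addr0 ?add0r.
have i1 : lebesgue_measure.-integrable setT (EFin \o f1).
  by rewrite f1E; apply: idx; exact: measurable_itv.
have i2 : lebesgue_measure.-integrable setT (EFin \o (fun s : T => f2 (- a + s))).
  rewrite (_ : EFin \o _ = fun s => (f s * \1_(`]a, +oo[%classic : set T) s)%:E).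
    by apply: idx; exact: measurable_itv.
  by apply/funext => s /=; rewrite shiftE.
exact: (RintegralD_shift i1 i2 mf2).
Qed.

End duhamel_splitting.

(** * Divergence-free fields *)

Lemma Rintegral_eq0 dT (T : measurableType dT) (R : realType)
    (mu : {measure set T -> \bar R}) (f : T -> R) :
  (forall x, f x = 0) -> \int[mu]_x f x = 0.
Proof.
by move=> f0; under eq_Rintegral do rewrite f0; rewrite /Rintegral integral0.
Qed.

Section test_functions.
Variables (R : realType) (d : nat).
Local Notation V := 'rV[R]_d.
Local Notation mu := (lebesgue_rV R d).
Implicit Types (phi psi L : V -> R) (x y : V).

(** The properties that a test function shares with its partial derivatives and that suffice for the
    pairings. *)
Definition bump psi := (forall x, {for x, continuous psi}) /\
  exists2 K, compact K & forall x, psi x != 0 -> K x.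

Lemma test_function_derivable i phi x : test_function phi ->
  is_derive x (delta_mx ord0 i) phi (partial i phi x).
Proof.
by move=> [dphi _]; split => //; apply: diff_derivable; exact: (dphi [::] x).
Qed.

Lemma test_function_bump phi : test_function phi -> bump phi.
Proof.
move=> [dphi cphi]; split.
  by move=> x; apply: differentiable_continuous; exact: (dphi [::] x).
by exists (closure [set x | phi x != 0]) => // x xphi; exact: subset_closure.
Qed.

Lemma partial_bump i phi : test_function phi -> bump (partial i phi).
Proof.
move=> tphi; have [dphi cphi] := tphi; split.
  by move=> x; apply: differentiable_continuous; exact: (dphi [:: i] x).
exists (closure [set x | phi x != 0]) => // x; apply: contra_neqP => nKx.
have [_ <-] := test_function_derivable i x tphi.
have : \forall y \near x, phi y = 0.
  have : open (~` closure [set x | phi x != 0]) by apply: closed_openC; exact: closed_closure.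
  rewrite openE => /(_ x nKx); apply: filterS => y nKy.
  apply/eqP/negP => /negP yn0; apply: nKy; exact: subset_closure.
move=> phi0; rewrite (near_eq_derive (g := cst 0) _ phi0).
by rewrite derive_cst.
Qed.

Lemma bump_bounded psi : bump psi -> exists M, forall x, `|psi x| <= M.
Proof.
move=> [cpsi [K cK Kpsi]].
have : compact (psi @` K).
  by apply: continuous_compact => //; apply: continuous_subspaceT => x; exact: cpsi.
move=> /compact_bounded/pinfty_ex_gt0[M M0 psiM]; exists M => x.
have [->|/Kpsi Kx] := eqVneq (psi x) 0; first by rewrite normr0 ltW.
by apply: psiM; exists x.
Qed.

Lemma rV_coord_le_norm x i : `|x ord0 i| <= `|x|.
Proof.
rewrite [leRHS]/Num.norm/= mx_normrE.
exact: (le_bigmax _ (fun ij : 'I_1 * 'I_d => `|x ij.1 ij.2|) (ord0, i)).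
Qed.

(** A cube rather than a ball, because [lebesgue_rV_box] gives its measure. *)
Definition cube (r : R) : set V := [set x | forall i, `[- r, r]%classic (x ord0 i)].

Lemma cubeP r x : cube r x <-> forall i, `|x ord0 i| <= r.
Proof.
by split=> h i; move: (h i); rewrite /= in_itv/= ler_norml.
Qed.

Lemma measurable_cube r : measurable (cube r).
Proof. by apply: (@measurable_box R d (fun=> `[- r, r]%classic)) => i; exact: measurable_itv. Qed.

Lemma cube_lty r : (mu (cube r) < +oo)%E.
Proof.
rewrite /cube (@lebesgue_rV_box R d (fun=> `[- r, r]%classic)); last first.
  by move=> i; exact: measurable_itv.
rewrite -ge0_fin_numE; last by apply: prode_ge0 => i _; exact: measure_ge0.
apply: prode_fin_num => i _; rewrite /= lebesgue_measure_itv/=.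
by case: ifP.
Qed.

Lemma bump_cube psi : bump psi -> exists r, forall x, psi x != 0 -> cube r x.
Proof.
move=> [_ [K cK Kpsi]].
have /pinfty_ex_gt0[r r0 Kr] := compact_bounded cK.
exists r => x /Kpsi Kx; apply/cubeP => i.
by apply: le_trans (rV_coord_le_norm _ _) _; exact: Kr.
Qed.

Lemma measurable_bump psi : bump psi -> measurable_fun setT psi.
Proof. by move=> [cpsi _]; exact: measurable_continuous_rV. Qed.

Lemma integrable_cube (M r : R) : mu.-integrable setT (fun x => (M * \1_(cube r) x)%:E).
Proof.
have h : mu.-integrable setT (EFin \o \1_(cube r)).
  have mc : measurable_fun setT (\1_(cube r) : V -> R).
    exact: measurable_indic (measurable_cube r).
  apply: (le_integrable_lty measurableT mc mc).
    by move=> x _; rewrite ger0_norm.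
  by rewrite integral_indic ?setIT//; [exact: cube_lty|exact: measurable_cube].
have := integrableZl measurableT M h; apply.
Qed.

Lemma integrable_bump psi : bump psi -> mu.-integrable setT (EFin \o psi).
Proof.
move=> bpsi; have [M psiM] := bump_bounded bpsi; have [r psir] := bump_cube bpsi.
have mpsi := measurable_bump bpsi.
have mc : measurable_fun setT (fun x => M * \1_(cube r) x).
  by apply: measurable_funM => //; exact: measurable_indic (measurable_cube r).
have /integrableP[_ coo] := integrable_cube M r.
apply: (le_integrable_lty measurableT mpsi mc) => [x _|].
  rewrite indicE; have [psi0|psi0] := eqVneq (psi x) 0.
    by rewrite psi0 normr0 mulr_ge0// (le_trans _ (psiM x)).
  by rewrite mem_set ?mulr1//; exact: psir.
apply: le_lt_trans coo; apply: ge0_le_integral => //.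
- by move=> x _; rewrite lee_fin mulr_ge0// (le_trans _ (psiM x)).
- exact/measurable_EFinP.
- by apply: measurableT_comp => //; exact/measurable_EFinP.
by move=> x _; rewrite lee_fin ler_norm.
Qed.

Lemma integrable_shift psi a : mu.-integrable setT (EFin \o psi) ->
  mu.-integrable setT (EFin \o (fun x => psi (x + a))).
Proof.
move=> /integrableP[/measurable_EFinP mpsi psioo]; apply/integrableP; split.
  by apply/measurable_EFinP; exact: measurable_comp_add.
rewrite (ge0_integral_shift a (f := fun x => (`|psi x|)%:E))//.
by apply/measurable_EFinP; exact: measurableT_comp.
Qed.

Lemma is_derive_reflect L z v l : is_derive (- z) v L l ->
  is_derive z v (fun w => L (- w)) (- l).
Proof.
move=> /is_derive_lineP; rewrite -{1}[0 : R]oppr0 => h; apply/is_derive_lineP.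
have := is_derive1_comp h (is_deriveN (is_derive_id (0 : R) (1 : R))).
rewrite mulrN1 (_ : _ \o _ = fun r : R => L (- (r *: v + z)))//.
by apply/funext => r /=; rewrite scaleNr opprD.
Qed.

(** A correlation is a convolution with the reflection of [L], which accounts for the sign. The
    derivative is carried by [L], so [psi] need only be integrable. *)
Lemma is_partial_correlation i psi L L' M M' y : mu.-integrable setT (EFin \o psi) ->
  measurable_fun setT L -> measurable_fun setT L' ->
  (forall x, `|L x| <= M) -> (forall x, `|L' x| <= M') ->
  (forall x, is_derive x (delta_mx ord0 i) L (L' x)) ->
  is_derive y (delta_mx ord0 i) (fun z => \int[mu]_x (psi x * L (x - z)))
    (- \int[mu]_x (psi x * L' (x - y))).
Proof.
move=> ipsi mL mL' LM LM' dL.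
have mLN : measurable_fun setT (fun w : V => L (- w)).
  have := @measurable_comp_sub R d L 0 mL.
  by under eq_fun do rewrite sub0r.
have LMN x : `|L (- x)| <= M by exact: LM.
have LMN' x : `|- L' (- x)| <= M' by rewrite normrN.
have := @is_partial_convolution R d i psi (fun w => L (- w)) (fun w => - L' (- w)) M M' y
  ipsi mLN LMN LMN' (fun z => is_derive_reflect (dL (- z))).
rewrite (_ : (fun z => \int[mu]_x (psi x * L (- (z - x)))) =
  fun z => \int[mu]_x (psi x * L (x - z))); last first.
  by apply/funext => z; apply: eq_Rintegral => x _; rewrite opprB.
rewrite (_ : \int[mu]_x (psi x * - L' (- (y - x))) =
  - \int[mu]_x (psi x * L' (x - y)))//.
rewrite -mulN1r -RintegralZl//.
  by apply: eq_Rintegral => x _; rewrite opprB mulN1r mulrN.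
apply: (integrable_mul_bounded (M := M')) => //.
exact: (measurable_comp_add (f := L')).
Qed.

(** Both sides are the derivative in [y] of the correlation of [phi] with [L], computed once on [L]
    and once, after a translation, on [phi]. No boundary term arises. *)
Lemma integration_by_parts_test i phi L L' M M' y : test_function phi ->
  measurable_fun setT L -> measurable_fun setT L' ->
  (forall x, `|L x| <= M) -> (forall x, `|L' x| <= M') ->
  (forall x, is_derive x (delta_mx ord0 i) L (L' x)) ->
  \int[mu]_x (partial i phi x * L (x - y)) = - \int[mu]_x (phi x * L' (x - y)).
Proof.
move=> tphi mL mL' LM LM' dL.
have bphi := test_function_bump tphi; have bdphi := partial_bump i tphi.
pose e : V := delta_mx ord0 i.
have [_ <-] := is_partial_correlation y (integrable_bump bphi) mL mL' LM LM' dL.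
have [Mdp dphiM] := bump_bounded bdphi.
have [r dphir] := bump_cube bdphi; have mphi := measurable_bump bphi.
have mdphi := measurable_bump bdphi.
have M0 : 0 <= M := le_trans (normr_ge0 _) (LM 0).
have Mdp0 : 0 <= Mdp := le_trans (normr_ge0 _) (dphiM 0).
(* The cube around the support is enlarged to contain its translates by [h e + y] for all
   [|h| < 1]. *)
pose rho := r + 1 + enorm y.
have mLz z : measurable_fun setT (fun x => L (x - z)).
  by apply: (measurable_comp_add (f := L)).
rewrite (_ : (fun z => \int[mu]_x (phi x * L (x - z))) =
    fun z => \int[mu]_x (phi (x + z) * L x)); last first.
  apply/funext => z; rewrite -(Rintegral_shift z); last exact: measurable_funM.
  by apply: eq_Rintegral => x _; rewrite addrK.
rewrite -[LHS](Rintegral_shift y); last exact: measurable_funM.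
under eq_Rintegral do rewrite addrK.
have h1 (h : R) : `|h| < 1 ->
    mu.-integrable setT (fun x => (phi (x + (h *: e + y)) * L x)%:E).
  move=> _; apply: (integrable_mul_bounded (M := M)) => //.
  exact: integrable_shift (integrable_bump bphi).
have h2 (x z : V) : setT x ->
    is_derive z e (fun z => phi (x + z) * L x) (partial i phi (x + z) * L x).
  move=> _; have /is_derive_lineP h := test_function_derivable i (x + z) tphi.
  apply/is_derive_lineP; have h2 := is_deriveZ (L x) h.
  rewrite (_ : (fun h : R => _) = L x \*: (fun h : R => phi (h *: e + (x + z)))).
    by apply: (is_derive_eq h2); rewrite mulrC.
  by apply/funext => k; rewrite /= addrCA mulrC.
have h3 (h : R) (x : V) : `|h| < 1 -> setT x ->
    `|partial i phi (x + (h *: e + y)) * L x| <= Mdp * M * \1_(cube rho) x.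
  move=> h1' _; have [->|/dphir/cubeP cx] := eqVneq (partial i phi (x + (h *: e + y))) 0.
    by rewrite mul0r normr0 !mulr_ge0.
  rewrite indicE mem_set ?mulr1; first by rewrite normrM ler_pM.
  apply/cubeP => l; have := cx l; rewrite !mxE eqxx/= => cxl.
  have yl := coord_le_enorm y l.
  have hl : `|h * (l == i)%:R| <= 1.
    by rewrite normrM; case: (l == i); rewrite ?normr0 ?normr1 ?mulr0 ?mulr1// ltW.
  rewrite (_ : x ord0 l = (x ord0 l + (h * (l == i)%:R + y ord0 l)) -
    h * (l == i)%:R - y ord0 l); last by ring.
  apply: (le_trans (ler_normB _ _)); apply: lerD => //.
  by apply: (le_trans (ler_normB _ _)); apply: lerD.
have h4 (x : V) : 0 <= Mdp * M * \1_(cube rho) x by rewrite !mulr_ge0.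
by have [_ ->] := is_derive_Rintegral measurableT h1 h2 h3 h4 (integrable_cube (Mdp * M) rho).
Qed.

Lemma partial_shift i psi a : partial i (fun x => psi (x + a)) = fun x => partial i psi (x + a).
Proof.
apply/funext => x; rewrite /partial /derive.
rewrite (_ : (fun h : R => h^-1 *: (((fun x => psi (x + a)) \o shift x) _ - psi (x + a))) =
  (fun h : R => h^-1 *: ((psi \o shift (x + a)) (h *: delta_mx ord0 i) - psi (x + a))))//.
by apply/funext => h /=; rewrite addrA.
Qed.

Lemma test_function_shift phi a : test_function phi -> test_function (fun x => phi (x + a)).
Proof.
move=> [dphi cphi]; split.
  have E s : foldr (@partial R d) (fun x => phi (x + a)) s =
      fun x => foldr (@partial R d) phi s (x + a).
    by elim: s => //= i s ->; rewrite partial_shift.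
  move=> s x; rewrite E.
  apply: (@differentiable_comp _ _ _ _ (fun x : V => x + a) (foldr (@partial R d) phi s)) => //.
set K := closure _ in cphi.
pose K' := (fun x : V => x - a) @` K.
have cK' : compact K'.
  apply: continuous_compact => //; apply: continuous_subspaceT => x.
  by apply: differentiable_continuous.
have clK' : closed K' by apply: compact_closed => //; exact: norm_hausdorff.
apply: (subclosed_compact _ cK'); first exact: closed_closure.
rewrite [X in _ `<=` X]((closure_id K').1 clK'); apply: closure_subset => x /= xa.
by exists (x + a); rewrite ?addrK//; exact: subset_closure.
Qed.

End test_functions.

Section divergence_free.
Variables (R : realType) (d : nat) (p : \bar R).
Hypotheses (d3 : (3 <= d)%N) (hp : (d%:R%:E < p)%E).
Local Notation V := 'rV[R]_d.
Local Notation T := (measurableTypeR R).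
Local Notation mu := (lebesgue_rV R d).
Implicit Types (phi : V -> R) (v : V -> V) (u : R -> V -> V) (x y : V) (t M : R).

Let p1 : (1 < p)%E := exponent_gt1 d3 hp.

Lemma measurable_leray_heat_kernel t i j : 0 < t ->
  measurable_fun setT (leray_heat_kernel t i j : V -> R).
Proof.
move=> t0; rewrite leray_heat_kernelE//; apply: measurable_funD.
  by apply: measurable_funM => //; exact: measurable_heat_kernel.
by apply: measurable_tail_integral_at; exact: tail_dominated_heat_d2.
Qed.

Lemma leray_heat_kernel_bounded t i j : 0 < t ->
  exists M, forall x : V, `|leray_heat_kernel t i j x| <= M.
Proof.
move=> t0; have [B B0 GB] := heat_kernel_bounded d t0.
have [M tM] := tail_integral_bounded d3 (tail_dominated_heat_d2 R i j) t0.
exists (B + M) => x; rewrite leray_heat_kernelE//.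
apply: (le_trans (ler_normD _ _)); apply: lerD => //.
rewrite normrM (ger0_norm (heat_kernel_ge0 _ _)).
case: (i == j); rewrite ?normr1 ?mul1r ?normr0 ?mul0r//; exact: ltW.
Qed.

Lemma sum_pairing_leray_d1 phi t k j y : test_function phi -> 0 < t ->
  \sum_i \int[mu]_x (partial i phi x * leray_d1 k i j t (x - y)) = 0.
Proof.
move=> tphi t0.
have mL i := measurable_leray_heat_kernel i j t0.
have m1 l i : measurable_fun setT (leray_d1 l i j t : V -> R).
  exact: measurable_leray_d1_at.
have sL l i (x : V) := leray_d1_le d3 l i j x t0.
have dL l i (x : V) := is_partial_leray d3 l i j x t0.
have bphi := test_function_bump tphi.
have zero z : \sum_i \int[mu]_x (partial i phi x * leray_heat_kernel t i j (x - z)) = 0.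
  transitivity (- \sum_i \int[mu]_x (phi x * leray_d1 i i j t (x - z))).
    rewrite -sumrN; apply: eq_bigr => i _; have [M LM] := leray_heat_kernel_bounded i j t0.
    exact: (integration_by_parts_test z tphi (mL i) (m1 i i) LM (sL i i) (dL i i)).
  rewrite -Rintegral_sum//; last first.
    move=> i; apply: (integrable_mul_bounded (M := leray_sup d t)) => //.
    - exact: integrable_bump.
    - exact: (measurable_comp_add (f := leray_d1 i i j t)).
  by rewrite Rintegral_eq0 ?oppr0// => x; rewrite -mulr_sumr leray_d1_div// mulr0.
(* Only one derivative of the Leray kernel is under control, so the second one is
   taken on the vanishing integral instead of on the kernel. *)
have dPsi i : is_derive y (delta_mx ord0 k)
    (fun z => \int[mu]_x (partial i phi x * leray_heat_kernel t i j (x - z)))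
    (- \int[mu]_x (partial i phi x * leray_d1 k i j t (x - y))).
  have [M LM] := leray_heat_kernel_bounded i j t0.
  have ib := integrable_bump (partial_bump i tphi).
  exact: (is_partial_correlation y ib (mL i) (m1 k i) LM (sL k i) (dL k i)).
have [_] := is_derive_sum dPsi.
rewrite (_ : \sum_i _ = cst 0); last by apply/funext => z; rewrite fct_sumE zero.
by rewrite derive_cst sumrN => /esym/eqP; rewrite oppr_eq0 => /eqP.
Qed.

Lemma integrable_bump_mul psi (f : V -> R) : bump psi -> measurable_fun setT f ->
  ('N[mu]_p[EFin \o f] < +oo)%E -> mu.-integrable setT (fun x => (psi x * f x)%:E).
Proof.
move=> bpsi mf foo; have mpsi := measurable_bump bpsi; have [B psiB] := bump_bounded bpsi.
have /integrableP[_ psioo] := integrable_bump bpsi.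
have mpf : measurable_fun setT (fun x => psi x * f x) by exact: measurable_funM.
have mapsi : measurable_fun setT (fun x => `|psi x|) by exact: measurableT_comp.
have maf : measurable_fun setT (fun x => `|f x|) by exact: measurableT_comp.
have mapf : measurable_fun setT (fun x => `|psi x| * `|f x|) by exact: measurable_funM.
apply: (le_integrable_lty measurableT mpf mapf) => [x _|]; first by rewrite normrM.
under eq_integral do rewrite EFinM.
apply: (integral_kernel_lty p1 mapsi _ psiB psioo) => //; first exact/measurable_EFinP.
by move: foo; rewrite -Lnorm_abse.
Qed.

Lemma weakly_div_free_duhamel a M u : 0 < a -> 0 < M -> Lp_path p a M u ->
  weakly_div_free (duhamel u a).
Proof.
move=> a0 M0 Lu phi tphi.
have Ld : in_Lp p (duhamel u a).
  split; first exact: measurable_duhamel Lu.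
  exact: le_lt_trans (Lpnorm_duhamel_le d3 hp a0 M0 Lu) (ltry _).
have bd i := partial_bump i tphi.
pose h i (s : T) := if 0 < s < a
  then \int[mu]_y (partial i phi y * leray_form (a - s) (u s) y ord0 i) else 0.
have hE i : lebesgue_measure.-integrable setT (EFin \o h i) /\
    \int[mu]_y (partial i phi y * duhamel u a y ord0 i) = \int[lebesgue_measure]_s h i s.
  have [B phiB] := bump_bounded (bd i).
  exact: (pairing_duhamel d3 hp (measurable_bump (bd i)) (integrable_bump (bd i)) phiB i a0 M0 Lu).
transitivity (\int[mu]_x (\sum_i partial i phi x * duhamel u a x ord0 i)).
  by apply: eq_Rintegral => x _; apply: eq_bigr => i _; rewrite mulrC.
rewrite Rintegral_sum//; last first.
  move=> i; apply: integrable_bump_mul => //; first exact: (measurable_fun_rVP _).1 Ld.1 i.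
  exact: Lnorm_coord_lty p1 _ _ Ld.
under eq_bigr do rewrite (hE _).2.
rewrite -Rintegral_sum//; last by move=> i; exact: (hE i).1.
apply: Rintegral_eq0 => s; have [sa|nsa] := boolP (0 < s < a); last first.
  by rewrite big1// => i _; rewrite /h (negbTE nsa).
have /andP[s0 s_a] := sa; have [Ls _ _] := Lu s sa.
have as0 : 0 < a - s by rewrite subr_gt0.
pose g i j k z := (\int[mu]_y (partial i phi y * leray_d1 k i j (a - s) (y - z))) *
  (u s z ord0 j * u s z ord0 k).
have gE i : (forall j k, mu.-integrable setT (EFin \o g i j k)) /\
    \int[mu]_y (partial i phi y * leray_form (a - s) (u s) y ord0 i) =
    \sum_j \sum_k \int[mu]_z g i j k z.
  exact: (pairing_leray_form d3 hp (measurable_bump (bd i)) (integrable_bump (bd i)) i as0 Ls).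
under eq_bigr do rewrite /h sa (gE _).2.
rewrite exchange_big big1// => j _; rewrite exchange_big big1// => k _.
rewrite -Rintegral_sum//; last by move=> i; exact: (gE i).1.
by apply: Rintegral_eq0 => z; rewrite /g -mulr_suml sum_pairing_leray_d1// mul0r.
Qed.

(** [heat t v] averages translates of [v], and testing a translate of [v] against [phi] amounts to
    testing [v] against a translate of [phi], which is again a test function. *)
Lemma weakly_div_free_heat t v : 0 < t -> in_Lp_sigma p v -> weakly_div_free (heat t v).
Proof.
move=> t0 [Lv dv] phi tphi; have [mv _] := Lv.
have mvi i : measurable_fun setT (fun y => v y ord0 i) by exact: (measurable_fun_rVP _).1.
have bd i := partial_bump i tphi; have md i := measurable_bump (bd i).
have mG := @measurable_heat_kernel R d t.
(* The first variable is the displacement, so that the heat kernel factors out of the integral over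
   the second one. *)
pose f i (w : V * V) := heat_kernel t w.1 * (partial i phi w.2 * v (w.2 - w.1) ord0 i).
have msw : measurable_fun setT (fun w : V * V => (w.2, w.1)).
  by apply: measurable_fun_pair; [exact: measurable_snd|exact: measurable_fst].
have mf i : measurable_fun setT (f i).
  apply: measurable_funM; first exact: (measurableT_comp mG measurable_fst).
  apply: measurable_funM; first exact: (measurableT_comp (md i) measurable_snd).
  exact: (measurableT_comp (measurableT_comp (mvi i) (@measurable_rV_sub R d)) msw).
have mf' i : measurable_fun setT (fun w : V * V => f i (w.2, w.1)).
  exact: (measurableT_comp (mf i) msw).
have inner i x : (\int[mu]_y (`|f i (y, x)|)%:E =
    (`|partial i phi x|)%:E * \int[mu]_y (heat_kernel t (x - y) * `|v y ord0 i|)%:E)%E.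
  rewrite -ge0_integralZl//; last 2 first.
  - apply/measurable_EFinP; apply: measurable_funM; first exact: measurable_heat_kernel_sub.
    exact: measurableT_comp.
  - by move=> y _; rewrite lee_fin mulr_ge0// heat_kernel_ge0.
  rewrite -(ge0_integral_reflect x).
  - apply: eq_integral => y _; rewrite /f/= normrM (ger0_norm (heat_kernel_ge0 _ _)) normrM.
    by rewrite -EFinM subKr mulrCA.
  - by apply/measurable_EFinP; apply: measurableT_comp => //; exact: (measurableT_comp (mf i) (measurable_pair2 x)).
  - by [].
have Noo i : ('N[mu]_p[EFin \o (fun y => v y ord0 i)] < +oo)%E by exact: Lnorm_coord_lty p1 _ _ Lv.
have ffin i : (\int[mu]_x \int[mu]_y (`|f i (y, x)|)%:E < +oo)%E.
  have [B B0 GB] := heat_kernel_bounded d t0.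
  pose C := ((1 `^ (1 - inv_exp p) * B `^ inv_exp p)%:E * 'N[mu]_p[EFin \o (fun y => v y ord0 i)])%E.
  have C0 : (0 <= C)%E.
    by rewrite mule_ge0 ?Lnorm_ge0// lee_fin mulr_ge0// powR_ge0.
  have Coo : (C < +oo)%E.
    by rewrite lte_mul_pinfty// lee_fin mulr_ge0// powR_ge0.
  have Gle x : (\int[mu]_y (heat_kernel t (x - y) * `|v y ord0 i|)%:E <= C)%E.
    apply: (integral_kernel_le p1 ltr01 B0 (measurable_heat_kernel_sub t x) (mvi i)).
    - by move=> y; exact: heat_kernel_ge0.
    - by move=> y; exact: GB.
    - by rewrite integral_heat_kernel_sub.
  have /integrableP[_ phioo] := integrable_bump (bd i).
  apply: (@le_lt_trans _ _ (\int[mu]_x ((`|partial i phi x|)%:E * C))%E).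
    apply: ge0_le_integral => //.
    - by move=> x _; exact: integral_ge0.
    - have mabs : measurable_fun setT (fun w : V * V => (`|f i (w.2, w.1)|)%:E).
        by apply/measurable_EFinP; exact: measurableT_comp.
      have := @measurable_fun_fubini_tonelli_F _ _ V V R mu _ mabs.
      by apply => w; rewrite lee_fin.
    - by apply: emeasurable_funM => //; apply/measurable_EFinP; exact: measurableT_comp.
    by move=> x _; rewrite inner; apply: lee_wpmul2l => //; exact: Gle.
  rewrite ge0_integralZr//; last by apply/measurable_EFinP; exact: measurableT_comp.
  by rewrite lte_mul_pinfty// ?integral_ge0// ge0_fin_numE// integral_ge0.
have fE i x : \int[mu]_y f i (y, x) = heat t v x ord0 i * partial i phi x.
  rewrite mxE -(Rintegral_reflect x); last first.
    exact: (measurableT_comp (mf i) (measurable_pair2 x)).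
  rewrite -RintegralZr//; last exact: (integrable_heat_coord p1 _ i t0 Lv).
  by apply: eq_Rintegral => y _; rewrite /f/= subKr mulrCA mulrC.
transitivity (\sum_i \int[mu]_x (\int[mu]_y f i (y, x))).
  rewrite -Rintegral_sum//; last by move=> i; exact: integrable_Rintegral (mf' i) (ffin i).
  by apply: eq_Rintegral => x _; apply: eq_bigr => i _; rewrite fE.
transitivity (\sum_i \int[mu]_y (\int[mu]_x f i (y, x))).
  apply: eq_bigr => i _.
  exact: (Rintegral_swap (m1 := mu) (m2 := mu) (mf' i) (ffin i)).
have ffin' i : (\int[mu]_y \int[mu]_x (`|f i (y, x)|)%:E < +oo)%E.
  rewrite (fubini_tonelli (fun w => (`|f i w|)%:E))//.
  by apply/measurable_EFinP; exact: measurableT_comp.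
rewrite -Rintegral_sum//; last by move=> i; exact: integrable_Rintegral (mf i) (ffin' i).
apply: Rintegral_eq0 => y.
have tphi' := test_function_shift y tphi.
have bd' i := partial_bump i tphi'.
transitivity (heat_kernel t y * \int[mu]_x (\sum_i v x ord0 i * partial i (fun x => phi (x + y)) x)); last by rewrite dv// mulr0.
have ib i : mu.-integrable setT (fun x => (partial i (fun x => phi (x + y)) x * v x ord0 i)%:E).
  exact: integrable_bump_mul.
rewrite (_ : \int[mu]_x (\sum_i _) = \sum_i \int[mu]_x (partial i (fun x => phi (x + y)) x * v x ord0 i)); last first.
  rewrite -Rintegral_sum//; apply: eq_Rintegral => x _.
  by apply: eq_bigr => i _; rewrite mulrC.
rewrite mulr_sumr; apply: eq_bigr => i _; rewrite -RintegralZl//; last exact: ib.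
rewrite -[LHS](Rintegral_shift y); last exact: (measurableT_comp (mf i) (measurable_pair1 y)).
by apply: eq_Rintegral => x _; rewrite /f/= addrK partial_shift.
Qed.

End divergence_free.

(** * Sparse data *)

Section sparse_heat.
Variables (R : realType) (d : nat) (p : \bar R).
Hypothesis p1 : (1 < p)%E.
Local Notation V := 'rV[R]_d.
Local Notation mu := (lebesgue_rV R d).
Implicit Types (v : V -> V) (x y : V) (t r : R).

Let p0 : (0 < p)%E. Proof. by rewrite (lt_trans _ p1). Qed.
Let p1' : (1 <= p)%E. Proof. exact: ltW. Qed.

Lemma measurable_eball x r : measurable (eball x r).
Proof.
rewrite (_ : eball x r = (fun y => enorm (y - x)) @^-1` `]-oo, r[%classic).
  rewrite -[X in measurable X]setTI.
  have h : measurable_fun setT (fun y : V => enorm (y - x)).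
    exact: (measurable_comp_add (f := @enorm R d) (- x) (@measurable_enorm R d)).
  by apply: h => //; exact: measurable_itv.
by apply/seteqP; split => y; rewrite /eball /= in_itv.
Qed.

Lemma lebesgue_eball_le x r : 0 <= r -> (mu (eball x r) <= ((2 * r) ^+ d)%:E)%E.
Proof.
move=> r0; pose A (i : 'I_d) : set R := `[x ord0 i - r, x ord0 i + r]%classic.
have mA i : measurable (A i) by exact: measurable_itv.
apply: (@le_trans _ _ (mu [set y | forall i, A i (y ord0 i)])).
  apply: le_measure; rewrite ?inE.
  - exact: measurable_eball.
  - exact: measurable_box.
  move=> y yx i; rewrite /A/= in_itv/= -ler_distlC distrC.
  have := coord_le_enorm (y - x) i; rewrite !mxE => h.
  by apply: (le_trans h); exact: ltW yx.
rewrite lebesgue_rV_box//.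
rewrite (eq_bigr (fun=> (2 * r)%:E)).
  by rewrite prodEFin lee_fin prodr_const card_ord.
move=> i _; rewrite /= lebesgue_measure_itv/= lte_fin.
case: ifPn => [_|].
  by rewrite -EFinB; congr EFin; ring.
rewrite -leNgt => h; have -> : r = 0 by lra.
by rewrite mulr0.
Qed.

Lemma eball_fin x r : 0 <= r -> (mu (eball x r) \is a fin_num)%E.
Proof.
by move=> r0; rewrite ge0_fin_numE// (le_lt_trans (lebesgue_eball_le x r0))// ltry.
Qed.

Lemma sparse_ball_le S (eps r : R) x : measurable S -> 0 <= r -> 0 <= eps ->
  (ereal_sup (range (fun x0 : V =>
       (fine (mu (S `&` eball x0 r)) / fine (mu (eball x0 r)))%:E)) <= eps%:E)%E ->
  (mu (S `&` eball x r) <= (eps * (2 * r) ^+ d)%:E)%E.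
Proof.
move=> mS r0 e0 he.
have mE := measurable_eball x r.
have SE : (mu (S `&` eball x r) <= mu (eball x r))%E.
  by apply: le_measure; rewrite ?inE//; exact: measurableI.
have fE := eball_fin x r0.
have fS : (mu (S `&` eball x r) \is a fin_num)%E.
  by rewrite ge0_fin_numE// (le_lt_trans SE)// -ge0_fin_numE.
have {}he : fine (mu (S `&` eball x r)) / fine (mu (eball x r)) <= eps.
  by rewrite -lee_fin (le_trans _ he)//; apply: ereal_sup_ubound; exists x.
have E0 : 0 <= fine (mu (eball x r)) by rewrite fine_ge0.
have EM : fine (mu (eball x r)) <= (2 * r) ^+ d.
  by rewrite -lee_fin fineK//; exact: lebesgue_eball_le.
rewrite -(fineK fS) lee_fin; apply: (@le_trans _ _ (eps * fine (mu (eball x r)))).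
  (* If the ball is null, the quotient carries no information, but then the intersection is null
     too. *)
  move: E0; rewrite le_eqVlt => /predU1P[E0|E0]; last by rewrite -ler_pdivrMr.
  by rewrite -E0 mulr0 E0 fine_le.
exact: ler_wpM2l.
Qed.

(* Junk values are harmless: where the inner integral diverges, the real integral is
   [0]. *)
Lemma Lnorm_Rkernel_le (k : V * V -> R) (A B : R) (f : V -> R) :
  0 < A -> 0 < B -> measurable_fun setT k -> (forall z, 0 <= k z) ->
  (forall x, (\int[mu]_y (k (x, y))%:E <= A%:E)%E) ->
  (forall y, (\int[mu]_x (k (x, y))%:E <= B%:E)%E) ->
  measurable_fun setT f ->
  ('N[mu]_p[EFin \o (fun x => \int[mu]_y (k (x, y) * f y))%R] <=
   (A `^ (1 - inv_exp p) * B `^ inv_exp p)%:E * 'N[mu]_p[EFin \o f])%E.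
Proof.
move=> A0 B0 mk k0 kA kB mf.
have mkf : measurable_fun setT (fun z : V * V => k z * f z.2).
  by apply: measurable_funM => //; exact: (measurableT_comp mf measurable_snd).
have maf : measurable_fun setT (fun y => `|f y|) by exact: measurableT_comp.
apply: le_trans (Lnorm_kernel_le A0 B0 mk k0 kA p1 mf kB); apply: le_Lnorm => //.
- apply/measurable_EFinP; exact: (measurable_Rintegral mu mkf).
- exact: measurable_kernel_integral.
apply: aeW => x; rewrite [leRHS]gee0_abs; last first.
  by apply: integral_ge0 => y _; rewrite lee_fin mulr_ge0.
have mkx : measurable_fun setT (fun y => k (x, y) * f y).
  exact: (measurableT_comp mkf (measurable_pair1 x)).
apply: le_trans (abs_Rintegral_le mu measurableT mkx) _.
rewrite le_eqVlt; apply/orP; left; apply/eqP/eq_integral => y _.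
by rewrite normrM (ger0_norm (k0 _)).
Qed.

Lemma heat_kernel_far t r (z : V) : 0 < t -> 0 <= r -> r <= enorm z ->
  heat_kernel t z <= 2 `^ (d%:R / 2) * expR (- (r ^+ 2 / (8 * t))) * heat_kernel (2 * t) z.
Proof.
move=> t0 r0 rz; rewrite (heat_kernel_double z t0).
apply: ler_wpM2r; first exact: heat_kernel_ge0.
apply: ler_wpM2l; first exact: powR_ge0.
rewrite ler_expR lerN2; apply: ler_wpM2r; first by rewrite invr_ge0 mulr_ge0// ltW.
by rewrite ler_sqr ?nnegrE ?enorm_ge0.
Qed.

(** Collects the coefficients of the three contributions in [Lpnorm_heat_sparse]: off the sparse
    set, on it and far away, on it and near. *)
Definition sparse_const : R := locked (d%:R * (1 + 2 `^ (d%:R / 2) + sup_const R d * 2 ^+ d)).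

Lemma kernel_const_id (A : R) : 0 < A -> A `^ (1 - inv_exp p) * A `^ inv_exp p = A.
Proof. by move=> A0; rewrite -powRD ?subrK ?powRr1 ?(ltW A0)// (gt_eqF A0) implybT. Qed.

(** In Schur's test the near kernel has row mass of order [eps lbar^d], since sparseness confines
    [y] to a thin set, but column mass only of order [lbar^d]; hence the power [eps^(1 - 1/p)]. The
    factor [d] comes from bounding [enorm] by the sum of the coordinates. *)
Lemma Lpnorm_heat_sparse v t (eps beta lbar : R) : 0 < t -> 0 < eps -> 0 < lbar ->
  in_Lp p v -> sparse eps beta (Num.sqrt t * lbar) p v ->
  (Lpnorm p setT (heat t v) <=
   (d%:R * (beta + 2 `^ (d%:R / 2) * expR (- (lbar ^+ 2 / 8)) +
     sup_const R d * 2 ^+ d * lbar ^+ d * eps `^ (1 - inv_exp p)))%:E *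
   Lpnorm p setT v)%E.
Proof.
move=> t0 e0 l0 Lv [S [mS betaS epsS]]; have [mv voo] := Lv.
set ell := Num.sqrt t * lbar in epsS.
have st0 : 0 < Num.sqrt t by rewrite sqrtr_gt0.
have ell0 : 0 < ell by rewrite mulr_gt0.
pose w y := enorm (v y); have mw : measurable_fun setT w by exact: measurable_enorm_comp.
have w0 y : 0 <= w y by exact: enorm_ge0.
have Nw : (Lpnorm p setT v = 'N[mu]_p[EFin \o w])%E by rewrite Lpnorm_setT.
have mI (D : set V) : measurable D -> measurable_fun setT (\1_D : V -> R).
  by move=> mD; exact: measurable_indic.
pose G (z : V * V) := heat_kernel t (z.1 - z.2).
have mG : measurable_fun setT G by exact: measurable_heat_kernel_sub2.
have G0 z : 0 <= G z by exact: heat_kernel_ge0.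
pose B0 := eball (0 : V) ell; have mB0 : measurable B0 by exact: measurable_eball.
have mnear : measurable_fun setT (fun z : V * V => \1_B0 (z.1 - z.2) : R).
  exact: (measurableT_comp (mI _ mB0) (@measurable_rV_sub R d)).
have mfar : measurable_fun setT (fun z : V * V => 1 - \1_B0 (z.1 - z.2) : R).
  by apply: measurable_funB => //; exact: measurable_cst.
have ind0 (D : set V) (x : V) : 0 <= (\1_D x : R) by [].
have ind1 (D : set V) (x : V) : (\1_D x : R) <= 1 by rewrite indicE lern1 leq_b1.
have far0 z : 0 <= 1 - \1_B0 z :> R by rewrite subr_ge0.
(* [G = G 1_(~` S) + G 1_S 1_(far) + G 1_S 1_(near)] *)
pose f1 y := w y * \1_(~` S) y; pose f2 y := w y * \1_S y.
have mf1 : measurable_fun setT f1.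
  by apply: measurable_funM => //; apply: mI; exact: measurableC.
have mf2 : measurable_fun setT f2 by apply: measurable_funM => //; exact: mI.
pose k2 (z : V * V) := G z * (1 - \1_B0 (z.1 - z.2)).
pose k3 (z : V * V) := G z * (\1_B0 (z.1 - z.2) * \1_S z.2).
have mk2 : measurable_fun setT k2 by exact: measurable_funM.
have mk3 : measurable_fun setT k3.
  apply: measurable_funM => //; apply: measurable_funM => //.
  exact: (measurableT_comp (mI _ mS) measurable_snd).
have k20 z : 0 <= k2 z by rewrite mulr_ge0.
have k30 z : 0 <= k3 z.
  by apply: mulr_ge0 => //; exact: mulr_ge0.
pose F1 x := \int[mu]_y (G (x, y) * f1 y).
pose F2 x := \int[mu]_y (k2 (x, y) * f2 y).
pose F3 x := \int[mu]_y (k3 (x, y) * w y).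
have mF1 : measurable_fun setT F1.
  apply: (measurable_Rintegral mu (h := fun z : V * V => G z * f1 z.2)).
  by apply: measurable_funM => //; exact: (measurableT_comp mf1 measurable_snd).
have mF2 : measurable_fun setT F2.
  apply: (measurable_Rintegral mu (h := fun z : V * V => k2 z * f2 z.2)).
  by apply: measurable_funM => //; exact: (measurableT_comp mf2 measurable_snd).
have mF3 : measurable_fun setT F3.
  apply: (measurable_Rintegral mu (h := fun z : V * V => k3 z * w z.2)).
  by apply: measurable_funM => //; exact: (measurableT_comp mw measurable_snd).
have N1 : ('N[mu]_p[EFin \o F1] <= beta%:E * Lpnorm p setT v)%E.
  have h := Lnorm_Rkernel_le (k := G) ltr01 ltr01 mG G0 _ _ mf1.
  apply: le_trans (h _ _) _ => [x|y|].
  - by rewrite /G/= integral_heat_kernel_sub.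
  - by rewrite /G/= integral_heat_kernel_subr.
  rewrite !powR1 mul1r mul1e; apply: le_trans (ltW betaS).
  rewrite /Lpnorm le_eqVlt; apply/orP; left; apply/eqP; congr Lnorm.
  by apply/funext => y; rewrite /f1/= patchE indicE; case: ifP => _; rewrite ?mulr1 ?mulr0.
have N2 : ('N[mu]_p[EFin \o F2] <=
    (2 `^ (d%:R / 2) * expR (- (lbar ^+ 2 / 8)))%:E * Lpnorm p setT v)%E.
  set q := _ * _; have q0 : 0 < q by rewrite /q mulr_gt0 ?expR_gt0 ?powR_gt0.
  have k2le z : k2 z <= q * heat_kernel (2 * t) (z.1 - z.2).
    rewrite /k2 indicE; have [zB|zB] := boolP ((z.1 - z.2) \in B0).
      by rewrite subrr mulr0; apply: mulr_ge0; [exact: ltW|exact: heat_kernel_ge0].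
    rewrite subr0 mulr1 (_ : q = 2 `^ (d%:R / 2) * expR (- (ell ^+ 2 / (8 * t)))).
      apply: heat_kernel_far => //; first exact: ltW.
      rewrite leNgt; apply/negP => zl; move/negP: zB; apply; rewrite inE /B0 /eball/=.
      by rewrite subr0.
    rewrite /q /ell exprMn sqr_sqrtr ?(ltW t0)//; congr (_ * expR (- _)).
    by field; rewrite gt_eqF.
  have t20 : 0 < 2 * t by rewrite mulr_gt0.
  have q0' : (0 <= q%:E)%E by rewrite lee_fin ltW.
  have h := Lnorm_Rkernel_le q0 q0 mk2 k20 _ _ mf2.
  apply: le_trans (h _ _) _ => [x|y|].
  - apply: (@le_trans _ _ (\int[mu]_y (q%:E * (heat_kernel (2 * t) (x - y))%:E))%E).
      apply: ge0_le_integral => //.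
      + by move=> y _; rewrite lee_fin.
      + by apply/measurable_EFinP; exact: (measurableT_comp mk2 (measurable_pair1 x)).
      + by apply: emeasurable_funM => //; apply/measurable_EFinP; exact: measurable_heat_kernel_sub.
      by move=> y _; rewrite -EFinM lee_fin; exact: k2le.
    rewrite ge0_integralZl//.
    + by rewrite integral_heat_kernel_sub// mule1.
    + by apply/measurable_EFinP; exact: measurable_heat_kernel_sub.
    + by move=> y _; rewrite lee_fin heat_kernel_ge0.
  - apply: (@le_trans _ _ (\int[mu]_x (q%:E * (heat_kernel (2 * t) (x - y))%:E))%E).
      apply: ge0_le_integral => //.
      + by move=> x _; rewrite lee_fin.
      + by apply/measurable_EFinP; exact: (measurableT_comp mk2 (measurable_pair2 y)).
      + by apply: emeasurable_funM => //; apply/measurable_EFinP; exact: measurable_heat_kernel_subr.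
      by move=> x _; rewrite -EFinM lee_fin; exact: k2le.
    rewrite ge0_integralZl//.
    + by rewrite integral_heat_kernel_subr// mule1.
    + by apply/measurable_EFinP; exact: measurable_heat_kernel_subr.
    + by move=> x _; rewrite lee_fin heat_kernel_ge0.
  rewrite kernel_const_id//; apply: lee_wpmul2l => //.
  rewrite Nw; apply: le_Lnorm => //; try exact/measurable_EFinP.
  apply: aeW => y /=; rewrite lee_fin /f2 normrM ler_piMr//.
  by rewrite ger0_norm.
have N3 : ('N[mu]_p[EFin \o F3] <=
    (sup_const R d * 2 ^+ d * lbar ^+ d * eps `^ (1 - inv_exp p))%:E * Lpnorm p setT v)%E.
  pose K := sup_const R d * 2 ^+ d * lbar ^+ d.
  have K0 : 0 < K by rewrite /K mulr_gt0 ?exprn_gt0// mulr_gt0 ?exprn_gt0 ?sup_const_gt0.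
  pose s := sup_const R d * t `^ (- (d%:R / 2)).
  have s0 : 0 <= s by rewrite mulr_ge0 ?powR_ge0// ltW// sup_const_gt0.
  (* The volume of a ball of radius [sqrt t lbar] against the supremum of the kernel: the powers of
     [t] cancel and only [lbar^d] remains. *)
  have tE : Num.sqrt t ^+ d * t `^ (- (d%:R / 2)) = 1.
    rewrite -powR12_sqrt ?(ltW t0)// -powR_mulrn ?powR_ge0// -powRrM -powRD ?(gt_eqF t0) ?implybT//.
    by rewrite (_ : _ + _ = 0) ?powRr0//; ring.
  have sK : s * (2 * ell) ^+ d = K.
    rewrite /s /K /ell !exprMn.
    transitivity (sup_const R d * 2 ^+ d * lbar ^+ d *
        (Num.sqrt t ^+ d * t `^ (- (d%:R / 2)))); last by rewrite tE mulr1.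
    move: (Num.sqrt t ^+ d) (t `^ _) (2 ^+ d) (lbar ^+ d) => a b c l.
    by ring.
  have Gs z : G z <= s by exact: heat_kernel_sup.
  have near_eball x y : (x - y) \in B0 = (y \in eball x ell).
    apply/idP/idP; rewrite !inE /B0 /eball/= subr0 => h; rewrite -(enormN (_ - _)) opprB//.
  have near_eball' x y : (x - y) \in B0 = (x \in eball y ell).
    by apply/idP/idP; rewrite !inE /B0 /eball/= subr0.
  have h := Lnorm_Rkernel_le (mulr_gt0 K0 e0) K0 mk3 k30 _ _ mw.
  apply: le_trans (h _ _) _ => [x|y|].
  - apply: (@le_trans _ _ (\int[mu]_y (s%:E * (\1_(S `&` eball x ell) y)%:E))%E).
      apply: ge0_le_integral => //.
      + by move=> y _; rewrite lee_fin.
      + by apply/measurable_EFinP; exact: (measurableT_comp mk3 (measurable_pair1 x)).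
      + apply: emeasurable_funM => //; apply/measurable_EFinP; apply: mI.
        by apply: measurableI => //; exact: measurable_eball.
      move=> y _; rewrite -EFinM lee_fin /k3/= !indicE near_eball in_setI.
      by case: (y \in S); case: (y \in eball x ell); rewrite /= ?(mulr0, mulr1) ?lexx ?Gs.
    rewrite ge0_integralZl//; last first.
      apply/measurable_EFinP; apply: mI.
      by apply: measurableI => //; exact: measurable_eball.
    rewrite integral_indic//; last by apply: measurableI => //; exact: measurable_eball.
    rewrite setIT [leRHS](_ : _ = s%:E * (eps * (2 * ell) ^+ d)%:E)%E; last first.
      by rewrite -EFinM mulrCA sK mulrC.
    apply: lee_wpmul2l; first by rewrite lee_fin.
    exact: (sparse_ball_le x mS (ltW ell0) (ltW e0) epsS).
  - apply: (@le_trans _ _ (\int[mu]_x (s%:E * (\1_(eball y ell) x)%:E))%E).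
      apply: ge0_le_integral => //.
      + by move=> x _; rewrite lee_fin.
      + by apply/measurable_EFinP; exact: (measurableT_comp mk3 (measurable_pair2 y)).
      + by apply: emeasurable_funM => //; apply/measurable_EFinP; apply: mI; exact: measurable_eball.
      move=> x _; rewrite -EFinM lee_fin /k3/= !indicE near_eball'.
      by case: (y \in S); case: (x \in eball y ell); rewrite /= ?(mulr0, mulr1) ?lexx ?Gs.
    rewrite ge0_integralZl//; last first.
      by apply/measurable_EFinP; apply: mI; exact: measurable_eball.
    rewrite integral_indic//; last exact: measurable_eball.
    rewrite setIT [leRHS](_ : _ = s%:E * ((2 * ell) ^+ d)%:E)%E; last first.
      by rewrite -EFinM sK.
    apply: lee_wpmul2l; first by rewrite lee_fin.
    exact: lebesgue_eball_le (ltW ell0).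
  rewrite -Nw powRM ?(ltW K0) ?(ltW e0)// mulrAC -/K kernel_const_id//.
have iw x : mu.-integrable setT (EFin \o (fun y => heat_kernel t (x - y) * w y)).
  by apply: (integrable_heat p1) => //; rewrite -Nw.
have sub_int x (k : V -> R) : measurable_fun setT k ->
    (forall y, 0 <= k y) -> (forall y, k y <= heat_kernel t (x - y) * w y) ->
    mu.-integrable setT (EFin \o k).
  move=> mk k0 kle.
  have mGw : measurable_fun setT (fun y => heat_kernel t (x - y) * w y).
    by apply: measurable_funM => //; exact: measurable_heat_kernel_sub.
  apply: (le_integrable_lty measurableT mk mGw) => [y _|]; first by rewrite ger0_norm.
  have /integrableP[_] := iw x; apply: le_lt_trans; apply: ge0_le_integral => //.
  - by move=> y _; rewrite lee_fin mulr_ge0// heat_kernel_ge0.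
  - exact/measurable_EFinP.
  - by apply: measurableT_comp => //; exact/measurable_EFinP.
  by move=> y _; rewrite lee_fin ler_norm.
have WE x : \int[mu]_y (heat_kernel t (x - y) * w y) = F1 x + F2 x + F3 x.
  have i1 : mu.-integrable setT (EFin \o (fun y => G (x, y) * f1 y)).
    apply: (sub_int x).
    - by apply: measurable_funM => //; exact: (measurableT_comp mG (measurable_pair1 x)).
    - by move=> y; apply: mulr_ge0 => //; exact: mulr_ge0.
    - move=> y; apply: ler_wpM2l; first exact: heat_kernel_ge0.
      by rewrite /f1 ler_piMr.
  have i2 : mu.-integrable setT (EFin \o (fun y => k2 (x, y) * f2 y)).
    apply: (sub_int x).
    - by apply: measurable_funM => //; exact: (measurableT_comp mk2 (measurable_pair1 x)).
    - by move=> y; apply: mulr_ge0 => //; exact: mulr_ge0.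
    - move=> y; apply: ler_pM => //.
      + exact: mulr_ge0.
      + by rewrite /k2 ler_piMr// lerBlDr lerDl.
      + by rewrite /f2 ler_piMr.
  have i3 : mu.-integrable setT (EFin \o (fun y => k3 (x, y) * w y)).
    apply: (sub_int x).
    - by apply: measurable_funM => //; exact: (measurableT_comp mk3 (measurable_pair1 x)).
    - by move=> y; rewrite mulr_ge0.
    - move=> y; apply: ler_wpM2r => //; rewrite /k3 ler_piMr//= mulr_ile1.
  have i12 : mu.-integrable setT (EFin \o (fun y => G (x, y) * f1 y + k2 (x, y) * f2 y)).
    by have := integrableD measurableT i1 i2; apply.
  rewrite /F1 /F2 /F3 -(RintegralD measurableT i1 i2) -(RintegralD measurableT i12 i3).
  apply: eq_Rintegral => y _; rewrite /k2 /k3 /f1 /f2 /G/= !indicE in_setC.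
  by case: (y \in S) => /=; ring.
pose dF x := d%:R * (F1 x + F2 x + F3 x).
have mF : measurable_fun setT (fun x => F1 x + F2 x + F3 x).
  by apply: measurable_funD => //; exact: measurable_funD.
have hle x : enorm (heat t v x) <= dF x.
  apply: (le_trans (enorm_le_sum _)).
  rewrite /dF mulr_natl -[X in _ *+ X]card_ord -sumr_const; apply: ler_sum => i _.
  rewrite -WE mxE; have iv := integrable_heat_coord p1 x i t0 Lv.
  apply: (le_trans (le_normr_Rintegral measurableT iv)); apply: le_Rintegral => //.
    exact: integrable_norm iv.
  move=> y _; rewrite normrM (ger0_norm (heat_kernel_ge0 _ _)).
  by apply: ler_wpM2l; [exact: heat_kernel_ge0|exact: coord_le_enorm].
have dR0 : 0 <= d%:R :> R by [].
apply: (@le_trans _ _ ('N[mu]_p[(fun x => d%:R%:E * (F1 x + F2 x + F3 x)%:E)])%E).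
  apply: Lpnorm_le => //.
  - exact: measurable_heat.
  - by apply: emeasurable_funM => //; exact/measurable_EFinP.
  by apply: aeW => x; rewrite -EFinM lee_fin; exact: hle.
have mFe : measurable_fun setT (fun x => (F1 x + F2 x + F3 x)%:E) by exact/measurable_EFinP.
apply: le_trans (LnormZ_le mu dR0 p0 mFe) _.
rewrite EFinM -muleA; apply: lee_wpmul2l; first by rewrite lee_fin.
apply: (@le_trans _ _ ('N[mu]_p[EFin \o F1] + 'N[mu]_p[EFin \o F2] + 'N[mu]_p[EFin \o F3])%E).
  apply: le_trans (eminkowski _ (measurable_funD mF1 mF2) mF3 p1') _.
  by apply: leeD => //; exact: eminkowski.
have vfin : Lpnorm p setT v \is a fin_num by rewrite ge0_fin_numE// Lpnorm_ge0.
rewrite !EFinD !muleDl ?fin_num_adde_defr//.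
by rewrite !leeD.
Qed.

End sparse_heat.

(** * Restarting and gluing strong solutions *)

Lemma cvge0P (R : realType) (T : Type) (F : set_system T) (FF : Filter F) (f : T -> \bar R) :
  (forall x, 0 <= f x)%E ->
  (f x @[x --> F] --> 0%E) <->
  (forall e : R, 0 < e -> \forall x \near F, (f x <= e%:E)%E).
Proof.
move=> f0; split=> [cf e e0|fe].
  have : \forall x \near F, (f x < e%:E)%E.
    move: cf => /(_ [set y | (y < e%:E)%E]); apply.
    by apply: open_nbhs_nbhs; split; [exact: open_ereal_lt_ereal|rewrite /= lte_fin].
  by apply: filterS => x; exact: ltW.
move=> A /= [e e0 eA].
have e20 : 0 < e / 2 by rewrite divr_gt0.
have := fe _ e20; rewrite nearE /nbhs/=; apply: filterS => x /=.
have := f0 x; case: (f x) => [r| |]//; rewrite !lee_fin => r0 re.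
apply: eA; rewrite /ball/= sub0r normrN ger0_norm//.
by rewrite (le_lt_trans re)// ltr_pdivrMr// ltr_pMr// ltr1n.
Qed.

Section strong_solutions.
Variables (R : realType) (d : nat) (p : \bar R).
Hypotheses (d3 : (3 <= d)%N) (hp : (d%:R%:E < p)%E).
Local Notation V := 'rV[R]_d.
Local Notation T := (measurableTypeR R).
Local Notation mu := (lebesgue_rV R d).
Implicit Types (v w g : V -> V) (u : R -> V -> V) (x : V) (t s M : R) (I J : set R).

Let p1 : (1 < p)%E := exponent_gt1 d3 hp.
Let p1' : (1 <= p)%E. Proof. exact: ltW. Qed.

Lemma continuous_LpP I u t :
  (Lpnorm p setT (fun x => u s x - u t x) @[s --> within I (nbhs t)] --> 0%E) <->
  (forall e : R, 0 < e -> \forall s \near t, I s ->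
     (Lpnorm p setT (fun x => u s x - u t x)%R <= e%:E)%E).
Proof. by apply: cvge0P => s; exact: Lpnorm_ge0. Qed.

Lemma strong_solution_sub v I J u : J `<=` I ->
  strong_solution p v I u -> strong_solution p v J u.
Proof.
move=> JI [mu_ [Lu cu] bu]; split.
- by move=> t /JI; exact: mu_.
- split=> t /JI It; first exact: Lu.
  apply/continuous_LpP => e e0; have := (continuous_LpP I u t).1 (cu t It) e e0.
  by apply: filterS => s + /JI; exact.
- by move=> t /JI; exact: bu.
Qed.

Lemma strong_solution_path v I u t : `]0, t[%classic `<=` I -> I t ->
  strong_solution p v I u -> exists2 M, 0 < M & Lp_path p t M u.
Proof.
move=> tI It [_ [Lu cu] bu]; have [M uM] := bu t It.
exists (1 + `|M|); first by rewrite ltr_pwDl.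
move=> s st; have Is : I s by apply: tI; rewrite /= in_itv.
split; first exact: Lu.
  by apply: (le_trans (uM s st)); rewrite lee_fin (le_trans (ler_norm M))// lerDr.
apply/cvge0P => [r|e e0]; first exact: Lpnorm_ge0.
have := (continuous_LpP I u s).1 (cu s Is) e e0.
have : \forall r \near s, 0 < r < t.
  have := @near_in_itvoo R 0 t s; rewrite in_itv/= => /(_ st).
  by apply: filterS => r; rewrite in_itv.
by apply: filterS2 => r rt; apply; apply: tI; rewrite /= in_itv.
Qed.

Lemma eq_duhamel u1 u2 t : (forall s, 0 < s < t -> u1 s = u2 s) ->
  duhamel u1 t = duhamel u2 t :> (V -> V).
Proof.
move=> u12; apply/funext => x; apply/rowP => i.
apply: etrans (mxE _ _ _ _) _; apply: esym; apply: etrans (mxE _ _ _ _) _.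
by apply: eq_Rintegral => s; rewrite inE /= in_itv/= => st; rewrite (u12 s st).
Qed.

Lemma duhamel_in_Lp t M u : 0 < t -> 0 < M -> Lp_path p t M u -> in_Lp p (duhamel u t).
Proof.
move=> t0 M0 Lu; split; first exact: measurable_duhamel Lu.
exact: le_lt_trans (Lpnorm_duhamel_le d3 hp t0 M0 Lu) (ltry _).
Qed.

Lemma in_LpB v w : in_Lp p v -> in_Lp p w -> in_Lp p (fun x => v x - w x).
Proof.
move=> [mv voo] [mw woo]; split.
  by apply: measurable_fun_rV_add => //; exact: measurable_fun_rV_opp.
by apply: (le_lt_trans (LpnormB p1' mv mw)); rewrite lte_add_pinfty.
Qed.

Lemma in_LpD v w : in_Lp p v -> in_Lp p w -> in_Lp p (fun x => v x + w x).
Proof.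
move=> [mv voo] [mw woo]; split; first exact: measurable_fun_rV_add.
by apply: (le_lt_trans (LpnormD p1' mv mw)); rewrite lte_add_pinfty.
Qed.

Lemma ae_in_Lp v w : measurable_fun setT w -> in_Lp p v ->
  {ae mu, forall x, v x = w x} -> in_Lp p w.
Proof. by move=> mw [mv voo] vw; split => //; rewrite -(ae_eq_Lpnorm p1' mv mw vw). Qed.

Section mild.
Variables (v : V -> V) (u : R -> V -> V) (a M : R).
Hypotheses (a0 : 0 < a) (M0 : 0 < M) (Lv : in_Lp p v) (La : in_Lp p (u a)).
Hypothesis (ma : {ae mu, forall x, u a x = heat a v x - duhamel u a x}).

(** The mild identity exhibits [exp(a Delta) v] as a sum of two fields in [L^p]. *)
Lemma mild_heat_in_Lp : Lp_path p a M u -> in_Lp p (heat a v).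
Proof.
move=> Lu; have Ld := duhamel_in_Lp a0 M0 Lu.
apply: (ae_in_Lp _ (in_LpD La Ld)); first exact: measurable_heat Lv.1.
by apply: filterS ma => x ->; rewrite subrK.
Qed.

Lemma mild_restart tau x : 0 < tau -> Lp_path p a M u ->
  heat tau (u a) x = heat (a + tau) v x - heat tau (duhamel u a) x.
Proof.
move=> tau0 Lu; have Ld := duhamel_in_Lp a0 M0 Lu; have Lh := mild_heat_in_Lp Lu.
rewrite (ae_eq_heat (w := fun y => heat a v y - duhamel u a y) tau x La.1)//.
- by rewrite (heatB p1 x tau0 Lh Ld) (heat_semigroup p1 x tau0 a0 Lv) [a + tau]addrC.
- exact: (in_LpB Lh Ld).1.
Qed.

End mild.

Lemma weakly_div_free_sub v w g : in_Lp p v -> in_Lp p w -> measurable_fun setT g ->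
  weakly_div_free v -> weakly_div_free w ->
  {ae mu, forall x, g x = v x - w x} -> weakly_div_free g.
Proof.
move=> Lv Lw mg dv dw gvw phi tphi.
have bd i := partial_bump i tphi; have md i := measurable_bump (bd i).
have isum h : in_Lp p h -> mu.-integrable setT
    (EFin \o (fun x => \sum_i h x ord0 i * partial i phi x)).
  move=> Lh; rewrite (_ : EFin \o _ = fun x => (\sum_i (partial i phi x * h x ord0 i)%:E)%E).
    apply: integrable_sum => // i _; apply: (integrable_bump_mul d3 hp) => //.
      exact: (measurable_fun_rVP _).1 Lh.1 i.
    exact: Lnorm_coord_lty p1 _ _ Lh.
  apply/funext => x /=; rewrite -sumEFin.
  by apply: eq_bigr => i _; rewrite mulrC.
have msum (h : V -> V) : measurable_fun setT h ->
    measurable_fun setT (fun x => \sum_i h x ord0 i * partial i phi x).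
  move=> mh; apply: measurable_sum => i; apply: measurable_funM => //.
  exact: (measurable_fun_rVP _).1 mh i.
transitivity (\int[mu]_x (\sum_i v x ord0 i * partial i phi x -
    \sum_i w x ord0 i * partial i phi x)).
  apply: ae_eq_Rintegral.
  - exact: msum.
  - by apply: measurable_funB; apply: msum; [exact: Lv.1|exact: Lw.1].
  apply: filterS gvw => x gx; rewrite -sumrB; apply: eq_bigr => i _.
  by rewrite gx !mxE mulrBl.
by rewrite (RintegralB measurableT (isum v Lv) (isum w Lw)) dv// dw// subr0.
Qed.

Lemma mild_in_Lp_sigma v u a M : 0 < a -> 0 < M -> in_Lp_sigma p v -> in_Lp p (u a) ->
  Lp_path p a M u -> {ae mu, forall x, u a x = heat a v x - duhamel u a x} ->
  in_Lp_sigma p (u a).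
Proof.
move=> a0 M0 Lv Lu Pu ma; split => //.
apply: (weakly_div_free_sub (mild_heat_in_Lp a0 M0 Lv.1 Lu ma Pu)
  (duhamel_in_Lp a0 M0 Pu) Lu.1 _ _ ma).
- exact: (weakly_div_free_heat d3 hp a0 Lv).
- exact: (weakly_div_free_duhamel d3 hp a0 M0 Pu).
Qed.

(* Covers data with [normLp p g = 0], for which no time [t] satisfies
   [normLp p g * t `^ scal_exp d p = cp]. *)
Lemma strong_solution0 g I : in_Lp p g -> normLp p g = 0 -> (forall t, I t -> 0 < t) ->
  strong_solution p g I (fun _ _ => 0).
Proof.
move=> Lg g0 I0.
have L0 : Lpnorm p setT (fun=> 0 : V) = 0%E by exact: Lpnorm0.
have gae : {ae mu, forall x, g x = 0}.
  by apply: (Lpnorm_eq0 p1' Lg.1); rewrite -normLpK// g0.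
split.
- move=> t /I0 t0; apply: aeW => x.
  rewrite (ae_eq_heat t x Lg.1 (measurable_cst _) gae).
  have -> : duhamel (fun _ _ => 0 : V) t x = 0.
    apply/rowP => j; apply: etrans (duhamelE d3 _ _ _ _) _; rewrite mxE.
    apply: Rintegral_eq0 => s; rewrite /leray_path/=; case: ifP => _; last by rewrite mxE.
    rewrite leray_formE big1// => j' _; rewrite big1// => k _.
    by apply: Rintegral_eq0 => y; rewrite mxE mul0r mulr0.
  have -> : heat t (fun=> 0 : V) x = 0.
    apply/rowP => i; rewrite [LHS]mxE [RHS]mxE.
    by apply: Rintegral_eq0 => y; rewrite mxE mulr0.
  by rewrite subr0.
- split=> [t _|t _].
    by split; [exact: measurable_cst|rewrite L0].
  apply: (continuous_LpP I (fun _ _ => 0) t).2 => e e0; apply: filterS filterT => s _ _.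
  rewrite (_ : (fun x => _) = fun=> 0 : V); last by apply/funext => x; rewrite subrr.
  by rewrite L0 lee_fin ltW.
- by move=> t _; exists 0 => s _; rewrite L0.
Qed.

(** [local_existence_constant] speaks only of the time [s] at which equality with [cp] holds. Small
    data make [s] at least [t], and the solution is restricted. *)
Lemma strong_solution_exists cp g t : local_existence_constant d p cp ->
  in_Lp_sigma p g -> 0 < t -> normLp p g * t `^ scal_exp d p <= cp ->
  exists u, strong_solution p g `]0, t] u.
Proof.
move=> [/andP[cp0 cp1] hcp] Lg t0 gt; have al0 := scal_exp_gt0 d3 hp.
have := normLp_ge0 p g; rewrite le_eqVlt => /predU1P[/esym g0|g0].
  exists (fun _ _ => 0); apply: strong_solution0 g0 _; first exact: Lg.1.
  by move=> s; rewrite /= in_itv/= => /andP[].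
pose s := (cp / normLp p g) `^ (scal_exp d p)^-1.
have cg : 0 < cp / normLp p g by rewrite divr_gt0.
have s0 : 0 < s by rewrite powR_gt0.
have sE : s `^ scal_exp d p = cp / normLp p g.
  by rewrite /s -powRrM mulVf ?gt_eqF// powRr1// ltW.
have [|u [su _] _] := hcp g s Lg s0; first by rewrite sE mulrC divfK ?gt_eqF.
exists u; apply: strong_solution_sub su => r; rewrite /= !in_itv/= => /andP[-> rt].
rewrite (le_trans rt)//= leNgt; apply/negP => st.
have : s `^ scal_exp d p < t `^ scal_exp d p.
  by apply: gt0_ltr_powR => //; rewrite nnegrE ltW.
by rewrite sE ltr_pdivrMr// mulrC ltNge gt.
Qed.

Section gluing.
Variables (v : V -> V) (u w : R -> V -> V) (a b c : R).
Hypotheses (a0 : 0 < a) (ab : a < b) (c0 : 0 < c) (Lv : in_Lp p v).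
Hypotheses (su : strong_solution p v `]0, b] u) (sw : strong_solution p (u a) `]0, c] w).

Definition glue t : V -> V := if t <= a then u t else w (t - a).

Let Ia : `]0, b]%classic a.
Proof. by rewrite /= in_itv/= a0 ltW. Qed.

Let La : in_Lp p (u a).
Proof. by have [_ [Lu _] _] := su; exact: Lu. Qed.

Let ma : {ae mu, forall x, u a x = heat a v x - duhamel u a x}.
Proof. by have [mu_ _ _] := su; exact: mu_. Qed.

Let path_u t : 0 < t -> t <= b -> exists2 M, 0 < M & Lp_path p t M u.
Proof.
move=> t0 tb; apply: (strong_solution_path _ _ su); last by rewrite /= in_itv/= t0.
by move=> s; rewrite /= !in_itv/= => /andP[-> st]; rewrite (le_trans (ltW st)).
Qed.

Let path_w t : 0 < t -> t <= c -> exists2 M, 0 < M & Lp_path p t M w.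
Proof.
move=> t0 tb; apply: (strong_solution_path _ _ sw); last by rewrite /= in_itv/= t0.
by move=> s; rewrite /= !in_itv/= => /andP[-> st]; rewrite (le_trans (ltW st)).
Qed.

(* Both [w] and [u] evolve from [u a]; the linear parts cancel and only Duhamel terms on
   an interval of length [tau] remain. *)
Lemma glue_defect tau : 0 < tau -> tau <= c -> a + tau <= b ->
  {ae mu, forall x, w tau x - u a x =
    (u (a + tau) x - u a x) + (duhamel (fun s => u (a + s)) tau x - duhamel w tau x)}.
Proof.
move=> tau0 tauc taub; have at0 : 0 < a + tau by rewrite addr_gt0.
have [M M0 Pu] := path_u at0 taub.
have Pa : Lp_path p a M u by apply: Lp_path_le Pu; rewrite lerDl ltW.
have [mw _ _] := sw; have [mu_ _ _] := su.
have It : `]0, c]%classic tau by rewrite /= in_itv/= tau0.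
have Iat : `]0, b]%classic (a + tau) by rewrite /= in_itv/= at0.
apply: (filterS3 _ _ (mw _ It) (mu_ _ Iat) (duhamel_split d3 hp a0 tau0 M0 Pu)) => x wx ux dx.
rewrite wx (mild_restart a0 M0 Lv La ma x tau0 Pa) ux dx.
set A := heat (a + tau) v x; set B := heat tau _ x.
set C := duhamel w tau x; set D := duhamel _ tau x; set E := u a x.
clearbody A B C D E; by apply/rowP => i; rewrite !mxE; ring.
Qed.

(** [w] is compared with [u], which is continuous at [a] from the right as well because [a < b]; the
    remaining Duhamel terms are [O(tau^scal_exp)]. *)
Lemma glue_right_continuous e : 0 < e -> exists2 delta, 0 < delta &
  forall tau, 0 < tau < delta -> (Lpnorm p setT (fun x => w tau x - u a x)%R <= e%:E)%E.
Proof.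
move=> e0; have [Mu Mu0 Pu] := path_u (lt_trans a0 ab) (lexx b).
have [Mw Mw0 Pw] := path_w c0 (lexx c).
have [_ [Lu cu] _] := su; have [_ [Lw _] _] := sw.
have al0 := scal_exp_gt0 d3 hp.
pose K := duhamel_const d p * (Mu ^+ 2 + Mw ^+ 2).
have K0 : 0 < K.
  by apply: mulr_gt0; [exact: duhamel_const_gt0|rewrite addr_gt0// exprn_gt0].
have e20 : 0 < e / 2 by rewrite divr_gt0.
have [eta /= eta0 cu2] := (continuous_LpP _ u a).1 (cu a Ia) _ e20.
(* The entries ensure in turn that [u] is close to [u a], that [a + tau] stays below [b], that [tau]
   stays below [c], and that [K tau^scal_exp] is at most [e / 2]. *)
pose delta := Num.min (Num.min eta (b - a)) (Num.min c ((e / 2 / K) `^ (scal_exp d p)^-1)).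
exists delta.
  by rewrite !lt_min eta0 subr_gt0 ab c0 powR_gt0// divr_gt0.
move=> tau /andP[tau0]; rewrite !lt_min => /andP[/andP[taueta tauba] /andP[tauc tauK]].
have taub : a + tau < b by rewrite -ltrBrDl.
have at0 : 0 < a + tau by rewrite addr_gt0.
have Iat : `]0, b]%classic (a + tau) by rewrite /= in_itv/= at0 ltW.
have It : `]0, c]%classic tau by rewrite /= in_itv/= tau0 ltW.
have Pu' : Lp_path p tau Mu (fun s => u (a + s)).
  by apply: Lp_path_shift => //; apply: Lp_path_le Pu; exact: ltW.
have Pw' : Lp_path p tau Mw w by apply: Lp_path_le Pw; exact: ltW.
have Ldu := duhamel_in_Lp tau0 Mu0 Pu'; have Ldw := duhamel_in_Lp tau0 Mw0 Pw'.
have Lua := Lu _ Iat; have Lwt := Lw _ It.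
rewrite (ae_eq_Lpnorm p1' (in_LpB Lwt La).1 _ (glue_defect tau0 (ltW tauc) (ltW taub))); last first.
  exact: (in_LpD (in_LpB Lua La) (in_LpB Ldu Ldw)).1.
apply: le_trans (LpnormD p1' (in_LpB Lua La).1 (in_LpB Ldu Ldw).1) _.
rewrite (_ : e%:E = (e / 2)%:E + (e / 2)%:E)%E; last by rewrite -EFinD; congr EFin; field.
apply: leeD.
  by apply: cu2 => //; rewrite /= opprD addrA subrr sub0r normrN ger0_norm// ltW.
apply: le_trans (LpnormB p1' Ldu.1 Ldw.1) _.
apply: le_trans (leeD (Lpnorm_duhamel_le d3 hp tau0 Mu0 Pu')
  (Lpnorm_duhamel_le d3 hp tau0 Mw0 Pw')) _.
rewrite -EFinD lee_fin -mulrDr mulrAC -/K.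
have tn : tau \in Num.nneg by rewrite nnegrE ltW.
have dn : (e / 2 / K) `^ (scal_exp d p)^-1 \in Num.nneg by rewrite nnegrE powR_ge0.
have := gt0_ltr_powR al0 tn dn tauK.
rewrite -powRrM mulVf ?gt_eqF// powRr1; last by rewrite ltW// divr_gt0.
by rewrite ltr_pdivlMr// mulrC => /ltW.
Qed.

Let I : set R := `]0, (a + c)[%classic.

Let glue_left t : t <= a -> glue t = u t.
Proof. by rewrite /glue => ->. Qed.

Let glue_right t : a < t -> glue t = w (t - a).
Proof. by rewrite /glue leNgt => ->. Qed.

Lemma glue_in_Lp t : I t -> in_Lp p (glue t).
Proof.
rewrite /I/= in_itv/= => /andP[t0 tac]; have [ta|at_] := leP t a.
  rewrite glue_left//; have [_ [Lu _] _] := su; apply: Lu.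
  by rewrite /= in_itv/= t0 (le_trans ta (ltW ab)).
rewrite glue_right//; have [_ [Lw _] _] := sw; apply: Lw.
by rewrite /= in_itv/= subr_gt0 at_ lerBlDl ltW.
Qed.

Lemma glue_continuous t : I t ->
  Lpnorm p setT (fun x => glue s x - glue t x) @[s --> within I (nbhs t)] --> 0%E.
Proof.
move=> It; have := It; rewrite {1}/I/= in_itv/= => /andP[t0 tac].
have [_ [Lu cu] _] := su; have [_ [Lw cw] _] := sw.
apply: (continuous_LpP I glue t).2 => e e0.
have cont_u : t <= a -> \forall s \near t, 0 < s -> s <= a ->
    (Lpnorm p setT (fun x => glue s x - glue t x)%R <= e%:E)%E.
  move=> ta; have Ibt : `]0, b]%classic t by rewrite /= in_itv/= t0 (le_trans ta (ltW ab)).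
  have := (continuous_LpP _ u t).1 (cu t Ibt) e e0.
  apply: filterS => s us s0 sa; rewrite !glue_left//; apply: us.
  by rewrite /= in_itv/= s0 (le_trans sa (ltW ab)).
have [ta|at_|ta] := ltgtP t a.
- have : \forall s \near t, s < a by exact: lt_nbhsl.
  apply: filterS2 (cont_u (ltW ta)) => s cs sa; rewrite /I/= in_itv/= => /andP[s0 _].
  by apply: cs => //; exact: ltW.
- have Ict : `]0, c]%classic (t - a) by rewrite /= in_itv/= subr_gt0 at_ lerBlDl ltW.
  have cwt := (continuous_LpP _ w (t - a)).1 (cw _ Ict) e e0.
  have h : s - a @[s --> t] --> t - a by apply: cvgB; [exact: cvg_id|exact: cvg_cst].
  have nt : \forall s \near t, a < s by exact: lt_nbhsr.
  have cwt' : \forall s \near t, `]0, c]%classic (s - a) ->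
      (Lpnorm p setT (fun x => w (s - a) x - w (t - a) x)%R <= e%:E)%E := h _ cwt.
  apply: (filterS2 _ _ cwt' nt) => s /= cs sa; rewrite /I/= in_itv/= => /andP[s0 sac].
  rewrite !glue_right//; apply: cs.
  by rewrite in_itv/= subr_gt0 sa lerBlDl ltW.
- have [delta delta0 rc] := glue_right_continuous e0.
  have nt : \forall s \near t, s < a + delta by apply: lt_nbhsl; rewrite ta ltrDl.
  have ta' : t <= a by rewrite ta.
  apply: (filterS2 _ _ (cont_u ta') nt) => s cs sad; rewrite /I/= in_itv/= => /andP[s0 sac].
  have [sa|as_] := leP s a; first exact: cs.
  rewrite glue_right// glue_left// ta; apply: rc.
  by rewrite subr_gt0 as_/= ltrBlDl.
Qed.

Lemma glue_path t : 0 < t -> t < a + c -> exists2 M, 0 < M & Lp_path p t M glue.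
Proof.
move=> t0 tac; have [Mu Mu0 Pu] := path_u (lt_trans a0 ab) (lexx b).
have [_ _ bw] := sw; have [|Mw wM] := bw c; first by rewrite /= in_itv/= c0 lexx.
exists (Mu + `|Mw|); first by rewrite ltr_wpDr.
move=> s /andP[s0 st]; have sac := lt_trans st tac.
have Is : I s by rewrite /I/= in_itv/= s0.
split; first exact: glue_in_Lp.
- have [sa|as_] := leP s a.
    rewrite glue_left//; have [|_ h _] := Pu s; first by rewrite s0 (le_lt_trans sa).
    by apply: (le_trans h); rewrite lee_fin lerDl.
  rewrite glue_right//; apply: (le_trans (wM _ _)).
    by rewrite subr_gt0 as_/= ltrBlDl.
  by rewrite lee_fin (le_trans (ler_norm _))// lerDr ltW.
apply/cvge0P => [r|e e0]; first exact: Lpnorm_ge0.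
have := (continuous_LpP I glue s).1 (glue_continuous Is) e e0.
have : \forall r \near s, 0 < r < a + c.
  have := @near_in_itvoo R 0 (a + c) s; rewrite in_itv/= s0 sac => /(_ isT).
  by apply: filterS => r; rewrite in_itv.
by apply: filterS2 => r rt; apply; rewrite /I/= in_itv.
Qed.

(** Beyond [a], [duhamel_split] separates the past of [u] from the Duhamel term of [w], and the heat
    flow of that past recombines with that of [v] into the heat flow of [u a]. The splitting asks
    for a path continuous in time, so continuity at [a] has to be settled first. *)
Lemma glue_mild : mild_solution v I glue.
Proof.
move=> t; rewrite /I/= in_itv/= => /andP[t0 tac].
have [mu_ _ _] := su; have [mw _ _] := sw; have [ta|at_] := leP t a.
  have Ibt : `]0, b]%classic t by rewrite /= in_itv/= t0 (le_trans ta (ltW ab)).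
  have E0 : duhamel glue t = duhamel u t :> (V -> V).
    by apply: eq_duhamel => s /andP[_ st]; rewrite glue_left// (le_trans (ltW st)).
  by apply: filterS (mu_ t Ibt) => x h; rewrite E0 (glue_left ta) h.
pose tau := t - a; have tau0 : 0 < tau by rewrite subr_gt0.
have tE : t = a + tau by rewrite addrC subrK.
have Itau : `]0, c]%classic tau by rewrite /= in_itv/= tau0 lerBlDl ltW.
have [M M0 P] := glue_path t0 tac; rewrite tE in P.
have [Mu Mu0 Pu] := path_u a0 (ltW ab).
have E1 : duhamel glue a = duhamel u a :> (V -> V).
  by apply: eq_duhamel => s /andP[_ sa]; rewrite glue_left// ltW.
have E2 : duhamel (fun s => glue (a + s)) tau = duhamel w tau :> (V -> V).
  apply: eq_duhamel => s /andP[s0 _]; rewrite glue_right; last by rewrite ltrDl.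
  by rewrite addrAC subrr add0r.
have Gt : glue t = w tau := glue_right at_.
apply: (filterS2 _ _ (mw _ Itau) (duhamel_split d3 hp a0 tau0 M0 P)) => x wx dx.
rewrite Gt wx [in RHS]tE dx E1 E2 (mild_restart a0 Mu0 Lv La ma x tau0 Pu).
have subrBD (A B C : V) : A - B - C = A - (B + C) by rewrite opprD addrA.
exact: subrBD.
Qed.

Lemma glue_strong : strong_solution p v I glue.
Proof.
split; [exact: glue_mild|split; [exact: glue_in_Lp|exact: glue_continuous]|].
move=> t; rewrite /I/= in_itv/= => /andP[t0 tac].
by have [M _ P] := glue_path t0 tac; exists M => s /P[].
Qed.

End gluing.

End strong_solutions.

(** * Choice of the constant and conclusion *)

Section sparse_data.
Variables (R : realType) (d : nat) (p : \bar R).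
Hypotheses (d3 : (3 <= d)%N) (hp : (d%:R%:E < p)%E).
Local Notation V := 'rV[R]_d.

(** The 8 compensates the one in [exp(- lbar^2 / 8)], which is then at most [gamma / C0]; twice
    [sparse_const] brings the sum of the three contributions below [gamma / 2]. *)
Definition sparse_threshold : R := 8 + 2 * sparse_const R d.

Lemma sparse_const_gt0 : 0 < sparse_const R d.
Proof.
have d0 : (0 : R) < d%:R by rewrite ltr0n (leq_trans _ d3).
rewrite /sparse_const -lock; apply: mulr_gt0 => //.
by rewrite addr_gt0 ?ltr_pwDl ?powR_ge0// mulr_gt0 ?exprn_gt0// sup_const_gt0.
Qed.

Lemma sparse_heat_coeff_le (gamma eps beta lbar : R) : 0 < gamma < 1 -> 0 < eps -> 0 < lbar ->
  sparse_threshold * ln (sparse_threshold / gamma) <= lbar ^+ 2 ->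
  beta = sparse_threshold^-1 * gamma ->
  eps `^ (1 - inv_exp p) <= sparse_threshold^-1 * gamma / lbar ^+ d ->
  d%:R * (beta + 2 `^ (d%:R / 2) * expR (- (lbar ^+ 2 / 8)) +
     sup_const R d * 2 ^+ d * lbar ^+ d * eps `^ (1 - inv_exp p)) <= gamma / 2.
Proof.
move=> /andP[g0 g1] e0 l0; set C := sparse_threshold => lC bE eC.
have sc0 := sparse_const_gt0.
have C8 : 8 <= C by rewrite lerDl mulr_ge0// ltW.
have C0 : 0 < C by rewrite (lt_le_trans _ C8).
have Cg0 : 0 < C / gamma by rewrite divr_gt0.
have ln0 : 0 <= ln (C / gamma).
  by rewrite ln_ge0// ler_pdivlMr// mul1r (le_trans (ltW g1))// (le_trans _ C8)// ler1n.
have expl : expR (- (lbar ^+ 2 / 8)) <= C^-1 * gamma.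
  have -> : C^-1 * gamma = expR (- ln (C / gamma)).
    by rewrite expRN lnK ?posrE// invf_div mulrC.
  rewrite ler_expR lerN2 ler_pdivlMr// mulrC (le_trans _ lC)//.
  exact: ler_wpM2r.
have supl : sup_const R d * 2 ^+ d * lbar ^+ d * eps `^ (1 - inv_exp p) <=
    sup_const R d * 2 ^+ d * (C^-1 * gamma).
  rewrite -mulrA; apply: ler_wpM2l.
    by rewrite mulr_ge0 ?exprn_ge0// ltW// sup_const_gt0.
  by rewrite mulrC -ler_pdivlMr// exprn_gt0.
apply: (@le_trans _ _ (sparse_const R d * (C^-1 * gamma))).
  rewrite /sparse_const -lock -[leRHS]mulrA; apply: ler_wpM2l; first by [].
  rewrite bE !mulrDl mul1r; apply: lerD => //; apply: lerD => //.
  by apply: ler_wpM2l => //; exact: powR_ge0.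
rewrite mulrA [leRHS]mulrC; apply: ler_wpM2r; first exact: ltW.
rewrite ler_pdivrMr// ler_pdivlMl//.
by rewrite /C /sparse_threshold lerDr.
Qed.

End sparse_data.

Theorem theorem1p2 (R : realType) (d : nat) (hd : (3 <= d)%N)
    (p : \bar R) (hp : (d%:R%:E < p)%E)
    (cp C1 : R) (hcp : local_existence_constant d p cp)
    (hC1 : bilinear_constant d p cp C1) :
  exists2 C0 : R, 1 <= C0 &
  forall (u0 : 'rV[R]_d -> 'rV[R]_d) (Tbar T0 gamma T1 eps beta lbar : R),
    in_Lp_sigma p u0 ->
    0 < Tbar -> normLp p u0 * Tbar `^ scal_exp d p = cp ->
    Tbar < T0 ->
    normLp p u0 * T0 `^ scal_exp d p * gamma = cp ->
    0 < T1 -> normLp p u0 * T1 `^ scal_exp d p = gamma / (2 * C1) ->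
    0 < eps < 1 -> 0 < beta < 1 -> 0 < lbar ->
    sparse eps beta (Num.sqrt T1 * lbar) p u0 ->
    C0 * ln (C0 / gamma) <= lbar ^+ 2 ->
    beta = C0^-1 * gamma ->
    eps `^ (1 - inv_exp p) <= C0^-1 * gamma / lbar ^+ d ->
  (T0%:E < max_existence_time p u0)%E.
Proof.
have p1 := exponent_gt1 hd hp; have p1' := ltW p1.
exists (sparse_threshold R d).
  rewrite /sparse_threshold (@le_trans _ _ 8) ?ler1n// lerDl mulr_ge0//.
  by rewrite ltW// (sparse_const_gt0 R hd).
move=> u0 Tbar T0 gamma T1 eps beta lbar Lu0 Tbar0 TbarE TbarT0 gammaE T10 T1E
  /andP[eps0 _] _ lbar0 sp lbarC betaE epsC.
have al0 := scal_exp_gt0 hd hp; set al := scal_exp d p in al0 TbarE gammaE T1E *.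
have [/andP[cp0 cp1] lec] := hcp; have [C1cp bil] := hC1.
set N := normLp p u0 in TbarE gammaE T1E *.
have N0 : 0 < N.
  rewrite lt_neqAle eq_sym normLp_ge0 andbT; apply: contraTneq cp0 => N0.
  by rewrite -TbarE N0 mul0r ltxx.
have T00 : 0 < T0 by rewrite (lt_trans Tbar0).
have powlt s t : 0 < s -> s < t -> s `^ al < t `^ al.
  move=> s0 st; apply: gt0_ltr_powR => //; rewrite nnegrE ltW//.
  exact: lt_trans st.
have g0 : 0 < gamma.
  by move: cp0; rewrite -gammaE pmulr_rgt0// mulr_gt0// powR_gt0.
have g1 : gamma < 1.
  rewrite -(ltr_pM2l (x := N * T0 `^ al)) ?mulr_gt0 ?powR_gt0//.
  by rewrite gammaE mulr1 -TbarE ltr_pM2l// powlt.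
have C10 : 0 < C1 by rewrite (lt_le_trans _ C1cp)// invr_gt0 mulr_gt0.
(* [N T1^al = gamma / (2 C1) < 1 / (2 C1) <= cp = N Tbar^al], by the lower bound on [C1]. The strict
   inequality leaves [u] some room after [T1] for the gluing. *)
have T1Tbar : T1 < Tbar.
  rewrite ltNge; apply/negP => TT.
  have : N * Tbar `^ al <= N * T1 `^ al.
    rewrite ler_pM2l//; move: TT; rewrite le_eqVlt => /predU1P[->//|/(powlt _ _ Tbar0)].
    exact: ltW.
  rewrite TbarE T1E leNgt => /negP; apply.
  apply: (@lt_le_trans _ _ (1 / (2 * C1))).
    by rewrite ltr_pM2r// invr_gt0 mulr_gt0.
  rewrite mul1r -[leRHS]invrK lef_pV2 ?posrE ?invr_gt0 ?mulr_gt0//.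
  by move: C1cp; rewrite invfM ler_pdivrMl.
have [u [su _] _] := lec u0 Tbar Lu0 Tbar0 TbarE.
have IT1 : `]0, Tbar]%classic T1 by rewrite /= in_itv/= T10 ltW.
have [M M0 Pu] : exists2 M, 0 < M & Lp_path p T1 M u.
  apply: (strong_solution_path _ IT1 su) => s; rewrite /= !in_itv/= => /andP[-> sT].
  exact: ltW (lt_trans sT T1Tbar).
have [mu_ [Lu _] _] := su.
have mT1 := mu_ T1 IT1; have LT1 := Lu T1 IT1.
have gL : in_Lp_sigma p (u T1) by exact: (mild_in_Lp_sigma hd hp T10 M0 Lu0 LT1 Pu mT1).
have Lh := mild_heat_in_Lp hd hp T10 M0 Lu0.1 LT1 mT1 Pu.
have Ld := duhamel_in_Lp hd hp T10 M0 Pu.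
have NE : (N%:E = Lpnorm p setT u0)%E by rewrite /N normLpK//; exact: Lu0.1.
have heat_le : (Lpnorm p setT (heat T1 u0) <= (gamma / 2 * N)%:E)%E.
  apply: le_trans (Lpnorm_heat_sparse p1 T10 eps0 lbar0 Lu0.1 sp) _.
  rewrite [leRHS]EFinM NE; apply: lee_wpmul2r; first exact: Lpnorm_ge0.
  by rewrite lee_fin sparse_heat_coeff_le// g0 g1.
have duh_le : (Lpnorm p setT (duhamel u T1) <= (gamma / 2 * N)%:E)%E.
  have T1in : 0 < T1 < Tbar by rewrite T10.
  apply: le_trans (bil u0 Tbar u Lu0 Tbar0 TbarE su T1 T1in) _.
  rewrite -/N -/al lee_fin (_ : C1 * _ * _ = C1 * N * (N * T1 `^ al)); last by ring.
  by rewrite T1E le_eqVlt; apply/orP; left; apply/eqP; field; rewrite gt_eqF.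
have gN : normLp p (u T1) <= gamma * N.
  rewrite -lee_fin normLpK//.
  rewrite (ae_eq_Lpnorm p1' LT1.1 (in_LpB hd hp Lh Ld).1 mT1).
  apply: le_trans (LpnormB p1' Lh.1 Ld.1) _.
  apply: le_trans (leeD heat_le duh_le) _.
  by rewrite -EFinD lee_fin le_eqVlt; apply/orP; left; apply/eqP; field.
(* The definition of [gamma] reads [gamma N T0^al = cp], so data of norm at most [gamma N] are
   guaranteed to live up to [T0]. *)
have [w sw] : exists w, strong_solution p (u T1) `]0, T0] w.
  apply: (strong_solution_exists hd hp hcp gL T00).
  rewrite -gammaE mulrAC [N * gamma]mulrC -/al.
  by apply: ler_wpM2r; first exact: powR_ge0.
apply: (@lt_le_trans _ _ (T1 + T0)%:E); first by rewrite lte_fin ltrDr.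
apply: ereal_sup_ubound; exists (T1 + T0) => //; split; first by rewrite addr_gt0.
exists (glue u w T1).
exact: (glue_strong hd hp T10 T1Tbar T00 Lu0.1 su sw).
Qed.
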